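(* Let $\mathbb{D}$ be a monoidal double category whose monoidal constraints (the associativity and unit transformations and, in the braided or symmetric case, the braiding) have loosely strong companions. Then its underlying (loose) bicategory $\mathcal{L}(\mathbb{D})$ is a monoidal bicategory. If $\mathbb{D}$ is braided, then $\mathcal{L}(\mathbb{D})$ is a braided monoidal bicategory, and if $\mathbb{D}$ is symmetric, then $\mathcal{L}(\mathbb{D})$ is a symmetric monoidal bicategory.
   Context: A double category $\mathbb{D}$ means a pseudo double category: a category $\mathbb{D}_0$ of objects and tight 1-cells $f\colon A\to B$, a category $\mathbb{D}_1$ of loose 1-cells $M\colon A\nrightarrow B$ and 2-cells, source/target functors $S,T\colon\mathbb{D}_1\to\mathbb{D}_0$, units $U_A\colon A\nrightarrow A$, and a loose composition $N\odot M\colon A\nrightarrow C$ for $M\colon A\nrightarrow B$, $N\colon B\nrightarrow C$, which is associative and unital up to coherent globular isomorphisms (a 2-cell $\alpha$ is globular if $S(\alpha)$ and $T(\alpha)$ are identities). Composition of tight 1-cells is strict. A functor of double categories is a pseudo double functor (preserving $\odot$ and $U$ up to coherent globular isomorphism). A transformation $\alpha\colon F\to G\colon\mathbb{D}\to\mathbb{E}$ is a tight transformation: natural transformations $\alpha_0\colon F_0\to G_0$, $\alpha_1\colon F_1\to G_1$ compatible with $S,T$ and with the constraints for $\odot$ and $U$; it has tight components $\alpha_A\colon FA\to GA$ and 2-cell components $\alpha_M\colon FM\to GM$. These form a strict 2-category $\mathcal{D}bl$ with finite products. The loose bicategory $\mathcal{L}(\mathbb{D})$ has the objects, the loose 1-cells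 and the globular 2-cells of $\mathbb{D}$; a functor $F$ induces a pseudofunctor $\mathcal{L}(F)$. A monoidal (braided, symmetric) double category is a pseudomonoid (braided, symmetric pseudomonoid) in $\mathcal{D}bl$: functors $\otimes\colon\mathbb{D}\times\mathbb{D}\to\mathbb{D}$, $I\colon *\to\mathbb{D}$, and invertible transformations for associativity and units (and a braiding $\otimes\cong\otimes\circ\tau$, with $\tau$ the twist) satisfying the usual axioms of a (braided, symmetric) monoidal category. A companion of a tight $f\colon A\to B$ is a loose 1-cell $\hat f\colon A\nrightarrow B$ with 2-cells $\epsilon_{\hat f}\colon\hat f\to U_B$ ($S(\epsilon_{\hat f})=f$, $T(\epsilon_{\hat f})=1_B$) and $\eta_{\hat f}\colon U_A\to\hat f$ ($S(\eta_{\hat f})=1_A$, $T(\eta_{\hat f})=f$) such that $\epsilon_{\hat f}\circ\eta_{\hat f}=U_f$ and $\epsilon_{\hat f}\odot\eta_{\hat f}=1_{\hat f}$ (modulo unit isomorphisms). If every component $\alpha_A$ of a transformation $\alpha\colon F\to G$ has a companion $\hat\alpha_A$, then $\alpha$ induces an oplax transformation $\hat\alpha\colon\mathcal{L}(F)\to\mathcal{L}(G)$ with 1-cell components $\hat\alpha_A$ and, at $M\colon A\nrightarrow B$, 2-cell component $\epsilon_{\hat\alpha_B}\odot\alpha_M\odot\eta_{\hat\alpha_A}\colon\hat\alpha_B\odot FM\to GM\odot\hat\alpha_A$ (modulo unit isomorphisms). The transformation $\alpha$ has loosely strong companions if each $\alpha_A$ has a companion and $\hat\alpha$ is pseudonatural.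 Monoidal, braided monoidal and symmetric monoidal bicategories are understood in the standard (one-object tricategory; McCrudden/Gurski) sense. The structure on $\mathcal{L}(\mathbb{D})$ is the one inherited from $\mathbb{D}$: tensor product $\mathcal{L}(\otimes)$, unit object $I$, and constraint equivalences obtained as companions of the tight constraints of $\mathbb{D}$.
   Formalization: The hypothesis ''have loosely strong companions'' is required of each monoidal constraint (and the braiding) and also of its inverse; with companions for one direction only, the inherited constraints need not be equivalences and the claim fails. *)

(* Defs.v *)
From Corelib Require Import ssreflect ssrfun ssrbool.

Set Implicit Arguments.
Unset Strict Implicit.
Unset Printing Implicit Defensive.

(** * Bicategories

    Bicategories, pseudofunctors and pseudonatural transformations are given as
    raw data ([bicat], [psfun], [psnat]) together with predicates [is_bicat],
    [is_psfun], [is_psnat] collecting the axioms.  Each constraint cell comes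
    with a cell (written with a prime) that the axioms require to be its
    inverse. *)

Declare Scope bicat_scope.
Delimit Scope bicat_scope with bicat.
Local Open Scope bicat_scope.

Record bicat := Bicat {
  ob :> Type;
  hom : ob -> ob -> Type;
  two : forall A B : ob, hom A B -> hom A B -> Type;
  id1 : forall A : ob, hom A A;
  comp1 : forall A B C : ob, hom B C -> hom A B -> hom A C;
  id2 : forall (A B : ob) (f : hom A B), two f f;
  vcomp : forall (A B : ob) (f g h : hom A B), two g h -> two f g -> two f h;
  hcomp : forall (A B C : ob) (f f' : hom A B) (g g' : hom B C),
    two g g' -> two f f' -> two (comp1 g f) (comp1 g' f');
  assoc : forall (A B C D : ob) (f : hom A B) (g : hom B C) (h : hom C D),
    two (comp1 (comp1 h g) f) (comp1 h (comp1 g f));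
  assoc' : forall (A B C D : ob) (f : hom A B) (g : hom B C) (h : hom C D),
    two (comp1 h (comp1 g f)) (comp1 (comp1 h g) f);
  lunit : forall (A B : ob) (f : hom A B), two (comp1 (id1 B) f) f;
  lunit' : forall (A B : ob) (f : hom A B), two f (comp1 (id1 B) f);
  runit : forall (A B : ob) (f : hom A B), two (comp1 f (id1 A)) f;
  runit' : forall (A B : ob) (f : hom A B), two f (comp1 f (id1 A))
}.

Arguments id1 {b} A.
Arguments id2 {b A B} f.
Arguments assoc {b A B C D} f g h.
Arguments assoc' {b A B C D} f g h.
Arguments lunit {b A B} f.
Arguments lunit' {b A B} f.
Arguments runit {b A B} f.
Arguments runit' {b A B} f.

Notation "g ∘ f" := (comp1 g f) (at level 40, left associativity) : bicat_scope.
Notation "f ⇒ g" := (two f g) (at level 70, no associativity) : bicat_scope.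
Notation "β • α" := (vcomp β α) (at level 50, left associativity) : bicat_scope.
Notation "β ∗ α" := (hcomp β α) (at level 40, left associativity) : bicat_scope.

Definition inverse2 (B : bicat) (X Y : B) (f g : hom X Y)
    (α : f ⇒ g) (β : g ⇒ f) : Prop :=
  β • α = id2 f /\ α • β = id2 g.

Record is_bicat (B : bicat) : Prop := IsBicat {
  vcompA : forall (X Y : B) (f g h k : hom X Y) (α : f ⇒ g) (β : g ⇒ h) (γ : h ⇒ k),
    γ • (β • α) = (γ • β) • α;
  vcomp1l : forall (X Y : B) (f g : hom X Y) (α : f ⇒ g), id2 g • α = α;
  vcomp1r : forall (X Y : B) (f g : hom X Y) (α : f ⇒ g), α • id2 f = α;
  hcomp_id : forall (X Y Z : B) (f : hom X Y) (g : hom Y Z),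
    id2 g ∗ id2 f = id2 (g ∘ f);
  interchange : forall (X Y Z : B) (f f' f'' : hom X Y) (g g' g'' : hom Y Z)
      (α : f ⇒ f') (α' : f' ⇒ f'') (β : g ⇒ g') (β' : g' ⇒ g''),
    (β' • β) ∗ (α' • α) = (β' ∗ α') • (β ∗ α);
  assoc_inv : forall (X Y Z W : B) (f : hom X Y) (g : hom Y Z) (h : hom Z W),
    inverse2 (assoc f g h) (assoc' f g h);
  lunit_inv : forall (X Y : B) (f : hom X Y), inverse2 (lunit f) (lunit' f);
  runit_inv : forall (X Y : B) (f : hom X Y), inverse2 (runit f) (runit' f);
  assoc_nat : forall (X Y Z W : B) (f f' : hom X Y) (g g' : hom Y Z) (h h' : hom Z W)
      (α : f ⇒ f') (β : g ⇒ g') (γ : h ⇒ h'),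
    assoc f' g' h' • ((γ ∗ β) ∗ α) = (γ ∗ (β ∗ α)) • assoc f g h;
  lunit_nat : forall (X Y : B) (f f' : hom X Y) (α : f ⇒ f'),
    lunit f' • (id2 (id1 Y) ∗ α) = α • lunit f;
  runit_nat : forall (X Y : B) (f f' : hom X Y) (α : f ⇒ f'),
    runit f' • (α ∗ id2 (id1 X)) = α • runit f;
  pentagon : forall (X Y Z W V : B)
      (f : hom X Y) (g : hom Y Z) (h : hom Z W) (k : hom W V),
    assoc (g ∘ f) h k • assoc f g (k ∘ h)
    = (id2 k ∗ assoc f g h) • assoc f (h ∘ g) k • (assoc g h k ∗ id2 f);
  triangle : forall (X Y Z : B) (f : hom X Y) (g : hom Y Z),
    (id2 g ∗ lunit f) • assoc f (id1 Y) g = runit g ∗ id2 f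
}.

(** ** Pseudofunctors *)

Record psfun (B C : bicat) := PsFun {
  psf0 :> B -> C;
  psf1 : forall X Y : B, hom X Y -> hom (psf0 X) (psf0 Y);
  psf2 : forall (X Y : B) (f g : hom X Y), f ⇒ g -> psf1 f ⇒ psf1 g;
  psfC : forall (X Y Z : B) (f : hom X Y) (g : hom Y Z),
    psf1 g ∘ psf1 f ⇒ psf1 (g ∘ f);
  psfC' : forall (X Y Z : B) (f : hom X Y) (g : hom Y Z),
    psf1 (g ∘ f) ⇒ psf1 g ∘ psf1 f;
  psfU : forall X : B, id1 (psf0 X) ⇒ psf1 (id1 X);
  psfU' : forall X : B, psf1 (id1 X) ⇒ id1 (psf0 X)
}.

Arguments psf1 {B C} p {X Y} f.
Arguments psf2 {B C} p {X Y f g} α : rename.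
Arguments psfC {B C} p {X Y Z} f g.
Arguments psfC' {B C} p {X Y Z} f g.
Arguments psfU {B C} p X.
Arguments psfU' {B C} p X.

Record is_psfun (B C : bicat) (F : psfun B C) : Prop := IsPsFun {
  psf2_id : forall (X Y : B) (f : hom X Y), psf2 F (id2 f) = id2 (psf1 F f);
  psf2_comp : forall (X Y : B) (f g h : hom X Y) (α : f ⇒ g) (β : g ⇒ h),
    psf2 F (β • α) = psf2 F β • psf2 F α;
  psfC_inv : forall (X Y Z : B) (f : hom X Y) (g : hom Y Z),
    inverse2 (psfC F f g) (psfC' F f g);
  psfU_inv : forall X : B, inverse2 (psfU F X) (psfU' F X);
  psfC_nat : forall (X Y Z : B) (f f' : hom X Y) (g g' : hom Y Z)
      (α : f ⇒ f') (β : g ⇒ g'),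
    psfC F f' g' • (psf2 F β ∗ psf2 F α) = psf2 F (β ∗ α) • psfC F f g;
  psfC_assoc : forall (X Y Z W : B) (f : hom X Y) (g : hom Y Z) (h : hom Z W),
    psf2 F (assoc f g h) • psfC F f (h ∘ g) • (psfC F g h ∗ id2 (psf1 F f))
    = psfC F (g ∘ f) h • (id2 (psf1 F h) ∗ psfC F f g)
      • assoc (psf1 F f) (psf1 F g) (psf1 F h);
  psfC_lunit : forall (X Y : B) (f : hom X Y),
    psf2 F (lunit f) • psfC F f (id1 Y) • (psfU F Y ∗ id2 (psf1 F f))
    = lunit (psf1 F f);
  psfC_runit : forall (X Y : B) (f : hom X Y),
    psf2 F (runit f) • psfC F (id1 X) f • (id2 (psf1 F f) ∗ psfU F X)
    = runit (psf1 F f)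
}.

Definition bprod (B C : bicat) : bicat := {|
  ob := ob B * ob C;
  hom X Y := (hom X.1 Y.1 * hom X.2 Y.2)%type;
  two X Y f g := ((f.1 ⇒ g.1) * (f.2 ⇒ g.2))%type;
  id1 X := (id1 X.1, id1 X.2);
  comp1 X Y Z g f := (g.1 ∘ f.1, g.2 ∘ f.2);
  id2 X Y f := (id2 f.1, id2 f.2);
  vcomp X Y f g h β α := (β.1 • α.1, β.2 • α.2);
  hcomp X Y Z f f' g g' β α := (β.1 ∗ α.1, β.2 ∗ α.2);
  assoc X Y Z W f g h := (assoc f.1 g.1 h.1, assoc f.2 g.2 h.2);
  assoc' X Y Z W f g h := (assoc' f.1 g.1 h.1, assoc' f.2 g.2 h.2);
  lunit X Y f := (lunit f.1, lunit f.2);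
  lunit' X Y f := (lunit' f.1, lunit' f.2);
  runit X Y f := (runit f.1, runit f.2);
  runit' X Y f := (runit' f.1, runit' f.2)
|}.

Definition bterm : bicat := {|
  ob := unit;
  hom _ _ := unit;
  two _ _ _ _ := unit;
  id1 _ := tt;
  comp1 _ _ _ _ _ := tt;
  id2 _ _ _ := tt;
  vcomp _ _ _ _ _ _ _ := tt;
  hcomp _ _ _ _ _ _ _ _ _ := tt;
  assoc _ _ _ _ _ _ _ := tt;
  assoc' _ _ _ _ _ _ _ := tt;
  lunit _ _ _ := tt;
  lunit' _ _ _ := tt;
  runit _ _ _ := tt;
  runit' _ _ _ := tt
|}.

Definition psf_id (B : bicat) : psfun B B := {|
  psf0 X := X;
  psf1 X Y f := f;
  psf2 X Y f g α := α;
  psfC X Y Z f g := id2 (g ∘ f);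
  psfC' X Y Z f g := id2 (g ∘ f);
  psfU X := id2 (id1 X);
  psfU' X := id2 (id1 X)
|}.

Definition psf_comp (B C D : bicat) (G : psfun C D) (F : psfun B C) : psfun B D := {|
  psf0 X := G (F X);
  psf1 X Y f := psf1 G (psf1 F f);
  psf2 X Y f g α := psf2 G (psf2 F α);
  psfC X Y Z f g := psf2 G (psfC F f g) • psfC G (psf1 F f) (psf1 F g);
  psfC' X Y Z f g := psfC' G (psf1 F f) (psf1 F g) • psf2 G (psfC' F f g);
  psfU X := psf2 G (psfU F X) • psfU G (F X);
  psfU' X := psfU' G (F X) • psf2 G (psfU' F X)
|}.

Definition psf_pair (B C D : bicat) (F : psfun B C) (G : psfun B D) :
    psfun B (bprod C D) := {|
  psf0 X := (F X, G X) : bprod C D;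
  psf1 X Y f := (psf1 F f, psf1 G f);
  psf2 X Y f g α := (psf2 F α, psf2 G α);
  psfC X Y Z f g := (psfC F f g, psfC G f g);
  psfC' X Y Z f g := (psfC' F f g, psfC' G f g);
  psfU X := (psfU F X, psfU G X);
  psfU' X := (psfU' F X, psfU' G X)
|}.

Definition psf_fst (B C : bicat) : psfun (bprod B C) B := {|
  psf0 (X : bprod B C) := X.1;
  psf1 X Y f := f.1;
  psf2 X Y f g α := α.1;
  psfC X Y Z f g := id2 (g.1 ∘ f.1);
  psfC' X Y Z f g := id2 (g.1 ∘ f.1);
  psfU X := id2 (id1 X.1);
  psfU' X := id2 (id1 X.1)
|}.

Definition psf_snd (B C : bicat) : psfun (bprod B C) C := {|
  psf0 (X : bprod B C) := X.2;
  psf1 X Y f := f.2;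
  psf2 X Y f g α := α.2;
  psfC X Y Z f g := id2 (g.2 ∘ f.2);
  psfC' X Y Z f g := id2 (g.2 ∘ f.2);
  psfU X := id2 (id1 X.2);
  psfU' X := id2 (id1 X.2)
|}.

Definition psf_bang (B : bicat) : psfun B bterm := {|
  psf0 _ := tt : bterm;
  psf1 _ _ _ := tt;
  psf2 _ _ _ _ _ := tt;
  psfC _ _ _ _ _ := tt;
  psfC' _ _ _ _ _ := tt;
  psfU _ := tt;
  psfU' _ := tt
|}.

Definition psf_const (B C : bicat) (A : C) : psfun B C := {|
  psf0 _ := A;
  psf1 _ _ _ := id1 A;
  psf2 _ _ _ _ _ := id2 (id1 A);
  psfC _ _ _ _ _ := lunit (id1 A);
  psfC' _ _ _ _ _ := lunit' (id1 A);
  psfU _ := id2 (id1 A);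
  psfU' _ := id2 (id1 A)
|}.
Arguments psf_const B {C} A.

(** ** Pseudonatural transformations and modifications

    The naturality cell has the oplax orientation used for companions. *)

Record psnat (B C : bicat) (F G : psfun B C) := PsNat {
  pn1 :> forall X : B, hom (F X) (G X);
  pn2 : forall (X Y : B) (f : hom X Y), pn1 Y ∘ psf1 F f ⇒ psf1 G f ∘ pn1 X;
  pn2' : forall (X Y : B) (f : hom X Y), psf1 G f ∘ pn1 X ⇒ pn1 Y ∘ psf1 F f
}.

Arguments pn2 {B C F G} p {X Y} f.
Arguments pn2' {B C F G} p {X Y} f.

Record is_psnat (B C : bicat) (F G : psfun B C) (θ : psnat F G) : Prop := IsPsNat {
  pn2_inv : forall (X Y : B) (f : hom X Y), inverse2 (pn2 θ f) (pn2' θ f);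
  pn2_nat : forall (X Y : B) (f f' : hom X Y) (α : f ⇒ f'),
    (psf2 G α ∗ id2 (θ X)) • pn2 θ f = pn2 θ f' • (id2 (θ Y) ∗ psf2 F α);
  pn2_comp : forall (X Y Z : B) (f : hom X Y) (g : hom Y Z),
    pn2 θ (g ∘ f) • (id2 (θ Z) ∗ psfC F f g)
    = (psfC G f g ∗ id2 (θ X))
      • assoc' (θ X) (psf1 G f) (psf1 G g)
      • (id2 (psf1 G g) ∗ pn2 θ f)
      • assoc (psf1 F f) (θ Y) (psf1 G g)
      • (pn2 θ g ∗ id2 (psf1 F f))
      • assoc' (psf1 F f) (psf1 F g) (θ Z);
  pn2_unit : forall X : B,
    pn2 θ (id1 X) • (id2 (θ X) ∗ psfU F X)
    = (psfU G X ∗ id2 (θ X)) • lunit' (θ X) • runit (θ X)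
}.

Definition pn_id (B C : bicat) (F : psfun B C) : psnat F F := {|
  pn1 X := id1 (F X);
  pn2 X Y f := runit' (psf1 F f) • lunit (psf1 F f);
  pn2' X Y f := lunit' (psf1 F f) • runit (psf1 F f)
|}.

Definition pn_comp (B C : bicat) (F G H : psfun B C)
    (θ' : psnat G H) (θ : psnat F G) : psnat F H := {|
  pn1 X := θ' X ∘ θ X;
  pn2 X Y f :=
    assoc (θ X) (θ' X) (psf1 H f) • (pn2 θ' f ∗ id2 (θ X))
    • assoc' (θ X) (psf1 G f) (θ' Y) • (id2 (θ' Y) ∗ pn2 θ f)
    • assoc (psf1 F f) (θ Y) (θ' Y);
  pn2' X Y f :=
    assoc' (psf1 F f) (θ Y) (θ' Y) • (id2 (θ' Y) ∗ pn2' θ f)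
    • assoc (θ X) (psf1 G f) (θ' Y) • (pn2' θ' f ∗ id2 (θ X))
    • assoc' (θ X) (θ' X) (psf1 H f)
|}.

(** Invertible modifications. *)
Record imod (B C : bicat) (F G : psfun B C) (θ θ' : psnat F G) := IMod {
  md :> forall X : B, θ X ⇒ θ' X;
  md' : forall X : B, θ' X ⇒ θ X;
  md_inv : forall X : B, inverse2 (md X) (md' X);
  md_nat : forall (X Y : B) (f : hom X Y),
    (id2 (psf1 G f) ∗ md X) • pn2 θ f = pn2 θ' f • (md Y ∗ id2 (psf1 F f))
}.

(** ** Pasting along paths of 1-cells

    To write pasting diagrams without explicit associators we use composable
    lists of 1-cells, written in diagrammatic order, and 2-cells between their
    composites; [whisk p α r] is [α] whiskered by the paths [p] and [r], with
    the coherence isomorphisms inserted.  For example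
    [pc ⟪ f ; g ; h ⟫] is [(h ∘ g) ∘ f]. *)

Inductive path (B : bicat) : B -> B -> Type :=
| pnil (X : B) : path X X
| pcons (X Y Z : B) (f : hom X Y) (p : path Y Z) : path X Z.
Arguments pnil {B X}.

Notation "⟪ ⟫" := pnil (format "⟪ ⟫") : bicat_scope.
Notation "⟪ f ; .. ; g ⟫" := (pcons f .. (pcons g pnil) ..) : bicat_scope.

Section Paths.
Variable B : bicat.

Fixpoint pc1 (Y Z : B) (p : path Y Z) : forall X : B, hom X Y -> hom X Z :=
  match p in path Y Z return forall X : B, hom X Y -> hom X Z with
  | pnil => fun _ f => f
  | pcons g q => fun _ f => pc1 q g ∘ f
  end.

Definition pc (X Y : B) (p : path X Y) : hom X Y :=
  match p with
  | @pnil _ X => id1 X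
  | pcons f q => pc1 q f
  end.

Fixpoint pcat (X Y Z : B) (p : path X Y) : path Y Z -> path X Z :=
  match p in path X Y return path Y Z -> path X Z with
  | pnil => fun q => q
  | pcons f p' => fun q => pcons f (pcat p' q)
  end.

Definition pcell (X Y : B) (p q : path X Y) : Type := pc p ⇒ pc q.

Definition pid (X Y : B) (p : path X Y) : pcell p p := id2 (pc p).

Definition pseq (X Y : B) (p q r : path X Y) (α : pcell p q) (β : pcell q r) :
  pcell p r := β • α.

Definition split1_nil (Y Z : B) (q : path Y Z) :
    forall (X : B) (f : hom X Y), pc1 q f ⇒ pc q ∘ f :=
  match q in path Y Z return forall (X : B) (f : hom X Y), pc1 q f ⇒ pc q ∘ f with
  | pnil => fun _ f => lunit' f
  | pcons g q' => fun _ f => id2 (pc1 q' g ∘ f)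
  end.

Definition join1_nil (Y Z : B) (q : path Y Z) :
    forall (X : B) (f : hom X Y), pc q ∘ f ⇒ pc1 q f :=
  match q in path Y Z return forall (X : B) (f : hom X Y), pc q ∘ f ⇒ pc1 q f with
  | pnil => fun _ f => lunit f
  | pcons g q' => fun _ f => id2 (pc1 q' g ∘ f)
  end.

Fixpoint split1 (Y Z W : B) (p : path Y Z) :
    forall (q : path Z W) (X : B) (f : hom X Y),
      pc1 (pcat p q) f ⇒ pc q ∘ pc1 p f :=
  match p in path Y Z return forall (q : path Z W) (X : B) (f : hom X Y),
      pc1 (pcat p q) f ⇒ pc q ∘ pc1 p f with
  | pnil => fun q _ f => split1_nil q f
  | pcons g p' => fun q _ f =>
      assoc f (pc1 p' g) (pc q) • (split1 p' q g ∗ id2 f)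
  end.

Fixpoint join1 (Y Z W : B) (p : path Y Z) :
    forall (q : path Z W) (X : B) (f : hom X Y),
      pc q ∘ pc1 p f ⇒ pc1 (pcat p q) f :=
  match p in path Y Z return forall (q : path Z W) (X : B) (f : hom X Y),
      pc q ∘ pc1 p f ⇒ pc1 (pcat p q) f with
  | pnil => fun q _ f => join1_nil q f
  | pcons g p' => fun q _ f =>
      (join1 p' q g ∗ id2 f) • assoc' f (pc1 p' g) (pc q)
  end.

Definition psplit (X Y Z : B) (p : path X Y) :
    forall q : path Y Z, pc (pcat p q) ⇒ pc q ∘ pc p :=
  match p in path X Y return forall q : path Y Z, pc (pcat p q) ⇒ pc q ∘ pc p with
  | pnil => fun q => runit' (pc q)
  | pcons f p' => fun q => split1 p' q f
  end.

Definition pjoin (X Y Z : B) (p : path X Y) :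
    forall q : path Y Z, pc q ∘ pc p ⇒ pc (pcat p q) :=
  match p in path X Y return forall q : path Y Z, pc q ∘ pc p ⇒ pc (pcat p q) with
  | pnil => fun q => runit (pc q)
  | pcons f p' => fun q => join1 p' q f
  end.

Definition whisk (X Y Z W : B) (p : path X Y) (q q' : path Y Z)
    (α : pcell q q') (r : path Z W) :
    pcell (pcat p (pcat q r)) (pcat p (pcat q' r)) :=
  pjoin p (pcat q' r)
  • ((pjoin q' r • (id2 (pc r) ∗ α) • psplit q r) ∗ id2 (pc p))
  • psplit p (pcat q r).

End Paths.

Notation "p ▷ α ◁ r" := (whisk p α r) (at level 60, α at next level, r at next level) : bicat_scope.
Notation "α ;; β" := (pseq α β) (at level 65, left associativity) : bicat_scope.

Section PathMap.
Variables (B C : bicat) (F : psfun B C).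

Fixpoint pmap (X Y : B) (p : path X Y) : path (F X) (F Y) :=
  match p with
  | pnil => pnil
  | pcons f q => pcons (psf1 F f) (pmap q)
  end.

Fixpoint pmap1_join (Y Z : B) (p : path Y Z) :
    forall (X : B) (f : hom X Y), pc1 (pmap p) (psf1 F f) ⇒ psf1 F (pc1 p f) :=
  match p in path Y Z return forall (X : B) (f : hom X Y),
      pc1 (pmap p) (psf1 F f) ⇒ psf1 F (pc1 p f) with
  | pnil => fun _ f => id2 (psf1 F f)
  | pcons g q => fun _ f =>
      psfC F f (pc1 q g) • (pmap1_join q g ∗ id2 (psf1 F f))
  end.

Fixpoint pmap1_split (Y Z : B) (p : path Y Z) :
    forall (X : B) (f : hom X Y), psf1 F (pc1 p f) ⇒ pc1 (pmap p) (psf1 F f) :=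
  match p in path Y Z return forall (X : B) (f : hom X Y),
      psf1 F (pc1 p f) ⇒ pc1 (pmap p) (psf1 F f) with
  | pnil => fun _ f => id2 (psf1 F f)
  | pcons g q => fun _ f =>
      (pmap1_split q g ∗ id2 (psf1 F f)) • psfC' F f (pc1 q g)
  end.

Definition pmap_join (X Y : B) (p : path X Y) : pc (pmap p) ⇒ psf1 F (pc p) :=
  match p in path X Y return pc (pmap p) ⇒ psf1 F (pc p) with
  | @pnil _ X => psfU F X
  | pcons f q => pmap1_join q f
  end.

Definition pmap_split (X Y : B) (p : path X Y) : psf1 F (pc p) ⇒ pc (pmap p) :=
  match p in path X Y return psf1 F (pc p) ⇒ pc (pmap p) with
  | @pnil _ X => psfU' F X
  | pcons f q => pmap1_split q f
  end.

Definition pmap2 (X Y : B) (p q : path X Y) (α : pcell p q) :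
    pcell (pmap p) (pmap q) :=
  pmap_split q • psf2 F α • pmap_join p.

End PathMap.

(** Pseudonatural adjoint equivalences. *)
Record adjequiv (B C : bicat) (F G : psfun B C) (θ : psnat F G) (θv : psnat G F) := AdjEquiv {
  ae_psnat : is_psnat θ;
  ae_psnatv : is_psnat θv;
  ae_unit : imod (pn_id F) (pn_comp θv θ);
  ae_counit : imod (pn_comp θ θv) (pn_id G);
  ae_triangle : forall X : B,
    (⟪⟫ ▷ (ae_unit X : pcell ⟪⟫ ⟪θ X; θv X⟫) ◁ ⟪θ X⟫)
    ;; (⟪θ X⟫ ▷ (ae_counit X : pcell ⟪θv X; θ X⟫ ⟪⟫) ◁ ⟪⟫)
    = pid ⟪θ X⟫;
  ae_trianglev : forall X : B,
    (⟪θv X⟫ ▷ (ae_unit X : pcell ⟪⟫ ⟪θ X; θv X⟫) ◁ ⟪⟫)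
    ;; (⟪⟫ ▷ (ae_counit X : pcell ⟪θv X; θ X⟫ ⟪⟫) ◁ ⟪θv X⟫)
    = pid ⟪θv X⟫
}.

(** * Monoidal bicategories

    One-object tricategories in the sense of Gordon--Power--Street and Gurski,
    except that the right unit equivalence is directed [A ⊗ I -> A] and the
    modifications [mb_mid], [mb_right] are replaced by their mates accordingly. *)

(** ** Tensor products *)

Section Tensor.
Variables (B : bicat) (T : psfun (bprod B B) B).

Definition ten (X : bicat) (F G : psfun X B) : psfun X B :=
  psf_comp T (psf_pair F G).

Definition ten_pn (X : bicat) (F F' G G' : psfun X B)
    (θ : psnat F F') (κ : psnat G G') : psnat (ten F G) (ten F' G') :=
  @PsNat _ _ (ten F G) (ten F' G')
    (fun x => psf1 T ((θ x, κ x) : @hom (bprod B B) (F x, G x) (F' x, G' x)))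
    (fun x y f =>
      psfC' T ((θ x, κ x) : @hom (bprod B B) (F x, G x) (F' x, G' x))
            ((psf1 F' f, psf1 G' f) : @hom (bprod B B) (F' x, G' x) (F' y, G' y))
      • psf2 T ((pn2 θ f, pn2 κ f) :
        @two (bprod B B) (F x, G x) (F' y, G' y)
          (θ y ∘ psf1 F f, κ y ∘ psf1 G f) (psf1 F' f ∘ θ x, psf1 G' f ∘ κ x))
      • psfC T ((psf1 F f, psf1 G f) : @hom (bprod B B) (F x, G x) (F y, G y))
             ((θ y, κ y) : @hom (bprod B B) (F y, G y) (F' y, G' y)))
    (fun x y f =>
      psfC' T ((psf1 F f, psf1 G f) : @hom (bprod B B) (F x, G x) (F y, G y))
            ((θ y, κ y) : @hom (bprod B B) (F y, G y) (F' y, G' y))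
      • psf2 T ((pn2' θ f, pn2' κ f) :
        @two (bprod B B) (F x, G x) (F' y, G' y)
          (psf1 F' f ∘ θ x, psf1 G' f ∘ κ x) (θ y ∘ psf1 F f, κ y ∘ psf1 G f))
      • psfC T ((θ x, κ x) : @hom (bprod B B) (F x, G x) (F' x, G' x))
             ((psf1 F' f, psf1 G' f) : @hom (bprod B B) (F' x, G' x) (F' y, G' y))).

Definition rten (C : B) : psfun B B := ten (psf_id B) (psf_const B C).
Definition lten (A : B) : psfun B B := ten (psf_const B A) (psf_id B).

Definition tob (A C : B) : B := T (A, C).

Definition tmap (A A' C C' : B) (f : hom A A') (g : hom C C') :
    hom (tob A C) (tob A' C') :=
  psf1 T ((f, g) : @hom (bprod B B) (A, C) (A', C')).

Definition tmap2 (A A' C C' : B) (f f' : hom A A') (g g' : hom C C')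
    (α : f ⇒ f') (β : g ⇒ g') : tmap f g ⇒ tmap f' g' :=
  psf2 T ((α, β) : @two (bprod B B) (A, C) (A', C') (f, g) (f', g')).

Definition rmap (A A' : B) (f : hom A A') (C : B) : hom (tob A C) (tob A' C) :=
  tmap f (id1 C).
Definition lmap (A : B) (C C' : B) (g : hom C C') : hom (tob A C) (tob A C') :=
  tmap (id1 A) g.

Definition tunit (A C : B) : id1 (tob A C) ⇒ tmap (id1 A) (id1 C) :=
  psfU T ((A, C) : bprod B B).
Definition tunit' (A C : B) : tmap (id1 A) (id1 C) ⇒ id1 (tob A C) :=
  psfU' T ((A, C) : bprod B B).

Definition tcomp (A A' A'' C C' C'' : B) (f : hom A A') (f' : hom A' A'')
    (g : hom C C') (g' : hom C' C'') :
    tmap f' g' ∘ tmap f g ⇒ tmap (f' ∘ f) (g' ∘ g) :=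
  psfC T ((f, g) : @hom (bprod B B) (A, C) (A', C'))
         ((f', g') : @hom (bprod B B) (A', C') (A'', C'')).
Definition tcomp' (A A' A'' C C' C'' : B) (f : hom A A') (f' : hom A' A'')
    (g : hom C C') (g' : hom C' C'') :
    tmap (f' ∘ f) (g' ∘ g) ⇒ tmap f' g' ∘ tmap f g :=
  psfC' T ((f, g) : @hom (bprod B B) (A, C) (A', C'))
          ((f', g') : @hom (bprod B B) (A', C') (A'', C'')).

Definition texch (A A' C C' : B) (f : hom A A') (g : hom C C') :
    pcell ⟪ lmap A g ; rmap f C' ⟫ ⟪ rmap f C ; lmap A' g ⟫ :=
  tcomp' f (id1 A') (id1 C) g
  • tmap2 (lunit' f • runit f) (runit' g • lunit g)
  • tcomp (id1 A) f g (id1 C').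

(** The reversed tensor product [A ⊗ʳ C = C ⊗ A]. *)
Definition trev : psfun (bprod B B) B :=
  psf_comp T (psf_pair (psf_snd B B) (psf_fst B B)).

End Tensor.

Section Projections.
Variable B : bicat.
Definition B2 : bicat := bprod B B.
Definition B3 : bicat := bprod B2 B.
Definition B4 : bicat := bprod B3 B.
Definition p21 : psfun B2 B := psf_fst B B.
Definition p22 : psfun B2 B := psf_snd B B.
Definition p31 : psfun B3 B := psf_comp p21 (psf_fst B2 B).
Definition p32 : psfun B3 B := psf_comp p22 (psf_fst B2 B).
Definition p33 : psfun B3 B := psf_snd B2 B.
Definition p41 : psfun B4 B := psf_comp p31 (psf_fst B3 B).
Definition p42 : psfun B4 B := psf_comp p32 (psf_fst B3 B).
Definition p43 : psfun B4 B := psf_comp p33 (psf_fst B3 B).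
Definition p44 : psfun B4 B := psf_snd B3 B.
End Projections.
Arguments p21 {B}. Arguments p22 {B}.
Arguments p31 {B}. Arguments p32 {B}. Arguments p33 {B}.
Arguments p41 {B}. Arguments p42 {B}. Arguments p43 {B}. Arguments p44 {B}.

Section ConstraintTypes.
Variables (B : bicat) (T : psfun (bprod B B) B) (U : psfun bterm B).

Definition unit_at (X : bicat) : psfun X B := psf_comp U (psf_bang X).

Definition assoc_type : Type :=
  psnat (ten T (ten T p31 p32) p33) (ten T p31 (ten T p32 p33)).
Definition assocv_type : Type :=
  psnat (ten T p31 (ten T p32 p33)) (ten T (ten T p31 p32) p33).
Definition lunit_type : Type := psnat (ten T (unit_at B) (psf_id B)) (psf_id B).
Definition lunitv_type : Type := psnat (psf_id B) (ten T (unit_at B) (psf_id B)).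
Definition runit_type : Type := psnat (ten T (psf_id B) (unit_at B)) (psf_id B).
Definition runitv_type : Type := psnat (psf_id B) (ten T (psf_id B) (unit_at B)).
Definition braid_type : Type := psnat (ten T p21 p22) (ten T p22 p21).

(** Instantiation of the constraints at pseudofunctors into [B]. *)
Section At.
Variables (X : bicat) (F G H : psfun X B).

Definition assoc_at (a : assoc_type) :
    psnat (ten T (ten T F G) H) (ten T F (ten T G H)) :=
  @PsNat _ _ (ten T (ten T F G) H) (ten T F (ten T G H))
    (fun x => a ((F x, G x, H x) : B3 B))
    (fun x y f => pn2 a ((psf1 F f, psf1 G f, psf1 H f) :
    @hom (B3 B) (F x, G x, H x) (F y, G y, H y)))
    (fun x y f => pn2' a ((psf1 F f, psf1 G f, psf1 H f) :
    @hom (B3 B) (F x, G x, H x) (F y, G y, H y))).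

Definition lunit_at (l : lunit_type) : psnat (ten T (unit_at X) F) F :=
  @PsNat _ _ (ten T (unit_at X) F) F
    (fun x => l (F x))
    (fun x y f => pn2 l (psf1 F f))
    (fun x y f => pn2' l (psf1 F f)).

Definition runit_at (r : runit_type) : psnat (ten T F (unit_at X)) F :=
  @PsNat _ _ (ten T F (unit_at X)) F
    (fun x => r (F x))
    (fun x y f => pn2 r (psf1 F f))
    (fun x y f => pn2' r (psf1 F f)).

Definition braid_at (b : braid_type) : psnat (ten T F G) (ten T G F) :=
  @PsNat _ _ (ten T F G) (ten T G F)
    (fun x => b ((F x, G x) : B2 B))
    (fun x y f => pn2 b ((psf1 F f, psf1 G f) : @hom (B2 B) (F x, G x) (F y, G y)))
    (fun x y f => pn2' b ((psf1 F f, psf1 G f) : @hom (B2 B) (F x, G x) (F y, G y))).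

End At.

Definition pentagonator_type (a : assoc_type) : Type :=
  imod
    (pn_comp (pn_comp (ten_pn T (pn_id p41) (assoc_at p42 p43 p44 a))
                      (assoc_at p41 (ten T p42 p43) p44 a))
             (ten_pn T (assoc_at p41 p42 p43 a) (pn_id p44)))
    (pn_comp (assoc_at p41 p42 (ten T p43 p44) a)
             (assoc_at (ten T p41 p42) p43 p44 a)).

Definition munit_type (a : assoc_type) (l : lunit_type) (r : runit_type) : Type :=
  imod
    (pn_comp (ten_pn T (pn_id p21) (lunit_at p22 l))
             (assoc_at p21 (unit_at (B2 B)) p22 a))
    (ten_pn T (runit_at p21 r) (pn_id p22)).

Definition lunitor_type (a : assoc_type) (l : lunit_type) : Type :=
  imod
    (pn_comp (lunit_at (ten T p21 p22) l) (assoc_at (unit_at (B2 B)) p21 p22 a))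
    (ten_pn T (lunit_at p21 l) (pn_id p22)).

Definition runitor_type (a : assoc_type) (r : runit_type) : Type :=
  imod
    (pn_comp (ten_pn T (pn_id p21) (runit_at p22 r))
             (assoc_at p21 p22 (unit_at (B2 B)) a))
    (runit_at (ten T p21 p22) r).

Definition hexagonator_type (a : assoc_type) (b : braid_type) : Type :=
  imod
    (pn_comp (pn_comp (assoc_at p32 p33 p31 a) (braid_at p31 (ten T p32 p33) b))
             (assoc_at p31 p32 p33 a))
    (pn_comp (pn_comp (ten_pn T (pn_id p32) (braid_at p31 p33 b))
                      (assoc_at p32 p31 p33 a))
             (ten_pn T (braid_at p31 p32 b) (pn_id p33))).

Definition syllepsis_type (b : braid_type) : Type :=
  imod (pn_id (ten T p21 p22)) (pn_comp (braid_at p22 p21 b) (braid_at p21 p22 b)).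

End ConstraintTypes.

(** The reversed constraints, for the reversed tensor product. *)
Section Reverse.
Variables (B : bicat) (T : psfun (bprod B B) B).

Definition assoc_rev (av : assocv_type T) : assoc_type (trev T) :=
  @PsNat (B3 B) B (ten (trev T) (ten (trev T) p31 p32) p33)
                  (ten (trev T) p31 (ten (trev T) p32 p33))
    (fun x : B3 B => av ((x.2, x.1.2, x.1.1) : B3 B))
    (fun (x y : B3 B) (f : @hom (B3 B) x y) => pn2 av
      ((f.2, f.1.2, f.1.1) : @hom (B3 B) (x.2, x.1.2, x.1.1) (y.2, y.1.2, y.1.1)))
    (fun (x y : B3 B) (f : @hom (B3 B) x y) => pn2' av
      ((f.2, f.1.2, f.1.1) : @hom (B3 B) (x.2, x.1.2, x.1.1) (y.2, y.1.2, y.1.1))).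

Definition braid_rev1 (b : braid_type T) (x : B2 B) :
    hom (tob T x.2 x.1) (tob T x.1 x.2) :=
  b ((x.2, x.1) : B2 B).

Definition braid_rev2 (b : braid_type T) (x y : B2 B) (f : hom x y) :
    braid_rev1 b y ∘ tmap T f.2 f.1 ⇒ tmap T f.1 f.2 ∘ braid_rev1 b x :=
  pn2 b ((f.2, f.1) : @hom (B2 B) (x.2, x.1) (y.2, y.1)).

Definition braid_rev2' (b : braid_type T) (x y : B2 B) (f : hom x y) :
    tmap T f.1 f.2 ∘ braid_rev1 b x ⇒ braid_rev1 b y ∘ tmap T f.2 f.1 :=
  pn2' b ((f.2, f.1) : @hom (B2 B) (x.2, x.1) (y.2, y.1)).

Definition braid_rev (b : braid_type T) : braid_type (trev T) :=
  @PsNat (B2 B) B (ten (trev T) p21 p22) (ten (trev T) p22 p21)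
    (braid_rev1 b) (@braid_rev2 b) (@braid_rev2' b).

End Reverse.

(** ** Pasting axioms

    In this part the tensor product [T] and the constraints are fixed; [f ⋊ C]
    and [A ⋉ g] stand for [f ⊗ 1_C] and [1_A ⊗ g], and similarly [α ⋊₂ C] and
    [A ⋉₂ α] for pasting cells.  All composites of cells are in diagrammatic
    order. *)

Section Pasting.
Variables (K : bicat) (T : psfun (bprod K K) K).

Local Notation "A ⊗ B" := (tob T A B) (at level 35, right associativity).
Local Notation "f ⋊ C" := (rmap T f C) (at level 34, left associativity).
Local Notation "A ⋉ f" := (lmap T A f) (at level 33, right associativity).
Local Notation "α ⋊₂ C" := (pmap2 (rten T C) α) (at level 34, left associativity).
Local Notation "A ⋉₂ α" := (pmap2 (lten T A) α) (at level 33, right associativity).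

Section AssocNat.
Variable a : assoc_type T.

Definition a1 (A B C : K) : hom ((A ⊗ B) ⊗ C) (A ⊗ (B ⊗ C)) :=
  a ((A, B, C) : B3 K).

Definition a2 (A A' B B' C C' : K) (f : hom A A') (g : hom B B') (h : hom C C') :
    pcell ⟪ tmap T (tmap T f g) h ; a1 A' B' C' ⟫
          ⟪ a1 A B C ; tmap T f (tmap T g h) ⟫ :=
  pn2 a ((f, g, h) : @hom (B3 K) (A, B, C) (A', B', C')).
Definition a2' (A A' B B' C C' : K) (f : hom A A') (g : hom B B') (h : hom C C') :
    pcell ⟪ a1 A B C ; tmap T f (tmap T g h) ⟫
          ⟪ tmap T (tmap T f g) h ; a1 A' B' C' ⟫ :=
  pn2' a ((f, g, h) : @hom (B3 K) (A, B, C) (A', B', C')).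

Definition aL (A A' : K) (f : hom A A') (B C : K) :
    pcell ⟪ (f ⋊ B) ⋊ C ; a1 A' B C ⟫ ⟪ a1 A B C ; f ⋊ (B ⊗ C) ⟫ :=
  a2 f (id1 B) (id1 C)
  ;; (⟪ a1 A B C ⟫
       ▷ (tmap2 T (id2 f) (tunit' T B C) :
            pcell ⟪ tmap T f (tmap T (id1 B) (id1 C)) ⟫ ⟪ f ⋊ (B ⊗ C) ⟫) ◁ ⟪⟫).
Definition aL' (A A' : K) (f : hom A A') (B C : K) :
    pcell ⟪ a1 A B C ; f ⋊ (B ⊗ C) ⟫ ⟪ (f ⋊ B) ⋊ C ; a1 A' B C ⟫ :=
  (⟪ a1 A B C ⟫
    ▷ (tmap2 T (id2 f) (tunit T B C) :
         pcell ⟪ f ⋊ (B ⊗ C) ⟫ ⟪ tmap T f (tmap T (id1 B) (id1 C)) ⟫) ◁ ⟪⟫)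
  ;; a2' f (id1 B) (id1 C).

Definition aM (A B B' : K) (g : hom B B') (C : K) :
    pcell ⟪ (A ⋉ g) ⋊ C ; a1 A B' C ⟫ ⟪ a1 A B C ; A ⋉ (g ⋊ C) ⟫ :=
  a2 (id1 A) g (id1 C).
Definition aM' (A B B' : K) (g : hom B B') (C : K) :
    pcell ⟪ a1 A B C ; A ⋉ (g ⋊ C) ⟫ ⟪ (A ⋉ g) ⋊ C ; a1 A B' C ⟫ :=
  a2' (id1 A) g (id1 C).

Definition aR (A B C C' : K) (h : hom C C') :
    pcell ⟪ (A ⊗ B) ⋉ h ; a1 A B C' ⟫ ⟪ a1 A B C ; A ⋉ (B ⋉ h) ⟫ :=
  (⟪⟫
    ▷ (tmap2 T (tunit T A B) (id2 h) :
         pcell ⟪ (A ⊗ B) ⋉ h ⟫ ⟪ tmap T (tmap T (id1 A) (id1 B)) h ⟫)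
    ◁ ⟪ a1 A B C' ⟫)
  ;; a2 (id1 A) (id1 B) h.
Definition aR' (A B C C' : K) (h : hom C C') :
    pcell ⟪ a1 A B C ; A ⋉ (B ⋉ h) ⟫ ⟪ (A ⊗ B) ⋉ h ; a1 A B C' ⟫ :=
  a2' (id1 A) (id1 B) h
  ;; (⟪⟫
       ▷ (tmap2 T (tunit' T A B) (id2 h) :
            pcell ⟪ tmap T (tmap T (id1 A) (id1 B)) h ⟫ ⟪ (A ⊗ B) ⋉ h ⟫)
       ◁ ⟪ a1 A B C' ⟫).

Definition pentagonator_cell : Type := forall A B C D : K,
  pcell ⟪ a1 A B C ⋊ D ; a1 A (B ⊗ C) D ; A ⋉ a1 B C D ⟫
        ⟪ a1 (A ⊗ B) C D ; a1 A B (C ⊗ D) ⟫.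
Definition pentagonator_cell' : Type := forall A B C D : K,
  pcell ⟪ a1 (A ⊗ B) C D ; a1 A B (C ⊗ D) ⟫
        ⟪ a1 A B C ⋊ D ; a1 A (B ⊗ C) D ; A ⋉ a1 B C D ⟫.

Definition pent (π : pentagonator_type a) : pentagonator_cell :=
  fun A B C D => π ((A, B, C, D) : B4 K).
Definition pent' (π : pentagonator_type a) : pentagonator_cell' :=
  fun A B C D => md' π ((A, B, C, D) : B4 K).

(** The nonabelian 4-cocycle condition (associahedron [K5]). *)
Definition assoc_axiom (π : pentagonator_cell) : Prop :=
  forall A B C D E : K,
    (⟪⟫ ▷ π A B C D ⋊₂ E
        ◁ ⟪ a1 A (B ⊗ C ⊗ D) E ; A ⋉ a1 B (C ⊗ D) E ; A ⋉ (B ⋉ a1 C D E) ⟫)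
    ;; (⟪ a1 (A ⊗ B) C D ⋊ E ⟫ ▷ π A B (C ⊗ D) E ◁ ⟪ A ⋉ (B ⋉ a1 C D E) ⟫)
    ;; (⟪ a1 (A ⊗ B) C D ⋊ E ; a1 (A ⊗ B) (C ⊗ D) E ⟫ ▷ aR' A B (a1 C D E) ◁ ⟪⟫)
    ;; (⟪⟫ ▷ π (A ⊗ B) C D E ◁ ⟪ a1 A B (C ⊗ D ⊗ E) ⟫)
    =
    (⟪ (a1 A B C ⋊ D) ⋊ E ; a1 A (B ⊗ C) D ⋊ E ⟫
        ▷ aM A (a1 B C D) E
        ◁ ⟪ A ⋉ a1 B (C ⊗ D) E ; A ⋉ (B ⋉ a1 C D E) ⟫)
    ;; (⟪ (a1 A B C ⋊ D) ⋊ E ; a1 A (B ⊗ C) D ⋊ E ; a1 A ((B ⊗ C) ⊗ D) E ⟫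
        ▷ A ⋉₂ π B C D E ◁ ⟪⟫)
    ;; (⟪ (a1 A B C ⋊ D) ⋊ E ⟫ ▷ π A (B ⊗ C) D E ◁ ⟪ A ⋉ a1 B C (D ⊗ E) ⟫)
    ;; (⟪⟫ ▷ aL (a1 A B C) D E ◁ ⟪ a1 A (B ⊗ C) (D ⊗ E) ; A ⋉ a1 B C (D ⊗ E) ⟫)
    ;; (⟪ a1 ((A ⊗ B) ⊗ C) D E ⟫ ▷ π A B C (D ⊗ E) ◁ ⟪⟫).

End AssocNat.

(** *** Unit axioms *)
Section Units.
Variables (U : psfun bterm K) (a : assoc_type T) (l : lunit_type T U) (r : runit_type T U).
Local Notation I := (U tt).

Definition l1 (A : K) : hom (I ⊗ A) A := l A.
Definition r1 (A : K) : hom (A ⊗ I) A := r A.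

Definition mcell (μ : munit_type a l r) (A B : K) :
    pcell ⟪ a1 a A I B ; A ⋉ l1 B ⟫ ⟪ r1 A ⋊ B ⟫ :=
  μ ((A, B) : B2 K).
Definition lcell (λ : lunitor_type a l) (A B : K) :
    pcell ⟪ a1 a I A B ; l1 (A ⊗ B) ⟫ ⟪ l1 A ⋊ B ⟫ :=
  λ ((A, B) : B2 K).
Definition rcell (ρ : runitor_type a r) (A B : K) :
    pcell ⟪ a1 a A B I ; A ⋉ r1 B ⟫ ⟪ r1 (A ⊗ B) ⟫ :=
  ρ ((A, B) : B2 K).

Definition left_unit_axiom (π : pentagonator_type a) (μ : munit_type a l r)
    (λ : lunitor_type a l) : Prop :=
  forall A B C : K,
    (⟪⟫ ▷ pent π A I B C ◁ ⟪ A ⋉ l1 (B ⊗ C) ⟫)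
    ;; (⟪ a1 a (A ⊗ I) B C ⟫ ▷ mcell μ A (B ⊗ C) ◁ ⟪⟫)
    =
    (⟪ a1 a A I B ⋊ C ; a1 a A (I ⊗ B) C ⟫ ▷ A ⋉₂ lcell λ B C ◁ ⟪⟫)
    ;; (⟪ a1 a A I B ⋊ C ⟫ ▷ aM' a A (l1 B) C ◁ ⟪⟫)
    ;; (⟪⟫ ▷ mcell μ A B ⋊₂ C ◁ ⟪ a1 a A B C ⟫)
    ;; aL a (r1 A) B C.

Definition right_unit_axiom (π : pentagonator_type a) (μ : munit_type a l r)
    (ρ : runitor_type a r) : Prop :=
  forall A B C : K,
    (⟪⟫ ▷ pent π A B I C ◁ ⟪ A ⋉ (B ⋉ l1 C) ⟫)
    ;; (⟪ a1 a (A ⊗ B) I C ⟫ ▷ aR' a A B (l1 C) ◁ ⟪⟫)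
    ;; (⟪⟫ ▷ mcell μ (A ⊗ B) C ◁ ⟪ a1 a A B C ⟫)
    =
    (⟪ a1 a A B I ⋊ C ; a1 a A (B ⊗ I) C ⟫ ▷ A ⋉₂ mcell μ B C ◁ ⟪⟫)
    ;; (⟪ a1 a A B I ⋊ C ⟫ ▷ aM' a A (r1 B) C ◁ ⟪⟫)
    ;; (⟪⟫ ▷ rcell ρ A B ⋊₂ C ◁ ⟪ a1 a A B C ⟫).

End Units.

(** *** The inverse associator and mates of the pentagonator *)
Section AssocInverse.
Variable av : assocv_type T.

Definition av1 (A B C : K) : hom (A ⊗ (B ⊗ C)) ((A ⊗ B) ⊗ C) :=
  av ((A, B, C) : B3 K).

Definition av2 (A A' B B' C C' : K) (f : hom A A') (g : hom B B') (h : hom C C') :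
    pcell ⟪ tmap T f (tmap T g h) ; av1 A' B' C' ⟫
          ⟪ av1 A B C ; tmap T (tmap T f g) h ⟫ :=
  pn2 av ((f, g, h) : @hom (B3 K) (A, B, C) (A', B', C')).
Definition av2' (A A' B B' C C' : K) (f : hom A A') (g : hom B B') (h : hom C C') :
    pcell ⟪ av1 A B C ; tmap T (tmap T f g) h ⟫
          ⟪ tmap T f (tmap T g h) ; av1 A' B' C' ⟫ :=
  pn2' av ((f, g, h) : @hom (B3 K) (A, B, C) (A', B', C')).

Definition avL' (A A' : K) (f : hom A A') (B C : K) :
    pcell ⟪ av1 A B C ; (f ⋊ B) ⋊ C ⟫ ⟪ f ⋊ (B ⊗ C) ; av1 A' B C ⟫ :=
  av2' f (id1 B) (id1 C)
  ;; (⟪⟫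
       ▷ (tmap2 T (id2 f) (tunit' T B C) :
            pcell ⟪ tmap T f (tmap T (id1 B) (id1 C)) ⟫ ⟪ f ⋊ (B ⊗ C) ⟫)
       ◁ ⟪ av1 A' B C ⟫).

Definition avR (A B C C' : K) (h : hom C C') :
    pcell ⟪ A ⋉ (B ⋉ h) ; av1 A B C' ⟫ ⟪ av1 A B C ; (A ⊗ B) ⋉ h ⟫ :=
  av2 (id1 A) (id1 B) h
  ;; (⟪ av1 A B C ⟫
       ▷ (tmap2 T (tunit' T A B) (id2 h) :
            pcell ⟪ tmap T (tmap T (id1 A) (id1 B)) h ⟫ ⟪ (A ⊗ B) ⋉ h ⟫) ◁ ⟪⟫).

Variables (a : assoc_type T) (e : adjequiv a av).

Definition eta (A B C : K) : pcell ⟪⟫ ⟪ a1 a A B C ; av1 A B C ⟫ :=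
  ae_unit e ((A, B, C) : B3 K).
Definition eta' (A B C : K) : pcell ⟪ a1 a A B C ; av1 A B C ⟫ ⟪⟫ :=
  md' (ae_unit e) ((A, B, C) : B3 K).
Definition eps (A B C : K) : pcell ⟪ av1 A B C ; a1 a A B C ⟫ ⟪⟫ :=
  ae_counit e ((A, B, C) : B3 K).
Definition eps' (A B C : K) : pcell ⟪⟫ ⟪ av1 A B C ; a1 a A B C ⟫ :=
  md' (ae_counit e) ((A, B, C) : B3 K).

Variable π : pentagonator_type a.

Definition pentv (A B C D : K) :
    pcell ⟪ A ⋉ av1 B C D ; av1 A (B ⊗ C) D ; av1 A B C ⋊ D ⟫
          ⟪ av1 A B (C ⊗ D) ; av1 (A ⊗ B) C D ⟫ :=
  (⟪ A ⋉ av1 B C D ; av1 A (B ⊗ C) D ; av1 A B C ⋊ D ⟫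
      ▷ eta (A ⊗ B) C D ◁ ⟪⟫)
  ;; (⟪ A ⋉ av1 B C D ; av1 A (B ⊗ C) D ; av1 A B C ⋊ D ; a1 a (A ⊗ B) C D ⟫
      ▷ eta A B (C ⊗ D) ◁ ⟪ av1 (A ⊗ B) C D ⟫)
  ;; (⟪ A ⋉ av1 B C D ; av1 A (B ⊗ C) D ; av1 A B C ⋊ D ⟫
      ▷ pent' π A B C D ◁ ⟪ av1 A B (C ⊗ D) ; av1 (A ⊗ B) C D ⟫)
  ;; (⟪ A ⋉ av1 B C D ; av1 A (B ⊗ C) D ⟫
      ▷ eps A B C ⋊₂ D
      ◁ ⟪ a1 a A (B ⊗ C) D ; A ⋉ a1 a B C D ; av1 A B (C ⊗ D) ; av1 (A ⊗ B) C D ⟫)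
  ;; (⟪ A ⋉ av1 B C D ⟫
      ▷ eps A (B ⊗ C) D
      ◁ ⟪ A ⋉ a1 a B C D ; av1 A B (C ⊗ D) ; av1 (A ⊗ B) C D ⟫)
  ;; (⟪⟫ ▷ A ⋉₂ eps B C D ◁ ⟪ av1 A B (C ⊗ D) ; av1 (A ⊗ B) C D ⟫).

Definition pentv' (A B C D : K) :
    pcell ⟪ av1 A B (C ⊗ D) ; av1 (A ⊗ B) C D ⟫
          ⟪ A ⋉ av1 B C D ; av1 A (B ⊗ C) D ; av1 A B C ⋊ D ⟫ :=
  (⟪⟫ ▷ A ⋉₂ eps' B C D ◁ ⟪ av1 A B (C ⊗ D) ; av1 (A ⊗ B) C D ⟫)
  ;; (⟪ A ⋉ av1 B C D ⟫
      ▷ eps' A (B ⊗ C) D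
      ◁ ⟪ A ⋉ a1 a B C D ; av1 A B (C ⊗ D) ; av1 (A ⊗ B) C D ⟫)
  ;; (⟪ A ⋉ av1 B C D ; av1 A (B ⊗ C) D ⟫
      ▷ eps' A B C ⋊₂ D
      ◁ ⟪ a1 a A (B ⊗ C) D ; A ⋉ a1 a B C D ; av1 A B (C ⊗ D) ; av1 (A ⊗ B) C D ⟫)
  ;; (⟪ A ⋉ av1 B C D ; av1 A (B ⊗ C) D ; av1 A B C ⋊ D ⟫
      ▷ pent π A B C D ◁ ⟪ av1 A B (C ⊗ D) ; av1 (A ⊗ B) C D ⟫)
  ;; (⟪ A ⋉ av1 B C D ; av1 A (B ⊗ C) D ; av1 A B C ⋊ D ; a1 a (A ⊗ B) C D ⟫
      ▷ eta' A B (C ⊗ D) ◁ ⟪ av1 (A ⊗ B) C D ⟫)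
  ;; (⟪ A ⋉ av1 B C D ; av1 A (B ⊗ C) D ; av1 A B C ⋊ D ⟫
      ▷ eta' (A ⊗ B) C D ◁ ⟪⟫).

Definition mateL (A B C D : K) :
    pcell ⟪ a1 a A (B ⊗ C) D ; A ⋉ a1 a B C D ; av1 A B (C ⊗ D) ⟫
          ⟪ av1 A B C ⋊ D ; a1 a (A ⊗ B) C D ⟫ :=
  (⟪⟫ ▷ eps' A B C ⋊₂ D
      ◁ ⟪ a1 a A (B ⊗ C) D ; A ⋉ a1 a B C D ; av1 A B (C ⊗ D) ⟫)
  ;; (⟪ av1 A B C ⋊ D ⟫ ▷ pent π A B C D ◁ ⟪ av1 A B (C ⊗ D) ⟫)
  ;; (⟪ av1 A B C ⋊ D ; a1 a (A ⊗ B) C D ⟫ ▷ eta' A B (C ⊗ D) ◁ ⟪⟫).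

Definition mateR (A B C D : K) :
    pcell ⟪ av1 (A ⊗ B) C D ; a1 a A B C ⋊ D ; a1 a A (B ⊗ C) D ⟫
          ⟪ a1 a A B (C ⊗ D) ; A ⋉ av1 B C D ⟫ :=
  (⟪ av1 (A ⊗ B) C D ; a1 a A B C ⋊ D ; a1 a A (B ⊗ C) D ⟫
      ▷ A ⋉₂ eta B C D ◁ ⟪⟫)
  ;; (⟪ av1 (A ⊗ B) C D ⟫ ▷ pent π A B C D ◁ ⟪ A ⋉ av1 B C D ⟫)
  ;; (⟪⟫ ▷ eps (A ⊗ B) C D ◁ ⟪ a1 a A B (C ⊗ D) ; A ⋉ av1 B C D ⟫).

End AssocInverse.

(** *** Braiding axioms *)
Section Braiding.
Variable b : braid_type T.

Definition b1 (A B : K) : hom (A ⊗ B) (B ⊗ A) := b ((A, B) : B2 K).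

Definition b2 (A A' B B' : K) (f : hom A A') (g : hom B B') :
    pcell ⟪ tmap T f g ; b1 A' B' ⟫ ⟪ b1 A B ; tmap T g f ⟫ :=
  pn2 b ((f, g) : @hom (B2 K) (A, B) (A', B')).
Definition b2' (A A' B B' : K) (f : hom A A') (g : hom B B') :
    pcell ⟪ b1 A B ; tmap T g f ⟫ ⟪ tmap T f g ; b1 A' B' ⟫ :=
  pn2' b ((f, g) : @hom (B2 K) (A, B) (A', B')).

Definition bL' (A A' : K) (f : hom A A') (B : K) :
    pcell ⟪ b1 A B ; B ⋉ f ⟫ ⟪ f ⋊ B ; b1 A' B ⟫ := b2' f (id1 B).
Definition bR (A B B' : K) (g : hom B B') :
    pcell ⟪ A ⋉ g ; b1 A B' ⟫ ⟪ b1 A B ; g ⋊ A ⟫ := b2 (id1 A) g.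
Definition bR' (A B B' : K) (g : hom B B') :
    pcell ⟪ b1 A B ; g ⋊ A ⟫ ⟪ A ⋉ g ; b1 A B' ⟫ := b2' (id1 A) g.

Variable a : assoc_type T.

Definition hexagonator_cell : Type := forall A B C : K,
  pcell ⟪ a1 a A B C ; b1 A (B ⊗ C) ; a1 a B C A ⟫
        ⟪ b1 A B ⋊ C ; a1 a B A C ; B ⋉ b1 A C ⟫.
Definition hexagonator_cell' : Type := forall A B C : K,
  pcell ⟪ b1 A B ⋊ C ; a1 a B A C ; B ⋉ b1 A C ⟫
        ⟪ a1 a A B C ; b1 A (B ⊗ C) ; a1 a B C A ⟫.

Definition hexa (R : hexagonator_type a b) : hexagonator_cell :=
  fun A B C => R ((A, B, C) : B3 K).
Definition hexa' (R : hexagonator_type a b) : hexagonator_cell' :=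
  fun A B C => md' R ((A, B, C) : B3 K).

(** The axiom for moving [A] past [B], [C] and [D]. *)
Definition braid_axiom_13 (π : pentagonator_cell a) (π' : pentagonator_cell' a)
    (R' : hexagonator_cell') : Prop :=
  forall A B C D : K,
    (⟪⟫ ▷ R' A B C ⋊₂ D
        ◁ ⟪ a1 a B (C ⊗ A) D ; B ⋉ a1 a C A D ; B ⋉ (C ⋉ b1 A D) ⟫)
    ;; (⟪ a1 a A B C ⋊ D ; b1 A (B ⊗ C) ⋊ D ⟫
        ▷ π B C A D ◁ ⟪ B ⋉ (C ⋉ b1 A D) ⟫)
    ;; (⟪ a1 a A B C ⋊ D ; b1 A (B ⊗ C) ⋊ D ; a1 a (B ⊗ C) A D ⟫
        ▷ aR' a B C (b1 A D) ◁ ⟪⟫)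
    ;; (⟪ a1 a A B C ⋊ D ⟫ ▷ R' A (B ⊗ C) D ◁ ⟪ a1 a B C (D ⊗ A) ⟫)
    ;; (⟪ a1 a A B C ⋊ D ; a1 a A (B ⊗ C) D ; b1 A ((B ⊗ C) ⊗ D) ⟫
        ▷ π' B C D A ◁ ⟪⟫)
    ;; (⟪ a1 a A B C ⋊ D ; a1 a A (B ⊗ C) D ⟫
        ▷ bR' A (a1 a B C D) ◁ ⟪ a1 a B (C ⊗ D) A ; B ⋉ a1 a C D A ⟫)
    ;; (⟪⟫ ▷ π A B C D
        ◁ ⟪ b1 A (B ⊗ (C ⊗ D)) ; a1 a B (C ⊗ D) A ; B ⋉ a1 a C D A ⟫)
    =
    (⟪ (b1 A B ⋊ C) ⋊ D ; a1 a B A C ⋊ D ⟫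
        ▷ aM a B (b1 A C) D ◁ ⟪ B ⋉ a1 a C A D ; B ⋉ (C ⋉ b1 A D) ⟫)
    ;; (⟪ (b1 A B ⋊ C) ⋊ D ; a1 a B A C ⋊ D ; a1 a B (A ⊗ C) D ⟫
        ▷ B ⋉₂ R' A C D ◁ ⟪⟫)
    ;; (⟪ (b1 A B ⋊ C) ⋊ D ⟫
        ▷ π B A C D ◁ ⟪ B ⋉ b1 A (C ⊗ D) ; B ⋉ a1 a C D A ⟫)
    ;; (⟪⟫ ▷ aL a (b1 A B) C D
        ◁ ⟪ a1 a B A (C ⊗ D) ; B ⋉ b1 A (C ⊗ D) ; B ⋉ a1 a C D A ⟫)
    ;; (⟪ a1 a (A ⊗ B) C D ⟫ ▷ R' A B (C ⊗ D) ◁ ⟪ B ⋉ a1 a C D A ⟫).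

Variables (av : assocv_type T) (e : adjequiv a av).

(** The second hexagonator is a hexagonator for the reversed structure. *)
Definition hexagonatorv_type : Type :=
  hexagonator_type (assoc_rev av) (braid_rev b).

Definition hexv (S : hexagonatorv_type) (A B C : K) :
    pcell ⟪ av1 av A B C ; b1 (A ⊗ B) C ; av1 av C A B ⟫
          ⟪ A ⋉ b1 B C ; av1 av A C B ; b1 A C ⋊ B ⟫ :=
  S ((C, B, A) : B3 K).
Definition hexv' (S : hexagonatorv_type) (A B C : K) :
    pcell ⟪ A ⋉ b1 B C ; av1 av A C B ; b1 A C ⋊ B ⟫
          ⟪ av1 av A B C ; b1 (A ⊗ B) C ; av1 av C A B ⟫ :=
  md' S ((C, B, A) : B3 K).

(** The axiom for moving [A], [B] past [C], [D]. *)
Definition braid_axiom_22 (π : pentagonator_type a) (R : hexagonator_type a b)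
    (S : hexagonatorv_type) : Prop :=
  forall A B C D : K,
    (⟪⟫ ▷ mateL e π A B C D
        ◁ ⟪ b1 (A ⊗ B) (C ⊗ D) ; av1 av (C ⊗ D) A B ; a1 a C D A ⋊ B ;
            a1 a C (D ⊗ A) B ⟫)
    ;; (⟪ av1 av A B C ⋊ D ; a1 a (A ⊗ B) C D ; b1 (A ⊗ B) (C ⊗ D) ⟫
        ▷ mateR e π C D A B ◁ ⟪⟫)
    ;; (⟪ av1 av A B C ⋊ D ⟫ ▷ hexa R (A ⊗ B) C D ◁ ⟪ C ⋉ av1 av D A B ⟫)
    ;; (⟪ av1 av A B C ⋊ D ; b1 (A ⊗ B) C ⋊ D ⟫
        ▷ eps' e C A B ⋊₂ D
        ◁ ⟪ a1 a C (A ⊗ B) D ; C ⋉ b1 (A ⊗ B) D ; C ⋉ av1 av D A B ⟫)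
    ;; (⟪ av1 av A B C ⋊ D ; b1 (A ⊗ B) C ⋊ D ; av1 av C A B ⋊ D ;
          a1 a C A B ⋊ D ; a1 a C (A ⊗ B) D ⟫
        ▷ C ⋉₂ eta e A B D
        ◁ ⟪ C ⋉ b1 (A ⊗ B) D ; C ⋉ av1 av D A B ⟫)
    ;; (⟪⟫ ▷ hexv S A B C ⋊₂ D
        ◁ ⟪ a1 a C A B ⋊ D ; a1 a C (A ⊗ B) D ; C ⋉ a1 a A B D ;
            C ⋉ av1 av A B D ; C ⋉ b1 (A ⊗ B) D ; C ⋉ av1 av D A B ⟫)
    ;; (⟪ (A ⋉ b1 B C) ⋊ D ; av1 av A C B ⋊ D ; (b1 A C ⋊ B) ⋊ D ;
          a1 a C A B ⋊ D ; a1 a C (A ⊗ B) D ; C ⋉ a1 a A B D ⟫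
        ▷ C ⋉₂ hexv S A B D ◁ ⟪⟫)
    ;; (⟪ (A ⋉ b1 B C) ⋊ D ; av1 av A C B ⋊ D ; (b1 A C ⋊ B) ⋊ D ⟫
        ▷ pent π C A B D
        ◁ ⟪ C ⋉ (A ⋉ b1 B D) ; C ⋉ av1 av A D B ; C ⋉ (b1 A D ⋊ B) ⟫)
    ;; (⟪ (A ⋉ b1 B C) ⋊ D ; av1 av A C B ⋊ D ⟫
        ▷ aL a (b1 A C) B D
        ◁ ⟪ a1 a C A (B ⊗ D) ; C ⋉ (A ⋉ b1 B D) ; C ⋉ av1 av A D B ;
            C ⋉ (b1 A D ⋊ B) ⟫)
    ;; (⟪ (A ⋉ b1 B C) ⋊ D ; av1 av A C B ⋊ D ; a1 a (A ⊗ C) B D ;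
          b1 A C ⋊ (B ⊗ D) ⟫
        ▷ aR' a C A (b1 B D) ◁ ⟪ C ⋉ av1 av A D B ; C ⋉ (b1 A D ⋊ B) ⟫)
    =
    (⟪ a1 a A (B ⊗ C) D ; A ⋉ a1 a B C D ⟫
        ▷ hexv S A B (C ⊗ D) ◁ ⟪ a1 a C D A ⋊ B ; a1 a C (D ⊗ A) B ⟫)
    ;; (⟪ a1 a A (B ⊗ C) D ; A ⋉ a1 a B C D ; A ⋉ b1 B (C ⊗ D) ⟫
        ▷ A ⋉₂ eta e C D B
        ◁ ⟪ av1 av A (C ⊗ D) B ; b1 A (C ⊗ D) ⋊ B ; a1 a C D A ⋊ B ;
            a1 a C (D ⊗ A) B ⟫)
    ;; (⟪ a1 a A (B ⊗ C) D ; A ⋉ a1 a B C D ; A ⋉ b1 B (C ⊗ D) ;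
          A ⋉ a1 a C D B ; A ⋉ av1 av C D B ; av1 av A (C ⊗ D) B ⟫
        ▷ eps' e A C D ⋊₂ B
        ◁ ⟪ b1 A (C ⊗ D) ⋊ B ; a1 a C D A ⋊ B ; a1 a C (D ⊗ A) B ⟫)
    ;; (⟪ a1 a A (B ⊗ C) D ⟫
        ▷ A ⋉₂ hexa R B C D
        ◁ ⟪ A ⋉ av1 av C D B ; av1 av A (C ⊗ D) B ; av1 av A C D ⋊ B ;
            a1 a A C D ⋊ B ; b1 A (C ⊗ D) ⋊ B ; a1 a C D A ⋊ B ;
            a1 a C (D ⊗ A) B ⟫)
    ;; (⟪ a1 a A (B ⊗ C) D ; A ⋉ (b1 B C ⋊ D) ; A ⋉ a1 a C B D ;
          A ⋉ (C ⋉ b1 B D) ; A ⋉ av1 av C D B ; av1 av A (C ⊗ D) B ;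
          av1 av A C D ⋊ B ⟫
        ▷ hexa R A C D ⋊₂ B ◁ ⟪ a1 a C (D ⊗ A) B ⟫)
    ;; (⟪ a1 a A (B ⊗ C) D ; A ⋉ (b1 B C ⋊ D) ; A ⋉ a1 a C B D ;
          A ⋉ (C ⋉ b1 B D) ⟫
        ▷ pentv e π A C D B
        ◁ ⟪ (b1 A C ⋊ D) ⋊ B ; a1 a C A D ⋊ B ; (C ⋉ b1 A D) ⋊ B ;
            a1 a C (D ⊗ A) B ⟫)
    ;; (⟪⟫ ▷ aM' a A (b1 B C) D
        ◁ ⟪ A ⋉ a1 a C B D ; A ⋉ (C ⋉ b1 B D) ; av1 av A C (D ⊗ B) ;
            av1 av (A ⊗ C) D B ; (b1 A C ⋊ D) ⋊ B ; a1 a C A D ⋊ B ;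
            (C ⋉ b1 A D) ⋊ B ; a1 a C (D ⊗ A) B ⟫)
    ;; (⟪ (A ⋉ b1 B C) ⋊ D ; a1 a A (C ⊗ B) D ; A ⋉ a1 a C B D ;
          A ⋉ (C ⋉ b1 B D) ; av1 av A C (D ⊗ B) ; av1 av (A ⊗ C) D B ;
          (b1 A C ⋊ D) ⋊ B ; a1 a C A D ⋊ B ⟫
        ▷ aM a C (b1 A D) B ◁ ⟪⟫)
    ;; (⟪ (A ⋉ b1 B C) ⋊ D ; a1 a A (C ⊗ B) D ; A ⋉ a1 a C B D ⟫
        ▷ avR av A C (b1 B D)
        ◁ ⟪ av1 av (A ⊗ C) D B ; (b1 A C ⋊ D) ⋊ B ; a1 a C A D ⋊ B ;
            a1 a C (A ⊗ D) B ; C ⋉ (b1 A D ⋊ B) ⟫)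
    ;; (⟪ (A ⋉ b1 B C) ⋊ D ; a1 a A (C ⊗ B) D ; A ⋉ a1 a C B D ;
          av1 av A C (B ⊗ D) ; (A ⊗ C) ⋉ b1 B D ⟫
        ▷ avL' av (b1 A C) D B
        ◁ ⟪ a1 a C A D ⋊ B ; a1 a C (A ⊗ D) B ; C ⋉ (b1 A D ⋊ B) ⟫)
    ;; (⟪ (A ⋉ b1 B C) ⋊ D ⟫
        ▷ mateL e π A C B D
        ◁ ⟪ (A ⊗ C) ⋉ b1 B D ; b1 A C ⋊ (D ⊗ B) ; av1 av (C ⊗ A) D B ;
            a1 a C A D ⋊ B ; a1 a C (A ⊗ D) B ; C ⋉ (b1 A D ⋊ B) ⟫)
    ;; (⟪ (A ⋉ b1 B C) ⋊ D ; av1 av A C B ⋊ D ; a1 a (A ⊗ C) B D ;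
          (A ⊗ C) ⋉ b1 B D ; b1 A C ⋊ (D ⊗ B) ⟫
        ▷ mateR e π C A D B ◁ ⟪ C ⋉ (b1 A D ⋊ B) ⟫)
    ;; (⟪ (A ⋉ b1 B C) ⋊ D ; av1 av A C B ⋊ D ; a1 a (A ⊗ C) B D ⟫
        ▷ texch T (b1 A C) (b1 B D)
        ◁ ⟪ a1 a C A (D ⊗ B) ; C ⋉ av1 av A D B ; C ⋉ (b1 A D ⋊ B) ⟫).

(** The Yang--Baxter axiom (Breen polytope). *)
Definition braid_axiom_YB (R : hexagonator_type a b) (S : hexagonatorv_type) : Prop :=
  forall A B C : K,
    (⟪ a1 a A B C ; A ⋉ b1 B C ; av1 av A C B ⟫ ▷ hexa' R A C B ◁ ⟪⟫)
    ;; (⟪ a1 a A B C ; A ⋉ b1 B C ⟫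
        ▷ eps e A C B ◁ ⟪ b1 A (C ⊗ B) ; a1 a C B A ⟫)
    ;; (⟪ a1 a A B C ⟫ ▷ bR A (b1 B C) ◁ ⟪ a1 a C B A ⟫)
    ;; (⟪ a1 a A B C ; b1 A (B ⊗ C) ⟫
        ▷ eta e B C A ◁ ⟪ b1 B C ⋊ A ; a1 a C B A ⟫)
    ;; (⟪⟫ ▷ hexa R A B C ◁ ⟪ av1 av B C A ; b1 B C ⋊ A ; a1 a C B A ⟫)
    =
    (⟪ a1 a A B C ⟫ ▷ hexv' S A B C ◁ ⟪ a1 a C A B ; C ⋉ b1 A B ⟫)
    ;; (⟪⟫ ▷ eta' e A B C
        ◁ ⟪ b1 (A ⊗ B) C ; av1 av C A B ; a1 a C A B ; C ⋉ b1 A B ⟫)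
    ;; (⟪ b1 (A ⊗ B) C ⟫ ▷ eps e C A B ◁ ⟪ C ⋉ b1 A B ⟫)
    ;; bL' (b1 A B) C
    ;; (⟪ b1 A B ⋊ C ⟫ ▷ eta e B A C ◁ ⟪ b1 (B ⊗ A) C ⟫)
    ;; (⟪ b1 A B ⋊ C ; a1 a B A C ; av1 av B A C ; b1 (B ⊗ A) C ⟫
        ▷ eps' e C B A ◁ ⟪⟫)
    ;; (⟪ b1 A B ⋊ C ; a1 a B A C ⟫ ▷ hexv S B A C ◁ ⟪ a1 a C B A ⟫).

(** *** Syllepsis and symmetry *)

Definition sycell (ν : syllepsis_type b) (A B : K) : pcell ⟪⟫ ⟪ b1 A B ; b1 B A ⟫ :=
  ν ((A, B) : B2 K).

Definition syllepsis_axiom_12 (R : hexagonator_type a b) (S : hexagonatorv_type)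
    (ν : syllepsis_type b) : Prop :=
  forall A B C : K,
    eta e A B C
    ;; (⟪ a1 a A B C ⟫ ▷ sycell ν A (B ⊗ C) ◁ ⟪ av1 av A B C ⟫)
    ;; (⟪ a1 a A B C ; b1 A (B ⊗ C) ⟫
        ▷ eta e B C A ◁ ⟪ b1 (B ⊗ C) A ; av1 av A B C ⟫)
    ;; (⟪⟫ ▷ hexa R A B C ◁ ⟪ av1 av B C A ; b1 (B ⊗ C) A ; av1 av A B C ⟫)
    ;; (⟪ b1 A B ⋊ C ; a1 a B A C ; B ⋉ b1 A C ⟫ ▷ hexv S B C A ◁ ⟪⟫)
    =
    sycell ν A B ⋊₂ C
    ;; (⟪ b1 A B ⋊ C ⟫ ▷ eta e B A C ◁ ⟪ b1 B A ⋊ C ⟫)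
    ;; (⟪ b1 A B ⋊ C ; a1 a B A C ⟫
        ▷ B ⋉₂ sycell ν A C ◁ ⟪ av1 av B A C ; b1 B A ⋊ C ⟫).

Definition syllepsis_axiom_21 (R : hexagonator_type a b) (S : hexagonatorv_type)
    (ν : syllepsis_type b) : Prop :=
  forall A B C : K,
    eps' e A B C
    ;; (⟪ av1 av A B C ⟫ ▷ sycell ν (A ⊗ B) C ◁ ⟪ a1 a A B C ⟫)
    ;; (⟪ av1 av A B C ; b1 (A ⊗ B) C ⟫
        ▷ eps' e C A B ◁ ⟪ b1 C (A ⊗ B) ; a1 a A B C ⟫)
    ;; (⟪⟫ ▷ hexv S A B C ◁ ⟪ a1 a C A B ; b1 C (A ⊗ B) ; a1 a A B C ⟫)
    ;; (⟪ A ⋉ b1 B C ; av1 av A C B ; b1 A C ⋊ B ⟫ ▷ hexa R C A B ◁ ⟪⟫)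
    =
    A ⋉₂ sycell ν B C
    ;; (⟪ A ⋉ b1 B C ⟫ ▷ eps' e A C B ◁ ⟪ A ⋉ b1 C B ⟫)
    ;; (⟪ A ⋉ b1 B C ; av1 av A C B ⟫
        ▷ sycell ν A C ⋊₂ B ◁ ⟪ a1 a A C B ; A ⋉ b1 C B ⟫).

Definition symmetry_axiom (ν : syllepsis_type b) : Prop :=
  forall A B : K,
    (⟪⟫ ▷ sycell ν A B ◁ ⟪ b1 A B ⟫) = (⟪ b1 A B ⟫ ▷ sycell ν B A ◁ ⟪⟫).

End Braiding.

End Pasting.

Arguments pentagonator_cell {K T} a.
Arguments pentagonator_cell' {K T} a.

(** The pentagonator of the reversed structure. *)
Definition pent_rev (K : bicat) (T : psfun (bprod K K) K) (a : assoc_type T)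
    (av : assocv_type T) (e : adjequiv a av) (π : pentagonator_type a) :
    pentagonator_cell (assoc_rev av) :=
  fun A B C D => pentv e π D C B A.
Definition pent_rev' (K : bicat) (T : psfun (bprod K K) K) (a : assoc_type T)
    (av : assocv_type T) (e : adjequiv a av) (π : pentagonator_type a) :
    pentagonator_cell' (assoc_rev av) :=
  fun A B C D => pentv' e π D C B A.

(** ** Monoidal, braided and symmetric structures *)

(** Tensor product, unit, and constraint equivalences with their reverses. *)
Record mon_data (B : bicat) := MonData {
  mT : psfun (bprod B B) B;
  mU : psfun bterm B;
  mα : assoc_type mT;
  mαv : assocv_type mT;
  mλ : lunit_type mT mU;
  mλv : lunitv_type mT mU;
  mρ : runit_type mT mU;
  mρv : runitv_type mT mU
}.

Record monoidal_bicat (B : bicat) (M : mon_data B) : Type := MonoidalBicat {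
  mb_bicat : is_bicat B;
  mb_tensor : is_psfun (mT M);
  mb_unit : is_psfun (mU M);
  mb_assoc : adjequiv (mα M) (mαv M);
  mb_lunit : adjequiv (mλ M) (mλv M);
  mb_runit : adjequiv (mρ M) (mρv M);
  mb_pent : pentagonator_type (mα M);
  mb_mid : munit_type (mα M) (mλ M) (mρ M);
  mb_left : lunitor_type (mα M) (mλ M);
  mb_right : runitor_type (mα M) (mρ M);
  mb_assoc_axiom : assoc_axiom (pent mb_pent);
  mb_left_axiom : left_unit_axiom mb_pent mb_mid mb_left;
  mb_right_axiom : right_unit_axiom mb_pent mb_mid mb_right
}.

Definition braidv_type (B : bicat) (T : psfun (bprod B B) B) : Type :=
  psnat (ten T p22 p21) (ten T p21 p22).

Record braided_bicat (B : bicat) (M : mon_data B) (m : monoidal_bicat M)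
    (b : braid_type (mT M)) (bv : braidv_type (mT M)) : Type := BraidedBicat {
  bb_braid : adjequiv b bv;
  bb_hex : hexagonator_type (mα M) b;
  bb_hexv : hexagonatorv_type b (mαv M);
  bb_axiom_13 : braid_axiom_13 (pent (mb_pent m)) (pent' (mb_pent m)) (hexa' bb_hex);
  bb_axiom_31 : braid_axiom_13 (pent_rev (mb_assoc m) (mb_pent m))
                  (pent_rev' (mb_assoc m) (mb_pent m)) (hexa' bb_hexv);
  bb_axiom_22 : braid_axiom_22 (mb_assoc m) (mb_pent m) bb_hex bb_hexv;
  bb_axiom_YB : braid_axiom_YB (mb_assoc m) bb_hex bb_hexv
}.

Record symmetric_bicat (B : bicat) (M : mon_data B) (m : monoidal_bicat M)
    (b : braid_type (mT M)) (bv : braidv_type (mT M))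
    (β : braided_bicat m b bv) : Type := SymmetricBicat {
  sb_syllepsis : syllepsis_type b;
  sb_axiom_12 : syllepsis_axiom_12 (mb_assoc m) (bb_hex β) (bb_hexv β) sb_syllepsis;
  sb_axiom_21 : syllepsis_axiom_21 (mb_assoc m) (bb_hex β) (bb_hexv β) sb_syllepsis;
  sb_symmetry : symmetry_axiom sb_syllepsis
}.

(** * Double categories *)

(** The categories [D_0] (objects, tight 1-cells) and [D_1] (loose 1-cells,
    2-cells) with the functors [S], [T : D_1 -> D_0].  A 2-cell does not carry its
    tight boundary in its type; the boundary is given by [src] and [tgt], so that
    all equations between 2-cells are homogeneous. *)
Record dgraph := DGraph {
  dob :> Type;
  tight : dob -> dob -> Type;
  tid : forall A : dob, tight A A;
  tcmp : forall A B C : dob, tight B C -> tight A B -> tight A C;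
  tcmpA : forall (A B C D : dob) (f : tight A B) (g : tight B C) (h : tight C D),
    tcmp h (tcmp g f) = tcmp (tcmp h g) f;
  tcmp1l : forall (A B : dob) (f : tight A B), tcmp (tid B) f = f;
  tcmp1r : forall (A B : dob) (f : tight A B), tcmp f (tid A) = f;
  loose : dob -> dob -> Type;
  cell : forall A B A' B' : dob, loose A B -> loose A' B' -> Type;
  cid : forall (A B : dob) (M : loose A B), cell M M;
  ccmp : forall (A B A' B' A'' B'' : dob)
      (M : loose A B) (N : loose A' B') (P : loose A'' B''),
    cell N P -> cell M N -> cell M P;
  ccmpA : forall (A B A' B' A'' B'' A3 B3 : dob)
      (M : loose A B) (N : loose A' B') (P : loose A'' B'') (Q : loose A3 B3)
      (α : cell M N) (β : cell N P) (γ : cell P Q),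
    ccmp γ (ccmp β α) = ccmp (ccmp γ β) α;
  ccmp1l : forall (A B A' B' : dob) (M : loose A B) (N : loose A' B') (α : cell M N),
    ccmp (cid N) α = α;
  ccmp1r : forall (A B A' B' : dob) (M : loose A B) (N : loose A' B') (α : cell M N),
    ccmp α (cid M) = α;
  src : forall (A B A' B' : dob) (M : loose A B) (N : loose A' B'),
    cell M N -> tight A A';
  tgt : forall (A B A' B' : dob) (M : loose A B) (N : loose A' B'),
    cell M N -> tight B B';
  src_id : forall (A B : dob) (M : loose A B), src (cid M) = tid A;
  tgt_id : forall (A B : dob) (M : loose A B), tgt (cid M) = tid B;
  src_cmp : forall (A B A' B' A'' B'' : dob)
      (M : loose A B) (N : loose A' B') (P : loose A'' B'')
      (α : cell M N) (β : cell N P),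
    src (ccmp β α) = tcmp (src β) (src α);
  tgt_cmp : forall (A B A' B' A'' B'' : dob)
      (M : loose A B) (N : loose A' B') (P : loose A'' B'')
      (α : cell M N) (β : cell N P),
    tgt (ccmp β α) = tcmp (tgt β) (tgt α)
}.

Arguments tid {d} A.
Arguments cid {d A B} M.

Declare Scope dbl_scope.
Delimit Scope dbl_scope with dbl.
Local Open Scope dbl_scope.
Notation "g ∘ₜ f" := (tcmp g f) (at level 40, left associativity) : dbl_scope.
Notation "β • α" := (ccmp β α) (at level 50, left associativity) : dbl_scope.

(** Globular 2-cells. *)
Definition glob (D : dgraph) (A B : D) (M N : loose A B) : Type :=
  {α : cell M N | src α = tid A /\ tgt α = tid B}.

Definition gcell (D : dgraph) (A B : D) (M N : loose A B) (α : glob M N) : cell M N :=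
  proj1_sig α.
Coercion gcell : glob >-> cell.

Lemma gsrc (D : dgraph) (A B : D) (M N : loose A B) (α : glob M N) : src α = tid A.
Proof. by case: α => [? []]. Qed.

Lemma gtgt (D : dgraph) (A B : D) (M N : loose A B) (α : glob M N) : tgt α = tid B.
Proof. by case: α => [? []]. Qed.

Definition mkglob (D : dgraph) (A B : D) (M N : loose A B) (α : cell M N)
    (s : src α = tid A) (t : tgt α = tid B) : glob M N :=
  exist _ α (conj s t).

Definition gid (D : dgraph) (A B : D) (M : loose A B) : glob M M :=
  mkglob (src_id M) (tgt_id M).

Section GlobComp.
Variables (D : dgraph) (A B : D) (M N P : loose A B) (β : glob N P) (α : glob M N).

Lemma gcmp_src : src (β • α) = tid A.
Proof. by rewrite src_cmp !gsrc tcmp1l. Qed.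

Lemma gcmp_tgt : tgt (β • α) = tid B.
Proof. by rewrite tgt_cmp !gtgt tcmp1l. Qed.

Definition gcmp : glob M P := mkglob gcmp_src gcmp_tgt.
End GlobComp.

Definition ginverse (D : dgraph) (A B : D) (M N : loose A B)
    (α : glob M N) (β : glob N M) : Prop :=
  β • α = cid M /\ α • β = cid N.

(** Pseudo double categories; [odot N M] is [N ⊙ M]. *)
Record dblcat := DblCat {
  dcarrier :> dgraph;
  U : forall A : dcarrier, loose A A;
  Ucell : forall (A B : dcarrier) (f : tight A B), cell (U A) (U B);
  Ucell_src : forall (A B : dcarrier) (f : tight A B), src (Ucell f) = f;
  Ucell_tgt : forall (A B : dcarrier) (f : tight A B), tgt (Ucell f) = f;
  Ucell_id : forall A : dcarrier, Ucell (tid A) = cid (U A);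
  Ucell_cmp : forall (A B C : dcarrier) (f : tight A B) (g : tight B C),
    Ucell (g ∘ₜ f) = Ucell g • Ucell f;
  odot : forall A B C : dcarrier, loose B C -> loose A B -> loose A C;
  ocell : forall (A B C A' B' C' : dcarrier)
      (M : loose A B) (N : loose B C) (M' : loose A' B') (N' : loose B' C')
      (β : cell N N') (α : cell M M'),
    tgt α = src β -> cell (odot N M) (odot N' M');
  ocell_src : forall (A B C A' B' C' : dcarrier)
      (M : loose A B) (N : loose B C) (M' : loose A' B') (N' : loose B' C')
      (β : cell N N') (α : cell M M') (e : tgt α = src β),
    src (ocell e) = src α;
  ocell_tgt : forall (A B C A' B' C' : dcarrier)
      (M : loose A B) (N : loose B C) (M' : loose A' B') (N' : loose B' C')
      (β : cell N N') (α : cell M M') (e : tgt α = src β),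
    tgt (ocell e) = tgt β;
  ocell_id : forall (A B C : dcarrier) (M : loose A B) (N : loose B C)
      (e : tgt (cid M) = src (cid N)),
    ocell e = cid (odot N M);
  ocell_cmp : forall (A B C A' B' C' A'' B'' C'' : dcarrier)
      (M : loose A B) (N : loose B C) (M' : loose A' B') (N' : loose B' C')
      (M'' : loose A'' B'') (N'' : loose B'' C'')
      (α : cell M M') (β : cell N N') (α' : cell M' M'') (β' : cell N' N'')
      (e : tgt α = src β) (e' : tgt α' = src β')
      (e'' : tgt (α' • α) = src (β' • β)),
    ocell e'' = ocell e' • ocell e;
  dassoc : forall (A B C D : dcarrier) (M : loose A B) (N : loose B C) (P : loose C D),
    glob (odot (odot P N) M) (odot P (odot N M));
  dassoc' : forall (A B C D : dcarrier) (M : loose A B) (N : loose B C) (P : loose C D),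
    glob (odot P (odot N M)) (odot (odot P N) M);
  dlunit : forall (A B : dcarrier) (M : loose A B), glob (odot (U B) M) M;
  dlunit' : forall (A B : dcarrier) (M : loose A B), glob M (odot (U B) M);
  drunit : forall (A B : dcarrier) (M : loose A B), glob (odot M (U A)) M;
  drunit' : forall (A B : dcarrier) (M : loose A B), glob M (odot M (U A));
  dassoc_inv : forall (A B C D : dcarrier)
      (M : loose A B) (N : loose B C) (P : loose C D),
    ginverse (dassoc M N P) (dassoc' M N P);
  dlunit_inv : forall (A B : dcarrier) (M : loose A B),
    ginverse (dlunit M) (dlunit' M);
  drunit_inv : forall (A B : dcarrier) (M : loose A B),
    ginverse (drunit M) (drunit' M);
  dassoc_nat : forall (A B C D A' B' C' D' : dcarrier)
      (M : loose A B) (N : loose B C) (P : loose C D)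
      (M' : loose A' B') (N' : loose B' C') (P' : loose C' D')
      (α : cell M M') (β : cell N N') (γ : cell P P')
      (e1 : tgt β = src γ) (e2 : tgt α = src (ocell e1))
      (e3 : tgt α = src β) (e4 : tgt (ocell e3) = src γ),
    dassoc M' N' P' • ocell e2 = ocell e4 • dassoc M N P;
  dlunit_nat : forall (A B A' B' : dcarrier) (M : loose A B) (M' : loose A' B')
      (α : cell M M') (e : tgt α = src (Ucell (tgt α))),
    dlunit M' • ocell e = α • dlunit M;
  drunit_nat : forall (A B A' B' : dcarrier) (M : loose A B) (M' : loose A' B')
      (α : cell M M') (e : tgt (Ucell (src α)) = src α),
    drunit M' • ocell e = α • drunit M;
  dpentagon : forall (A B C D E : dcarrier)
      (M : loose A B) (N : loose B C) (P : loose C D) (Q : loose D E)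
      (e1 : tgt (dassoc M N P) = src (cid Q)) (e2 : tgt (cid M) = src (dassoc N P Q)),
    dassoc (odot N M) P Q • dassoc M N (odot Q P)
    = ocell e1 • dassoc M (odot P N) Q • ocell e2;
  dtriangle : forall (A B C : dcarrier) (M : loose A B) (N : loose B C)
      (e1 : tgt (dlunit M) = src (cid N)) (e2 : tgt (cid M) = src (drunit N)),
    ocell e1 • dassoc M (U B) N = ocell e2
}.

Arguments U {d} A.
Arguments dassoc {d A B C D} M N P.
Arguments dassoc' {d A B C D} M N P.
Arguments dlunit {d A B} M.
Arguments dlunit' {d A B} M.
Arguments drunit {d A B} M.
Arguments drunit' {d A B} M.
Notation "N ⊙ M" := (odot N M) (at level 40, left associativity) : dbl_scope.

(** Horizontal composite of globular cells. *)
Section GlobOdot.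
Variables (D : dblcat) (A B C : D) (M M' : loose A B) (N N' : loose B C).
Variables (β : glob N N') (α : glob M M').

Lemma godot_eq : tgt α = src β.
Proof. by rewrite gtgt gsrc. Qed.

Lemma godot_src : src (ocell godot_eq) = tid A.
Proof. by rewrite ocell_src gsrc. Qed.

Lemma godot_tgt : tgt (ocell godot_eq) = tid C.
Proof. by rewrite ocell_tgt gtgt. Qed.

Definition godot : glob (N ⊙ M) (N' ⊙ M') := mkglob godot_src godot_tgt.
End GlobOdot.

(** ** The loose bicategory *)

Definition Lb (D : dblcat) : bicat := {|
  ob := D;
  hom A B := loose A B;
  two A B M N := glob M N;
  id1 A := U A;
  comp1 A B C N M := N ⊙ M;
  id2 A B M := gid M;
  vcomp A B M N P β α := gcmp β α;
  hcomp A B C M M' N N' β α := godot β α;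
  assoc A B C E M N P := dassoc M N P;
  assoc' A B C E M N P := dassoc' M N P;
  lunit A B M := dlunit M;
  lunit' A B M := dlunit' M;
  runit A B M := drunit M;
  runit' A B M := drunit' M
|}.

(** ** Products and the terminal double category *)

Definition gprod (D E : dgraph) : dgraph := {|
  dob := dob D * dob E;
  tight A B := (tight A.1 B.1 * tight A.2 B.2)%type;
  tid A := (tid A.1, tid A.2);
  tcmp A B C g f := (g.1 ∘ₜ f.1, g.2 ∘ₜ f.2);
  tcmpA A B C F f g h := ltac:(by congr pair; apply: tcmpA);
  tcmp1l A B f := ltac:(by case: f => f1 f2; congr pair; apply: tcmp1l);
  tcmp1r A B f := ltac:(by case: f => f1 f2; congr pair; apply: tcmp1r);
  loose A B := (loose A.1 B.1 * loose A.2 B.2)%type;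
  cell A B A' B' M N := (cell M.1 N.1 * cell M.2 N.2)%type;
  cid A B M := (cid M.1, cid M.2);
  ccmp A B A' B' A'' B'' M N P β α := (β.1 • α.1, β.2 • α.2);
  ccmpA A B A' B' A'' B'' A3 B3 M N P Q α β γ := ltac:(by congr pair; apply: ccmpA);
  ccmp1l A B A' B' M N α := ltac:(by case: α => α1 α2; congr pair; apply: ccmp1l);
  ccmp1r A B A' B' M N α := ltac:(by case: α => α1 α2; congr pair; apply: ccmp1r);
  src A B A' B' M N α := (src α.1, src α.2);
  tgt A B A' B' M N α := (tgt α.1, tgt α.2);
  src_id A B M := ltac:(by congr pair; apply: src_id);
  tgt_id A B M := ltac:(by congr pair; apply: tgt_id);
  src_cmp A B A' B' A'' B'' M N P α β := ltac:(by congr pair; apply: src_cmp);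
  tgt_cmp A B A' B' A'' B'' M N P α β := ltac:(by congr pair; apply: tgt_cmp)
|}.

Definition gpair (D E : dgraph) (A B : gprod D E) (M N : loose A B)
    (α : glob M.1 N.1) (β : glob M.2 N.2) : glob M N :=
  @mkglob (gprod D E) A B M N (gcell α, gcell β)
    (f_equal2 pair (gsrc α) (gsrc β)) (f_equal2 pair (gtgt α) (gtgt β)).

Arguments gpair {D E A B M N} & α β.

Definition dprod (D E : dblcat) : dblcat := {|
  dcarrier := gprod D E;
  U A := (U A.1, U A.2);
  Ucell A B f := (Ucell f.1, Ucell f.2);
  Ucell_src A B f := ltac:(by case: f => f1 f2; congr pair; apply: Ucell_src);
  Ucell_tgt A B f := ltac:(by case: f => f1 f2; congr pair; apply: Ucell_tgt);
  Ucell_id A := ltac:(by congr pair; apply: Ucell_id);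
  Ucell_cmp A B C f g := ltac:(by congr pair; apply: Ucell_cmp);
  odot A B C N M := (N.1 ⊙ M.1, N.2 ⊙ M.2);
  ocell A B C A' B' C' M N M' N' β α e :=
    (ocell (f_equal fst e), ocell (f_equal snd e));
  ocell_src A B C A' B' C' M N M' N' β α e := ltac:(by congr pair; apply: ocell_src);
  ocell_tgt A B C A' B' C' M N M' N' β α e := ltac:(by congr pair; apply: ocell_tgt);
  ocell_id A B C M N e := ltac:(by congr pair; apply: ocell_id);
  ocell_cmp A B C A' B' C' A'' B'' C'' M N M' N' M'' N'' α β α' β' e e' e'' :=
    ltac:(by congr pair; apply: ocell_cmp);
  dassoc A B C F M N P := gpair (dassoc M.1 N.1 P.1) (dassoc M.2 N.2 P.2);
  dassoc' A B C F M N P := gpair (dassoc' M.1 N.1 P.1) (dassoc' M.2 N.2 P.2);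
  dlunit A B M := gpair (dlunit M.1) (dlunit M.2);
  dlunit' A B M := gpair (dlunit' M.1) (dlunit' M.2);
  drunit A B M := gpair (drunit M.1) (drunit M.2);
  drunit' A B M := gpair (drunit' M.1) (drunit' M.2);
  dassoc_inv A B C F M N P := ltac:(by split; congr pair;
    [apply: (proj1 (dassoc_inv _ _ _)).. | apply: (proj2 (dassoc_inv _ _ _)) |
     apply: (proj2 (dassoc_inv _ _ _))]);
  dlunit_inv A B M := ltac:(by split; congr pair;
    [apply: (proj1 (dlunit_inv _)).. | apply: (proj2 (dlunit_inv _)) |
     apply: (proj2 (dlunit_inv _))]);
  drunit_inv A B M := ltac:(by split; congr pair;
    [apply: (proj1 (drunit_inv _)).. | apply: (proj2 (drunit_inv _)) |
     apply: (proj2 (drunit_inv _))]);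
  dassoc_nat A B C F A' B' C' F' M N P M' N' P' α β γ e1 e2 e3 e4 :=
    ltac:(by congr pair; apply: dassoc_nat);
  dlunit_nat A B A' B' M M' α e :=
    ltac:(by case: α e => α1 α2 e; congr pair; apply: dlunit_nat);
  drunit_nat A B A' B' M M' α e :=
    ltac:(by case: α e => α1 α2 e; congr pair; apply: drunit_nat);
  dpentagon A B C F G M N P Q e1 e2 := ltac:(by congr pair; apply: dpentagon);
  dtriangle A B C M N e1 e2 := ltac:(by congr pair; apply: dtriangle)
|}.

Definition gterm : dgraph := {|
  dob := unit;
  tight _ _ := unit;
  tid _ := tt;
  tcmp _ _ _ _ _ := tt;
  tcmpA _ _ _ _ _ _ _ := erefl;
  tcmp1l _ _ f := ltac:(by case: f);
  tcmp1r _ _ f := ltac:(by case: f);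
  loose _ _ := unit;
  cell _ _ _ _ _ _ := unit;
  cid _ _ _ := tt;
  ccmp _ _ _ _ _ _ _ _ _ _ _ := tt;
  ccmpA _ _ _ _ _ _ _ _ _ _ _ _ _ _ _ := erefl;
  ccmp1l _ _ _ _ _ _ α := ltac:(by case: α);
  ccmp1r _ _ _ _ _ _ α := ltac:(by case: α);
  src _ _ _ _ _ _ _ := tt;
  tgt _ _ _ _ _ _ _ := tt;
  src_id _ _ _ := erefl;
  tgt_id _ _ _ := erefl;
  src_cmp _ _ _ _ _ _ _ _ _ _ _ := erefl;
  tgt_cmp _ _ _ _ _ _ _ _ _ _ _ := erefl
|}.

Definition gtt (A B : gterm) (M N : loose A B) : glob M N :=
  @mkglob gterm A B M N tt erefl erefl.

Definition dterm : dblcat := {|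
  dcarrier := gterm;
  U _ := tt;
  Ucell _ _ _ := tt;
  Ucell_src _ _ f := ltac:(by case: f);
  Ucell_tgt _ _ f := ltac:(by case: f);
  Ucell_id _ := erefl;
  Ucell_cmp _ _ _ _ _ := erefl;
  odot _ _ _ _ _ := tt;
  ocell _ _ _ _ _ _ _ _ _ _ _ _ _ := tt;
  ocell_src _ _ _ _ _ _ _ _ _ _ _ _ _ := erefl;
  ocell_tgt _ _ _ _ _ _ _ _ _ _ _ _ _ := erefl;
  ocell_id _ _ _ _ _ _ := erefl;
  ocell_cmp _ _ _ _ _ _ _ _ _ _ _ _ _ _ _ _ _ _ _ _ _ _ := erefl;
  dassoc A B C E M N P := @gtt A E tt tt;
  dassoc' A B C E M N P := @gtt A E tt tt;
  dlunit A B M := @gtt A B tt M;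
  dlunit' A B M := @gtt A B M tt;
  drunit A B M := @gtt A B tt M;
  drunit' A B M := @gtt A B M tt;
  dassoc_inv _ _ _ _ _ _ _ := conj erefl erefl;
  dlunit_inv _ _ _ := conj erefl erefl;
  drunit_inv _ _ _ := conj erefl erefl;
  dassoc_nat _ _ _ _ _ _ _ _ _ _ _ _ _ _ _ _ _ _ _ _ _ := erefl;
  dlunit_nat _ _ _ _ _ _ _ _ := erefl;
  drunit_nat _ _ _ _ _ _ _ _ := erefl;
  dpentagon _ _ _ _ _ _ _ _ _ _ _ := erefl;
  dtriangle _ _ _ _ _ _ _ := erefl
|}.

(** ** Double functors and transformations

    As for pseudofunctors, the axioms on the constraint cells of a double functor
    are collected in a separate predicate [is_dfun]. *)

Record dfun (D E : dblcat) := DFun {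
  df0 :> D -> E;
  df1 : forall A B : D, tight A B -> tight (df0 A) (df0 B);
  df1_id : forall A : D, df1 (tid A) = tid (df0 A);
  df1_cmp : forall (A B C : D) (f : tight A B) (g : tight B C),
    df1 (g ∘ₜ f) = df1 g ∘ₜ df1 f;
  dfl : forall A B : D, loose A B -> loose (df0 A) (df0 B);
  dfc : forall (A B A' B' : D) (M : loose A B) (N : loose A' B'),
    cell M N -> cell (dfl M) (dfl N);
  dfc_id : forall (A B : D) (M : loose A B), dfc (cid M) = cid (dfl M);
  dfc_cmp : forall (A B A' B' A'' B'' : D)
      (M : loose A B) (N : loose A' B') (P : loose A'' B'')
      (α : cell M N) (β : cell N P),
    dfc (β • α) = dfc β • dfc α;
  dfc_src : forall (A B A' B' : D) (M : loose A B) (N : loose A' B') (α : cell M N),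
    src (dfc α) = df1 (src α);
  dfc_tgt : forall (A B A' B' : D) (M : loose A B) (N : loose A' B') (α : cell M N),
    tgt (dfc α) = df1 (tgt α);
  dfO : forall (A B C : D) (M : loose A B) (N : loose B C),
    glob (dfl N ⊙ dfl M) (dfl (N ⊙ M));
  dfO' : forall (A B C : D) (M : loose A B) (N : loose B C),
    glob (dfl (N ⊙ M)) (dfl N ⊙ dfl M);
  dfU : forall A : D, glob (U (df0 A)) (dfl (U A));
  dfU' : forall A : D, glob (dfl (U A)) (U (df0 A))
}.

Arguments df1 {D E} d {A B} f.
Arguments dfl {D E} d {A B} M : rename.
Arguments dfc {D E} d {A B A' B' M N} α : rename.
Arguments dfO {D E} d {A B C} M N.
Arguments dfO' {D E} d {A B C} M N.
Arguments dfU {D E} d A.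
Arguments dfU' {D E} d A.

Record is_dfun (D E : dblcat) (F : dfun D E) : Prop := IsDFun {
  dfO_inv : forall (A B C : D) (M : loose A B) (N : loose B C),
    ginverse (dfO F M N) (dfO' F M N);
  dfU_inv : forall A : D, ginverse (dfU F A) (dfU' F A);
  dfO_nat : forall (A B C A' B' C' : D)
      (M : loose A B) (N : loose B C) (M' : loose A' B') (N' : loose B' C')
      (β : cell N N') (α : cell M M')
      (e : tgt α = src β) (e' : tgt (dfc F α) = src (dfc F β)),
    dfO F M' N' • ocell e' = dfc F (ocell e) • dfO F M N;
  dfU_nat : forall (A B : D) (f : tight A B),
    dfU F B • Ucell (df1 F f) = dfc F (Ucell f) • dfU F A;
  dfO_assoc : forall (A B C E' : D) (M : loose A B) (N : loose B C) (P : loose C E')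
      (e1 : tgt (cid (dfl F M)) = src (dfO F N P))
      (e2 : tgt (dfO F M N) = src (cid (dfl F P))),
    dfc F (dassoc M N P) • dfO F M (P ⊙ N) • ocell e1
    = dfO F (N ⊙ M) P • ocell e2 • dassoc (dfl F M) (dfl F N) (dfl F P);
  dfO_lunit : forall (A B : D) (M : loose A B)
      (e : tgt (cid (dfl F M)) = src (dfU F B)),
    dfc F (dlunit M) • dfO F M (U B) • ocell e = dlunit (dfl F M);
  dfO_runit : forall (A B : D) (M : loose A B)
      (e : tgt (dfU F A) = src (cid (dfl F M))),
    dfc F (drunit M) • dfO F (U A) M • ocell e = drunit (dfl F M)
}.

(** Image of a globular cell. *)
Section GlobFun.
Variables (D E : dblcat) (F : dfun D E) (A B : D) (M N : loose A B) (α : glob M N).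

Lemma gfun_src : src (dfc F α) = tid (F A).
Proof. by rewrite dfc_src gsrc df1_id. Qed.

Lemma gfun_tgt : tgt (dfc F α) = tid (F B).
Proof. by rewrite dfc_tgt gtgt df1_id. Qed.

Definition gfun : glob (dfl F M) (dfl F N) := mkglob gfun_src gfun_tgt.
End GlobFun.

Definition df_id (D : dblcat) : dfun D D := {|
  df0 A := A;
  df1 A B f := f;
  df1_id A := erefl;
  df1_cmp A B C f g := erefl;
  dfl A B M := M;
  dfc A B A' B' M N α := α;
  dfc_id A B M := erefl;
  dfc_cmp A B A' B' A'' B'' M N P α β := erefl;
  dfc_src A B A' B' M N α := erefl;
  dfc_tgt A B A' B' M N α := erefl;
  dfO A B C M N := gid (N ⊙ M);
  dfO' A B C M N := gid (N ⊙ M);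
  dfU A := gid (U A);
  dfU' A := gid (U A)
|}.

Definition df_comp (D E H : dblcat) (G : dfun E H) (F : dfun D E) : dfun D H := {|
  df0 A := G (F A);
  df1 A B f := df1 G (df1 F f);
  df1_id A := ltac:(by rewrite /= !df1_id);
  df1_cmp A B C f g := ltac:(by rewrite /= !df1_cmp);
  dfl A B M := dfl G (dfl F M);
  dfc A B A' B' M N α := dfc G (dfc F α);
  dfc_id A B M := ltac:(by rewrite /= !dfc_id);
  dfc_cmp A B A' B' A'' B'' M N P α β := ltac:(by rewrite /= !dfc_cmp);
  dfc_src A B A' B' M N α := ltac:(by rewrite /= !dfc_src);
  dfc_tgt A B A' B' M N α := ltac:(by rewrite /= !dfc_tgt);
  dfO A B C M N := gcmp (gfun G (dfO F M N)) (dfO G (dfl F M) (dfl F N));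
  dfO' A B C M N := gcmp (dfO' G (dfl F M) (dfl F N)) (gfun G (dfO' F M N));
  dfU A := gcmp (gfun G (dfU F A)) (dfU G (F A));
  dfU' A := gcmp (dfU' G (F A)) (gfun G (dfU' F A))
|}.

Definition df_pair (D E H : dblcat) (F : dfun D E) (G : dfun D H) :
    dfun D (dprod E H) := {|
  df0 A := (F A, G A) : dprod E H;
  df1 A B f := (df1 F f, df1 G f);
  df1_id A := ltac:(by congr pair; apply: df1_id);
  df1_cmp A B C f g := ltac:(by congr pair; apply: df1_cmp);
  dfl A B M := (dfl F M, dfl G M);
  dfc A B A' B' M N α := (dfc F α, dfc G α);
  dfc_id A B M := ltac:(by congr pair; apply: dfc_id);
  dfc_cmp A B A' B' A'' B'' M N P α β := ltac:(by congr pair; apply: dfc_cmp);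
  dfc_src A B A' B' M N α := ltac:(by congr pair; apply: dfc_src);
  dfc_tgt A B A' B' M N α := ltac:(by congr pair; apply: dfc_tgt);
  dfO A B C M N := gpair (dfO F M N) (dfO G M N);
  dfO' A B C M N := gpair (dfO' F M N) (dfO' G M N);
  dfU A := gpair (dfU F A) (dfU G A);
  dfU' A := gpair (dfU' F A) (dfU' G A)
|}.

Definition df_fst (D E : dblcat) : dfun (dprod D E) D := {|
  df0 (A : dprod D E) := A.1;
  df1 A B f := f.1;
  df1_id A := erefl;
  df1_cmp A B C f g := erefl;
  dfl A B M := M.1;
  dfc A B A' B' M N α := α.1;
  dfc_id A B M := erefl;
  dfc_cmp A B A' B' A'' B'' M N P α β := erefl;
  dfc_src A B A' B' M N α := erefl;
  dfc_tgt A B A' B' M N α := erefl;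
  dfO A B C M N := gid (N.1 ⊙ M.1);
  dfO' A B C M N := gid (N.1 ⊙ M.1);
  dfU A := gid (U A.1);
  dfU' A := gid (U A.1)
|}.

Definition df_snd (D E : dblcat) : dfun (dprod D E) E := {|
  df0 (A : dprod D E) := A.2;
  df1 A B f := f.2;
  df1_id A := erefl;
  df1_cmp A B C f g := erefl;
  dfl A B M := M.2;
  dfc A B A' B' M N α := α.2;
  dfc_id A B M := erefl;
  dfc_cmp A B A' B' A'' B'' M N P α β := erefl;
  dfc_src A B A' B' M N α := erefl;
  dfc_tgt A B A' B' M N α := erefl;
  dfO A B C M N := gid (N.2 ⊙ M.2);
  dfO' A B C M N := gid (N.2 ⊙ M.2);
  dfU A := gid (U A.2);
  dfU' A := gid (U A.2)
|}.

Definition df_bang (D : dblcat) : dfun D dterm := {|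
  df0 _ := tt : dterm;
  df1 _ _ _ := tt;
  df1_id _ := erefl;
  df1_cmp _ _ _ _ _ := erefl;
  dfl _ _ _ := tt;
  dfc _ _ _ _ _ _ _ := tt;
  dfc_id _ _ _ := erefl;
  dfc_cmp _ _ _ _ _ _ _ _ _ _ _ := erefl;
  dfc_src _ _ _ _ _ _ _ := erefl;
  dfc_tgt _ _ _ _ _ _ _ := erefl;
  dfO _ _ _ _ _ := @gtt tt tt tt tt;
  dfO' _ _ _ _ _ := @gtt tt tt tt tt;
  dfU _ := @gtt tt tt tt tt;
  dfU' _ := @gtt tt tt tt tt
|}.

(** Tight transformations. *)
Record dtrans (D E : dblcat) (F G : dfun D E) := DTrans {
  dt0 :> forall A : D, tight (F A) (G A);
  dt0_nat : forall (A B : D) (f : tight A B), df1 G f ∘ₜ dt0 A = dt0 B ∘ₜ df1 F f;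
  dtc : forall (A B : D) (M : loose A B), cell (dfl F M) (dfl G M);
  dtc_src : forall (A B : D) (M : loose A B), src (dtc M) = dt0 A;
  dtc_tgt : forall (A B : D) (M : loose A B), tgt (dtc M) = dt0 B;
  dtc_nat : forall (A B A' B' : D) (M : loose A B) (N : loose A' B') (α : cell M N),
    dfc G α • dtc M = dtc N • dfc F α;
  dtc_odot : forall (A B C : D) (M : loose A B) (N : loose B C)
      (e : tgt (dtc M) = src (dtc N)),
    dfO G M N • ocell e = dtc (N ⊙ M) • dfO F M N;
  dtc_U : forall A : D, dfU G A • Ucell (dt0 A) = dtc (U A) • dfU F A
}.

Arguments dtc {D E F G} d {A B} M.

Definition dinverse (D E : dblcat) (F G : dfun D E) (α : dtrans F G) (αv : dtrans G F) :
    Prop :=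
  (forall A : D, αv A ∘ₜ α A = tid (F A) /\ α A ∘ₜ αv A = tid (G A))
  /\ (forall (A B : D) (M : loose A B),
        dtc αv M • dtc α M = cid (dfl F M) /\ dtc α M • dtc αv M = cid (dfl G M)).

(** ** Companions *)

Record companion (D : dblcat) (A B : D) (f : tight A B) := Companion {
  chat : loose A B;
  ceps : cell chat (U B);
  ceps_src : src ceps = f;
  ceps_tgt : tgt ceps = tid B;
  ceta : cell (U A) chat;
  ceta_src : src ceta = tid A;
  ceta_tgt : tgt ceta = f;
  ceps_eta : ceps • ceta = Ucell f;
  ceps_odot_eta : forall e : tgt ceta = src ceps,
    dlunit chat • ocell e = drunit chat
}.

(** The 2-cell component [ε ⊙ α_M ⊙ η] at [M] of the oplax transformation induced
    by companions of the components of [α]. *)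
Section Hat.
Variables (D E : dblcat) (F G : dfun D E) (α : dtrans F G).
Variable c : forall A : D, companion (α A).
Variables (A B : D) (M : loose A B).

Lemma hat_eq1 : tgt (ceta (c A)) = src (dtc α M).
Proof. by rewrite ceta_tgt dtc_src. Qed.

Lemma hat_eq2 : tgt (ocell hat_eq1) = src (ceps (c B)).
Proof. by rewrite ocell_tgt dtc_tgt ceps_src. Qed.

Definition hat_cell : cell (chat (c B) ⊙ dfl F M) (dfl G M ⊙ chat (c A)) :=
  dlunit (dfl G M ⊙ chat (c A)) • ocell hat_eq2
  • godot (gid (chat (c B))) (drunit' (dfl F M)).

Lemma hat_src : src hat_cell = tid (F A).
Proof. by rewrite !src_cmp ocell_src ocell_src ceta_src !gsrc !tcmp1l. Qed.

Lemma hat_tgt : tgt hat_cell = tid (G B).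
Proof. by rewrite !tgt_cmp ocell_tgt ceps_tgt !gtgt !tcmp1l. Qed.

Definition hat : glob (chat (c B) ⊙ dfl F M) (dfl G M ⊙ chat (c A)) :=
  mkglob hat_src hat_tgt.
End Hat.

(** Loosely strong companions: the induced oplax transformation is pseudonatural,
    that is, its 2-cell components are invertible. *)
Record strong_companions (D E : dblcat) (F G : dfun D E) (α : dtrans F G) :=
  StrongCompanions {
  sc :> forall A : D, companion (α A);
  sc_inv : forall (A B : D) (M : loose A B),
    glob (dfl G M ⊙ chat (sc A)) (chat (sc B) ⊙ dfl F M);
  sc_invP : forall (A B : D) (M : loose A B), ginverse (hat sc M) (sc_inv M)
}.

(** ** Monoidal double categories *)

Section DTensor.
Variables (D : dblcat) (T : dfun (dprod D D) D) (I : dfun dterm D).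

Definition dten (X : dblcat) (F G : dfun X D) : dfun X D := df_comp T (df_pair F G).
Definition dunit_at (X : dblcat) : dfun X D := df_comp I (df_bang X).

Definition D2 : dblcat := dprod D D.
Definition D3 : dblcat := dprod D2 D.
Definition d21 : dfun D2 D := df_fst D D.
Definition d22 : dfun D2 D := df_snd D D.
Definition d31 : dfun D3 D := df_comp d21 (df_fst D2 D).
Definition d32 : dfun D3 D := df_comp d22 (df_fst D2 D).
Definition d33 : dfun D3 D := df_snd D2 D.

Definition dten1 (A A' C C' : D) (f : tight A A') (g : tight C C') :
    tight (T (A, C)) (T (A', C')) :=
  df1 T ((f, g) : @tight D2 (A, C) (A', C')).

Definition dtenl (A A' C C' : D) (M : loose A A') (N : loose C C') :
    loose (T (A, C)) (T (A', C')) :=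
  dfl T ((M, N) : @loose D2 (A, C) (A', C')).

Definition dtenc (A A' B B' C C' E E' : D)
    (M : loose A A') (N : loose B B') (P : loose C C') (Q : loose E E')
    (α : cell M N) (β : cell P Q) : cell (dtenl M P) (dtenl N Q) :=
  dfc T ((α, β) : @cell D2 (A, C) (A', C') (B, E) (B', E') (M, P) (N, Q)).

End DTensor.

Record monoidal_dbl := MonoidalDbl {
  mdc :> dblcat;
  mdT : dfun (dprod mdc mdc) mdc;
  mdT_dfun : is_dfun mdT;
  mdI : dfun dterm mdc;
  mdI_dfun : is_dfun mdI;
  mdα : dtrans (dten mdT (dten mdT (d31 mdc) (d32 mdc)) (d33 mdc))
               (dten mdT (d31 mdc) (dten mdT (d32 mdc) (d33 mdc)));
  mdαv : dtrans (dten mdT (d31 mdc) (dten mdT (d32 mdc) (d33 mdc)))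
                (dten mdT (dten mdT (d31 mdc) (d32 mdc)) (d33 mdc));
  mdα_inv : dinverse mdα mdαv;
  mdλ : dtrans (dten mdT (dunit_at mdI mdc) (df_id mdc)) (df_id mdc);
  mdλv : dtrans (df_id mdc) (dten mdT (dunit_at mdI mdc) (df_id mdc));
  mdλ_inv : dinverse mdλ mdλv;
  mdρ : dtrans (dten mdT (df_id mdc) (dunit_at mdI mdc)) (df_id mdc);
  mdρv : dtrans (df_id mdc) (dten mdT (df_id mdc) (dunit_at mdI mdc));
  mdρ_inv : dinverse mdρ mdρv;
  md_pentagon0 : forall A B C E : mdc,
    dten1 mdT (tid A) (mdα ((B, C, E) : D3 mdc))
      ∘ₜ mdα ((A, mdT (B, C), E) : D3 mdc)
      ∘ₜ dten1 mdT (mdα ((A, B, C) : D3 mdc)) (tid E)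
    = mdα ((A, B, mdT (C, E)) : D3 mdc) ∘ₜ mdα ((mdT (A, B), C, E) : D3 mdc);
  md_pentagon1 : forall (A B C E A' B' C' E' : mdc)
      (M : loose A A') (N : loose B B') (P : loose C C') (Q : loose E E'),
    dtenc mdT (cid M) (dtc mdα ((N, P, Q) : @loose (D3 mdc) (B, C, E) (B', C', E')))
      • dtc mdα ((M, dtenl mdT N P, Q) :
          @loose (D3 mdc) (A, mdT (B, C), E) (A', mdT (B', C'), E'))
      • dtenc mdT (dtc mdα ((M, N, P) : @loose (D3 mdc) (A, B, C) (A', B', C'))) (cid Q)
    = dtc mdα ((M, N, dtenl mdT P Q) :
          @loose (D3 mdc) (A, B, mdT (C, E)) (A', B', mdT (C', E')))
      • dtc mdα ((dtenl mdT M N, P, Q) :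
          @loose (D3 mdc) (mdT (A, B), C, E) (mdT (A', B'), C', E'));
  md_triangle0 : forall A B : mdc,
    dten1 mdT (tid A) (mdλ B) ∘ₜ mdα ((A, mdI tt, B) : D3 mdc)
    = dten1 mdT (mdρ A) (tid B);
  md_triangle1 : forall (A B A' B' : mdc) (M : loose A A') (N : loose B B'),
    dtenc mdT (cid M) (dtc mdλ N)
      • dtc mdα ((M, @dfl dterm mdc mdI tt tt tt, N) :
          @loose (D3 mdc) (A, mdI tt, B) (A', mdI tt, B'))
    = dtenc mdT (dtc mdρ M) (cid N)
}.

Definition dbraid_type (D : monoidal_dbl) : Type :=
  dtrans (dten (mdT D) (d21 D) (d22 D)) (dten (mdT D) (d22 D) (d21 D)).
Definition dbraidv_type (D : monoidal_dbl) : Type :=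
  dtrans (dten (mdT D) (d22 D) (d21 D)) (dten (mdT D) (d21 D) (d22 D)).

Record braided_dbl := BraidedDbl {
  bdm :> monoidal_dbl;
  bdβ : dbraid_type bdm;
  bdβv : dbraidv_type bdm;
  bdβ_inv : dinverse bdβ bdβv;
  bd_hexagon0 : forall A B C : bdm,
    mdα bdm ((B, C, A) : D3 bdm)
      ∘ₜ bdβ ((A, mdT bdm (B, C)) : D2 bdm)
      ∘ₜ mdα bdm ((A, B, C) : D3 bdm)
    = dten1 (mdT bdm) (tid B) (bdβ ((A, C) : D2 bdm))
      ∘ₜ mdα bdm ((B, A, C) : D3 bdm)
      ∘ₜ dten1 (mdT bdm) (bdβ ((A, B) : D2 bdm)) (tid C);
  bd_hexagon1 : forall (A B C A' B' C' : bdm)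
      (M : loose A A') (N : loose B B') (P : loose C C'),
    dtc (mdα bdm) ((N, P, M) : @loose (D3 bdm) (B, C, A) (B', C', A'))
      • dtc bdβ ((M, dtenl (mdT bdm) N P) :
          @loose (D2 bdm) (A, mdT bdm (B, C)) (A', mdT bdm (B', C')))
      • dtc (mdα bdm) ((M, N, P) : @loose (D3 bdm) (A, B, C) (A', B', C'))
    = dtenc (mdT bdm) (cid N) (dtc bdβ ((M, P) : @loose (D2 bdm) (A, C) (A', C')))
      • dtc (mdα bdm) ((N, M, P) : @loose (D3 bdm) (B, A, C) (B', A', C'))
      • dtenc (mdT bdm) (dtc bdβ ((M, N) : @loose (D2 bdm) (A, B) (A', B'))) (cid P);
  bd_hexagonv0 : forall A B C : bdm,
    mdαv bdm ((C, A, B) : D3 bdm)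
      ∘ₜ bdβ ((mdT bdm (A, B), C) : D2 bdm)
      ∘ₜ mdαv bdm ((A, B, C) : D3 bdm)
    = dten1 (mdT bdm) (bdβ ((A, C) : D2 bdm)) (tid B)
      ∘ₜ mdαv bdm ((A, C, B) : D3 bdm)
      ∘ₜ dten1 (mdT bdm) (tid A) (bdβ ((B, C) : D2 bdm));
  bd_hexagonv1 : forall (A B C A' B' C' : bdm)
      (M : loose A A') (N : loose B B') (P : loose C C'),
    dtc (mdαv bdm) ((P, M, N) : @loose (D3 bdm) (C, A, B) (C', A', B'))
      • dtc bdβ ((dtenl (mdT bdm) M N, P) :
          @loose (D2 bdm) (mdT bdm (A, B), C) (mdT bdm (A', B'), C'))
      • dtc (mdαv bdm) ((M, N, P) : @loose (D3 bdm) (A, B, C) (A', B', C'))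
    = dtenc (mdT bdm) (dtc bdβ ((M, P) : @loose (D2 bdm) (A, C) (A', C'))) (cid N)
      • dtc (mdαv bdm) ((M, P, N) : @loose (D3 bdm) (A, C, B) (A', C', B'))
      • dtenc (mdT bdm) (cid M) (dtc bdβ ((N, P) : @loose (D2 bdm) (B, C) (B', C')))
}.

Definition is_symmetric_dbl (D : braided_dbl) : Prop :=
  (forall A B : D, bdβ D ((B, A) : D2 D) ∘ₜ bdβ D ((A, B) : D2 D) = tid (mdT D (A, B)))
  /\ (forall (A B A' B' : D) (M : loose A A') (N : loose B B'),
        dtc (bdβ D) ((N, M) : @loose (D2 D) (B, A) (B', A'))
          • dtc (bdβ D) ((M, N) : @loose (D2 D) (A, B) (A', B'))
        = cid (dtenl (mdT D) M N)).

(** The monoidal constraints are invertible transformations, and companions are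
    required in both directions: the companion of a tight isomorphism [f] is an
    equivalence in the loose bicategory only if [f^-1] has a companion as well. *)
Record constraint_companions (D : monoidal_dbl) := ConstraintCompanions {
  ccα : strong_companions (mdα D);
  ccαv : strong_companions (mdαv D);
  ccλ : strong_companions (mdλ D);
  ccλv : strong_companions (mdλv D);
  ccρ : strong_companions (mdρ D);
  ccρv : strong_companions (mdρv D)
}.

Record braid_companions (D : braided_dbl) := BraidCompanions {
  ccβ : strong_companions (bdβ D);
  ccβv : strong_companions (bdβv D)
}.

(** ** The inherited structure on the loose bicategory *)

Definition Lf (D E : dblcat) (F : dfun D E) : psfun (Lb D) (Lb E) :=
  @PsFun (Lb D) (Lb E) (df0 F)
    (fun A B M => dfl F M)
    (fun A B M N α => gfun F α)
    (fun A B C M N => dfO F M N)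
    (fun A B C M N => dfO' F M N)
    (fun A => dfU F A)
    (fun A => dfU' F A).

(** The isomorphism [L(D) × L(E) -> L(D × E)]. *)
Definition Lprod (D E : dblcat) : psfun (bprod (Lb D) (Lb E)) (Lb (dprod D E)) :=
  @PsFun (bprod (Lb D) (Lb E)) (Lb (dprod D E))
    (fun A => A)
    (fun A B M => M)
    (fun A B M N α => @gpair D E A B M N α.1 α.2)
    (fun A B C M N => @gid (dprod D E) A C (@odot (dprod D E) A B C N M))
    (fun A B C M N => @gid (dprod D E) A C (@odot (dprod D E) A B C N M))
    (fun A => @gid (dprod D E) A A (@U (dprod D E) A))
    (fun A => @gid (dprod D E) A A (@U (dprod D E) A)).

(** The isomorphism from the terminal bicategory to [L] of the terminal double
    category. *)
Definition Lone : psfun bterm (Lb dterm) :=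
  @PsFun bterm (Lb dterm) (fun _ => tt)
    (fun _ _ _ => tt)
    (fun _ _ _ _ _ => @gtt tt tt tt tt)
    (fun _ _ _ _ _ => @gtt tt tt tt tt)
    (fun _ _ _ _ _ => @gtt tt tt tt tt)
    (fun _ => @gtt tt tt tt tt)
    (fun _ => @gtt tt tt tt tt).

Definition LT (D : monoidal_dbl) : psfun (bprod (Lb D) (Lb D)) (Lb D) :=
  psf_comp (Lf (mdT D)) (Lprod D D).

Definition LU (D : monoidal_dbl) : psfun bterm (Lb D) := psf_comp (Lf (mdI D)) Lone.

(** Constraint equivalences: companions of the tight constraints.  The objects
    and 1-cells of [Lb D × Lb D × Lb D] are those of [Lb (D × D × D)], so that the
    components [chat] and [hat] can be used as they are. *)
Section Inherited.
Variables (D : monoidal_dbl) (c : constraint_companions D).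

Definition Lα : assoc_type (LT D) :=
  @PsNat (B3 (Lb D)) (Lb D) (ten (LT D) (ten (LT D) p31 p32) p33)
                            (ten (LT D) p31 (ten (LT D) p32 p33))
    (fun A => chat (ccα c A))
    (fun A B M => @hat (D3 D) D _ _ (mdα D) (ccα c) A B M)
    (fun A B M => @sc_inv (D3 D) D _ _ (mdα D) (ccα c) A B M).

Definition Lαv : assocv_type (LT D) :=
  @PsNat (B3 (Lb D)) (Lb D) (ten (LT D) p31 (ten (LT D) p32 p33))
                            (ten (LT D) (ten (LT D) p31 p32) p33)
    (fun A => chat (ccαv c A))
    (fun A B M => @hat (D3 D) D _ _ (mdαv D) (ccαv c) A B M)
    (fun A B M => @sc_inv (D3 D) D _ _ (mdαv D) (ccαv c) A B M).

Definition Lλ : lunit_type (LT D) (LU D) :=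
  @PsNat (Lb D) (Lb D) (ten (LT D) (unit_at (LU D) (Lb D)) (psf_id (Lb D))) (psf_id (Lb D))
    (fun A => chat (ccλ c A))
    (fun A B M => @hat D D _ _ (mdλ D) (ccλ c) A B M)
    (fun A B M => @sc_inv D D _ _ (mdλ D) (ccλ c) A B M).

Definition Lλv : lunitv_type (LT D) (LU D) :=
  @PsNat (Lb D) (Lb D) (psf_id (Lb D)) (ten (LT D) (unit_at (LU D) (Lb D)) (psf_id (Lb D)))
    (fun A => chat (ccλv c A))
    (fun A B M => @hat D D _ _ (mdλv D) (ccλv c) A B M)
    (fun A B M => @sc_inv D D _ _ (mdλv D) (ccλv c) A B M).

Definition Lρ : runit_type (LT D) (LU D) :=
  @PsNat (Lb D) (Lb D) (ten (LT D) (psf_id (Lb D)) (unit_at (LU D) (Lb D))) (psf_id (Lb D))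
    (fun A => chat (ccρ c A))
    (fun A B M => @hat D D _ _ (mdρ D) (ccρ c) A B M)
    (fun A B M => @sc_inv D D _ _ (mdρ D) (ccρ c) A B M).

Definition Lρv : runitv_type (LT D) (LU D) :=
  @PsNat (Lb D) (Lb D) (psf_id (Lb D)) (ten (LT D) (psf_id (Lb D)) (unit_at (LU D) (Lb D)))
    (fun A => chat (ccρv c A))
    (fun A B M => @hat D D _ _ (mdρv D) (ccρv c) A B M)
    (fun A B M => @sc_inv D D _ _ (mdρv D) (ccρv c) A B M).

Definition Lmon : mon_data (Lb D) := {|
  mT := LT D; mU := LU D;
  mα := Lα; mαv := Lαv;
  mλ := Lλ; mλv := Lλv;
  mρ := Lρ; mρv := Lρv
|}.

End Inherited.

Section InheritedBraiding.
Variables (D : braided_dbl) (c : braid_companions D).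

Definition Lβ : braid_type (LT D) :=
  @PsNat (B2 (Lb D)) (Lb D) (ten (LT D) p21 p22) (ten (LT D) p22 p21)
    (fun A => chat (ccβ c A))
    (fun A B M => @hat (D2 D) D _ _ (bdβ D) (ccβ c) A B M)
    (fun A B M => @sc_inv (D2 D) D _ _ (bdβ D) (ccβ c) A B M).

Definition Lβv : braidv_type (LT D) :=
  @PsNat (B2 (Lb D)) (Lb D) (ten (LT D) p22 p21) (ten (LT D) p21 p22)
    (fun A => chat (ccβv c A))
    (fun A B M => @hat (D2 D) D _ _ (bdβv D) (ccβv c) A B M)
    (fun A B M => @sc_inv (D2 D) D _ _ (bdβv D) (ccβv c) A B M).

End InheritedBraiding.

(* Main.v *)
(** Any two companions of the same tight 1-cell are related by exactly one globular
    2-cell compatible with the counits [ε], and these canonical 2-cells are closed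
    under all operations of the loose bicategory, under [⊗], and under the constraint
    2-cells of the companion transformations.  Companions and canonical 2-cells thus
    form a locally preordered bicategory, in which every pasting equation between
    coherence modifications holds.

    The modifications exist because the tight constraints satisfy the axioms of a
    (braided, symmetric) monoidal category on the nose: the two sides of an axiom are
    companions of equal tight 1-cells.  Naturality of a modification, or of a companion
    transformation, is an equation between squares [ε ⊙ φ] and is detected by
    composing with [ε], where it becomes an equation between the 2-cells of the tight
    transformations.  The unit axioms besides the triangle follow from Kelly's
    argument in the category of loose 1-cells and 2-cells. *)

From Corelib Require Import ssreflect ssrfun.
From Stdlib Require Import ProofIrrelevance.
Require Import Defs.

Set Implicit Arguments.
Unset Strict Implicit.
Unset Printing Implicit Defensive.

(** * Locally thin structures on a bicategory *)

Local Open Scope bicat_scope.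

(** No pasting diagram is ever manipulated by hand. Pasting ([whisk], [pmap2], the mates) is defined
    from the raw data of a bicategory, so each axiom can be stated a second time over [marked],
    where it holds because parallel 2-cells are equal. Projecting to underlying 2-cells then yields,
    by computation alone, the axiom over the loose bicategory. The work lies in showing that the
    generating cells are canonical. Uniqueness of canonical cells rests on one fact: a 2-cell into a
    companion is determined by its tight source and its composite with ε ([ce_inj]; [counit_inj] is
    the version whiskered with a loose 1-cell). The same fact makes a loose naturality cell
    determined by the tight 2-cell that it lies over ([square_uniq]). Loose strength enters through
    the inverses of the naturality cells: it gives pseudonaturality, and these inverses are
    canonical because the inverse of a canonical cell is. *)

(* A class of 1-cells carrying extra structure [mk], closed under the bicategory
   operations, together with 2-cells [can] of which there is at most one between any
   two structured 1-cells.  The structured 1-cells and these 2-cells form a locally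
   preordered bicategory ([marked] below), in which every equation of 2-cells holds. *)
Record thin_sub (K : bicat) := ThinSub {
  mk : forall X Y : K, hom X Y -> Type;
  can : forall (X Y : K) (f g : hom X Y), mk f -> mk g -> f ⇒ g -> Prop;
  can_uniq : forall (X Y : K) (f g : hom X Y) (c : mk f) (d : mk g) (α β : f ⇒ g),
    can c d α -> can c d β -> α = β;
  can_inv : forall (X Y : K) (f g : hom X Y) (c : mk f) (d : mk g)
      (α : f ⇒ g) (β : g ⇒ f), inverse2 α β -> can c d α -> can d c β;
  mk_id : forall X : K, mk (id1 X);
  mk_comp : forall (X Y Z : K) (g : hom Y Z) (f : hom X Y), mk g -> mk f -> mk (g ∘ f);
  can_id : forall (X Y : K) (f : hom X Y) (c : mk f), can c c (id2 f);
  can_vcomp : forall (X Y : K) (f g h : hom X Y) (c : mk f) (d : mk g) (e : mk h)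
      (β : g ⇒ h) (α : f ⇒ g), can d e β -> can c d α -> can c e (β • α);
  can_hcomp : forall (X Y Z : K) (f f' : hom X Y) (g g' : hom Y Z)
      (c : mk f) (c' : mk f') (d : mk g) (d' : mk g') (β : g ⇒ g') (α : f ⇒ f'),
    can d d' β -> can c c' α -> can (mk_comp d c) (mk_comp d' c') (β ∗ α);
  can_assoc : forall (X Y Z W : K) (f : hom X Y) (g : hom Y Z) (h : hom Z W)
      (c : mk f) (d : mk g) (e : mk h),
    can (mk_comp (mk_comp e d) c) (mk_comp e (mk_comp d c)) (assoc f g h);
  can_lunit : forall (X Y : K) (f : hom X Y) (c : mk f),
    can (mk_comp (mk_id Y) c) c (lunit f);
  can_runit : forall (X Y : K) (f : hom X Y) (c : mk f),
    can (mk_comp c (mk_id X)) c (runit f)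
}.
Arguments mk {K} t {X Y} f.
Arguments can {K} t {X Y f g} c d α.
Arguments mk_id {K} t X.

Section Marked.
Variables (K : bicat) (HK : is_bicat K) (S : thin_sub K).

Definition mhom (X Y : K) : Type := {f : hom X Y & mk S f}.
Definition mtwo (X Y : K) (f g : mhom X Y) : Type :=
  {α : projT1 f ⇒ projT1 g | can S (projT2 f) (projT2 g) α}.

(** The primed constraint cells are canonical as inverses of canonical cells, which is where [HK]
    enters. *)
Definition marked : bicat := {|
  ob := ob K;
  hom := mhom;
  two := mtwo;
  id1 X := existT _ (id1 X) (mk_id S X);
  comp1 X Y Z g f := existT _ (projT1 g ∘ projT1 f) (mk_comp (projT2 g) (projT2 f));
  id2 X Y f := exist _ (id2 (projT1 f)) (can_id (projT2 f));
  vcomp X Y f g h β α :=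
    exist _ (proj1_sig β • proj1_sig α) (can_vcomp (proj2_sig β) (proj2_sig α));
  hcomp X Y Z f f' g g' β α :=
    exist _ (proj1_sig β ∗ proj1_sig α) (can_hcomp (proj2_sig β) (proj2_sig α));
  assoc X Y Z W f g h := exist _ (assoc (projT1 f) (projT1 g) (projT1 h))
    (can_assoc (projT2 f) (projT2 g) (projT2 h));
  assoc' X Y Z W f g h := exist _ (assoc' (projT1 f) (projT1 g) (projT1 h))
    (can_inv (assoc_inv HK _ _ _) (can_assoc (projT2 f) (projT2 g) (projT2 h)));
  lunit X Y f := exist _ (lunit (projT1 f)) (can_lunit (projT2 f));
  lunit' X Y f := exist _ (lunit' (projT1 f))
    (can_inv (lunit_inv HK _) (can_lunit (projT2 f)));
  runit X Y f := exist _ (runit (projT1 f)) (can_runit (projT2 f));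
  runit' X Y f := exist _ (runit' (projT1 f))
    (can_inv (runit_inv HK _) (can_runit (projT2 f)))
|}.

(** The underlying 2-cells agree by [can_uniq]; the certificates then agree by proof irrelevance,
    [can] being a proposition. *)
Lemma marked_thin (X Y : marked) (f g : hom X Y) (α β : f ⇒ g) : α = β.
Proof.
case: α β => [α cα] [β cβ].
move: (cα) (cβ); rewrite (can_uniq cα cβ) => p q.
by rewrite (proof_irrelevance _ p q).
Qed.

Section Triangles.
Variables (X Y : K) (f : hom X Y) (g : hom Y X) (c : mk S f) (d : mk S g).
Variables (η : pcell ⟪⟫ ⟪f ; g⟫) (ε : pcell ⟪g ; f⟫ ⟪⟫).
Hypothesis cη : can S (mk_id S X) (mk_comp d c) η.
Hypothesis cε : can S (mk_comp c d) (mk_id S Y) ε.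

Let mf : @hom marked X Y := existT _ f c.
Let mg : @hom marked Y X := existT _ g d.
Let mη : @pcell marked X X ⟪⟫ ⟪mf ; mg⟫ := exist _ η cη.
Let mε : @pcell marked Y Y ⟪mg ; mf⟫ ⟪⟫ := exist _ ε cε.

Lemma triangle_thin : (⟪⟫ ▷ η ◁ ⟪f⟫) ;; (⟪f⟫ ▷ ε ◁ ⟪⟫) = pid ⟪f⟫.
Proof.
have H : (⟪⟫ ▷ mη ◁ ⟪mf⟫) ;; (⟪mf⟫ ▷ mε ◁ ⟪⟫) = pid ⟪mf⟫ := marked_thin _ _.
exact (f_equal (@proj1_sig _ _) H).
Qed.

Lemma trianglev_thin : (⟪g⟫ ▷ η ◁ ⟪⟫) ;; (⟪⟫ ▷ ε ◁ ⟪g⟫) = pid ⟪g⟫.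
Proof.
have H : (⟪mg⟫ ▷ mη ◁ ⟪⟫) ;; (⟪⟫ ▷ mε ◁ ⟪mg⟫) = pid ⟪mg⟫ := marked_thin _ _.
exact (f_equal (@proj1_sig _ _) H).
Qed.
End Triangles.

(** * Lifting the tensor product and the constraints to the marked bicategory *)

Section MarkedTensor.
Variable T : psfun (bprod K K) K.

(** Here [T] is raw data, with nothing relating its primed cells to the unprimed ones, so canonicity
    is asked of both. *)
Record lift_tensor := LiftTensor {
  lT1 : forall (A A' C C' : K) (f : hom A A') (g : hom C C'),
    mk S f -> mk S g -> mk S (tmap T f g);
  lT2 : forall (A A' C C' : K) (f f' : hom A A') (g g' : hom C C')
      (c : mk S f) (c' : mk S f') (d : mk S g) (d' : mk S g')
      (α : f ⇒ f') (β : g ⇒ g'), can S c c' α -> can S d d' β ->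
    can S (lT1 c d) (lT1 c' d') (tmap2 T α β);
  lTC : forall (A A' A'' C C' C'' : K) (f : hom A A') (f' : hom A' A'')
      (g : hom C C') (g' : hom C' C'')
      (c : mk S f) (c' : mk S f') (d : mk S g) (d' : mk S g'),
    can S (mk_comp (lT1 c' d') (lT1 c d)) (lT1 (mk_comp c' c) (mk_comp d' d))
      (tcomp T f f' g g');
  lTC' : forall (A A' A'' C C' C'' : K) (f : hom A A') (f' : hom A' A'')
      (g : hom C C') (g' : hom C' C'')
      (c : mk S f) (c' : mk S f') (d : mk S g) (d' : mk S g'),
    can S (lT1 (mk_comp c' c) (mk_comp d' d)) (mk_comp (lT1 c' d') (lT1 c d))
      (tcomp' T f f' g g');
  lTU : forall A C : K, can S (mk_id S (tob T A C)) (lT1 (mk_id S A) (mk_id S C))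
      (tunit T A C);
  lTU' : forall A C : K, can S (lT1 (mk_id S A) (mk_id S C)) (mk_id S (tob T A C))
      (tunit' T A C)
}.

Variable LT : lift_tensor.

Definition marked_tensor : psfun (bprod marked marked) marked :=
  @PsFun (bprod marked marked) marked (fun X => tob T X.1 X.2)
    (fun X Y f => existT _ (tmap T (projT1 f.1) (projT1 f.2))
       (lT1 LT (projT2 f.1) (projT2 f.2)))
    (fun X Y f g α => exist _ (tmap2 T (proj1_sig α.1) (proj1_sig α.2))
       (lT2 LT (proj2_sig α.1) (proj2_sig α.2)))
    (fun X Y Z f g => exist _
       (tcomp T (projT1 f.1) (projT1 g.1) (projT1 f.2) (projT1 g.2))
       (lTC LT (projT2 f.1) (projT2 g.1) (projT2 f.2) (projT2 g.2)))
    (fun X Y Z f g => exist _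
       (tcomp' T (projT1 f.1) (projT1 g.1) (projT1 f.2) (projT1 g.2))
       (lTC' LT (projT2 f.1) (projT2 g.1) (projT2 f.2) (projT2 g.2)))
    (fun X => exist _ (tunit T X.1 X.2) (lTU LT X.1 X.2))
    (fun X => exist _ (tunit' T X.1 X.2) (lTU' LT X.1 X.2)).

Record lift_assoc (a : assoc_type T) := LiftAssoc {
  la1 : forall A B C : K, mk S (a1 a A B C);
  la2 : forall (A A' B B' C C' : K) (f : hom A A') (g : hom B B') (h : hom C C')
      (c : mk S f) (d : mk S g) (e : mk S h),
    can S (mk_comp (la1 A' B' C') (lT1 LT (lT1 LT c d) e))
          (mk_comp (lT1 LT c (lT1 LT d e)) (la1 A B C)) (a2 a f g h);
  la2' : forall (A A' B B' C C' : K) (f : hom A A') (g : hom B B') (h : hom C C')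
      (c : mk S f) (d : mk S g) (e : mk S h),
    can S (mk_comp (lT1 LT c (lT1 LT d e)) (la1 A B C))
          (mk_comp (la1 A' B' C') (lT1 LT (lT1 LT c d) e)) (a2' a f g h)
}.

Definition marked_assoc (a : assoc_type T) (La : lift_assoc a) :
    assoc_type marked_tensor :=
  @PsNat (B3 marked) marked
    (ten marked_tensor (ten marked_tensor p31 p32) p33)
    (ten marked_tensor p31 (ten marked_tensor p32 p33))
    (fun X : B3 marked => existT _ (a1 a X.1.1 X.1.2 X.2) (la1 La X.1.1 X.1.2 X.2))
    (fun X Y (f : @hom (B3 marked) X Y) =>
       exist _ (a2 a (projT1 f.1.1) (projT1 f.1.2) (projT1 f.2))
       (la2 La (projT2 f.1.1) (projT2 f.1.2) (projT2 f.2)))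
    (fun X Y (f : @hom (B3 marked) X Y) =>
       exist _ (a2' a (projT1 f.1.1) (projT1 f.1.2) (projT1 f.2))
       (la2' La (projT2 f.1.1) (projT2 f.1.2) (projT2 f.2))).

Record lift_assocv (av : assocv_type T) := LiftAssocv {
  lav1 : forall A B C : K, mk S (av1 av A B C);
  lav2 : forall (A A' B B' C C' : K) (f : hom A A') (g : hom B B') (h : hom C C')
      (c : mk S f) (d : mk S g) (e : mk S h),
    can S (mk_comp (lav1 A' B' C') (lT1 LT c (lT1 LT d e)))
          (mk_comp (lT1 LT (lT1 LT c d) e) (lav1 A B C)) (av2 av f g h);
  lav2' : forall (A A' B B' C C' : K) (f : hom A A') (g : hom B B') (h : hom C C')
      (c : mk S f) (d : mk S g) (e : mk S h),
    can S (mk_comp (lT1 LT (lT1 LT c d) e) (lav1 A B C))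
          (mk_comp (lav1 A' B' C') (lT1 LT c (lT1 LT d e))) (av2' av f g h)
}.

Definition marked_assocv (av : assocv_type T) (La : lift_assocv av) :
    assocv_type marked_tensor :=
  @PsNat (B3 marked) marked
    (ten marked_tensor p31 (ten marked_tensor p32 p33))
    (ten marked_tensor (ten marked_tensor p31 p32) p33)
    (fun X : B3 marked => existT _ (av1 av X.1.1 X.1.2 X.2) (lav1 La X.1.1 X.1.2 X.2))
    (fun X Y (f : @hom (B3 marked) X Y) =>
       exist _ (av2 av (projT1 f.1.1) (projT1 f.1.2) (projT1 f.2))
       (lav2 La (projT2 f.1.1) (projT2 f.1.2) (projT2 f.2)))
    (fun X Y (f : @hom (B3 marked) X Y) =>
       exist _ (av2' av (projT1 f.1.1) (projT1 f.1.2) (projT1 f.2))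
       (lav2' La (projT2 f.1.1) (projT2 f.1.2) (projT2 f.2))).

Record lift_braid (b : braid_type T) := LiftBraid {
  lb1 : forall A B : K, mk S (b1 b A B);
  lb2 : forall (A A' B B' : K) (f : hom A A') (g : hom B B') (c : mk S f) (d : mk S g),
    can S (mk_comp (lb1 A' B') (lT1 LT c d)) (mk_comp (lT1 LT d c) (lb1 A B)) (b2 b f g);
  lb2' : forall (A A' B B' : K) (f : hom A A') (g : hom B B') (c : mk S f) (d : mk S g),
    can S (mk_comp (lT1 LT d c) (lb1 A B)) (mk_comp (lb1 A' B') (lT1 LT c d)) (b2' b f g)
}.

Definition marked_braid (b : braid_type T) (Lb : lift_braid b) :
    braid_type marked_tensor :=
  @PsNat (B2 marked) marked (ten marked_tensor p21 p22) (ten marked_tensor p22 p21)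
    (fun X : B2 marked => existT _ (b1 b X.1 X.2) (lb1 Lb X.1 X.2))
    (fun X Y (f : @hom (B2 marked) X Y) =>
       exist _ (b2 b (projT1 f.1) (projT1 f.2)) (lb2 Lb (projT2 f.1) (projT2 f.2)))
    (fun X Y (f : @hom (B2 marked) X Y) =>
       exist _ (b2' b (projT1 f.1) (projT1 f.2)) (lb2' Lb (projT2 f.1) (projT2 f.2))).

Lemma marked_psnat (B : bicat) (F G : psfun B marked) (θ : psnat F G) : is_psnat θ.
Proof. by split => *; try split; apply: marked_thin. Qed.

Definition marked_imod (B : bicat) (F G : psfun B marked) (θ θ' : psnat F G)
    (m : forall X, θ X ⇒ θ' X) (m' : forall X, θ' X ⇒ θ X) : imod θ θ' :=
  IMod (fun X => conj (marked_thin (m' X • m X) _) (marked_thin (m X • m' X) _))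
    (fun X Y f => marked_thin _ _).

Section MarkedTransformations.
Variable B : bicat.

(** These combinators run parallel to [over_id], [over_comp] and [over_tensor]. Canonicity of a
    modification is phrased with them in [pent_can] and its analogues, because the marks then reduce
    to those for which [imod_over_canonical] proves it. *)
Definition mk_pn (F G : psfun B K) (θ : psnat F G) : Type := forall X : B, mk S (θ X).

Definition mk_pn_id (F : psfun B K) : mk_pn (pn_id F) := fun X => mk_id S (F X).

Definition mk_pn_comp (F G H : psfun B K) (θ' : psnat G H) (θ : psnat F G)
    (m' : mk_pn θ') (m : mk_pn θ) : mk_pn (pn_comp θ' θ) :=
  fun X => mk_comp (m' X) (m X).

Definition mk_ten_pn (F F' G G' : psfun B K) (θ : psnat F F') (κ : psnat G G')
    (m : mk_pn θ) (n : mk_pn κ) : mk_pn (ten_pn T θ κ) :=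
  fun X => lT1 LT (m X) (n X).

Definition mk_assoc_at (a : assoc_type T) (La : lift_assoc a) (F G H : psfun B K) :
    mk_pn (assoc_at F G H a) :=
  fun X => la1 La (F X) (G X) (H X).

Definition mk_braid_at (b : braid_type T) (Lb : lift_braid b) (F G : psfun B K) :
    mk_pn (braid_at F G b) :=
  fun X => lb1 Lb (F X) (G X).

End MarkedTransformations.

Section Assoc.
Variables (a : assoc_type T) (La : lift_assoc a).

Local Notation Ma := (marked_assoc La).

Definition pentagonator_can (π : pentagonator_cell a) : Prop :=
  forall A B C D : K,
  can S (mk_comp (mk_comp (lT1 LT (mk_id S A) (la1 La B C D)) (la1 La A (tob T B C) D))
          (lT1 LT (la1 La A B C) (mk_id S D)))
        (mk_comp (la1 La A B (tob T C D)) (la1 La (tob T A B) C D)) (π A B C D).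
Definition pentagonator_can' (π : pentagonator_cell' a) : Prop :=
  forall A B C D : K,
  can S (mk_comp (la1 La A B (tob T C D)) (la1 La (tob T A B) C D))
        (mk_comp (mk_comp (lT1 LT (mk_id S A) (la1 La B C D)) (la1 La A (tob T B C) D))
          (lT1 LT (la1 La A B C) (mk_id S D))) (π A B C D).

Lemma pent_can' (π : pentagonator_type a) :
  pentagonator_can (pent π) -> pentagonator_can' (pent' π).
Proof. move=> cπ A B C D; exact: (can_inv (md_inv π (A, B, C, D)) (cπ A B C D)). Qed.

Lemma pent_can (π : pentagonator_type a) :
  (forall X : B4 K, can S
    (mk_pn_comp (mk_pn_comp
        (mk_ten_pn (mk_pn_id p41) (mk_assoc_at La p42 p43 p44))
        (mk_assoc_at La p41 (ten T p42 p43) p44))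
      (mk_ten_pn (mk_assoc_at La p41 p42 p43) (mk_pn_id p44)) X)
    (mk_pn_comp (mk_assoc_at La p41 p42 (ten T p43 p44))
      (mk_assoc_at La (ten T p41 p42) p43 p44) X) (π X)) ->
  pentagonator_can (pent π).
Proof. move=> H A B C D; exact (H (A, B, C, D)). Qed.

(** Transparent, as are the other marked modifications: pastings over it must compute to the
    original cells after projection. *)
Definition marked_pentagonator (π : pentagonator_type a) (cπ : pentagonator_can (pent π)) :
    pentagonator_type Ma.
Proof.
refine (@marked_imod _ _ _ _ _ _ _) => X.
  exact: (exist _ _ (cπ X.1.1.1 X.1.1.2 X.1.2 X.2)).
exact: (exist _ _ (pent_can' cπ X.1.1.1 X.1.1.2 X.1.2 X.2)).
Defined.

Lemma assoc_axiom_thin (π : pentagonator_cell a) (cπ : pentagonator_can π) :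
  assoc_axiom π.
Proof.
pose mπ : pentagonator_cell Ma := fun A B C D => exist _ (π A B C D) (cπ A B C D).
have H : assoc_axiom mπ by move=> *; apply: marked_thin.
move=> A B C D E.
exact (f_equal (@proj1_sig _ _) (H A B C D E)).
Qed.

Section Units.
Variable U : psfun bterm K.

Record lift_unit := LiftUnit {
  lU1 : forall (X Y : bterm) (f : hom X Y), mk S (psf1 U f);
  lU2 : forall (X Y : bterm) (f g : hom X Y) (α : f ⇒ g), can S (lU1 f) (lU1 g) (psf2 U α);
  lUC : forall (X Y Z : bterm) (f : hom X Y) (g : hom Y Z),
    can S (mk_comp (lU1 g) (lU1 f)) (lU1 (g ∘ f)) (psfC U f g);
  lUC' : forall (X Y Z : bterm) (f : hom X Y) (g : hom Y Z),
    can S (lU1 (g ∘ f)) (mk_comp (lU1 g) (lU1 f)) (psfC' U f g);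
  lUU : forall X : bterm, can S (mk_id S (U X)) (lU1 (id1 X)) (psfU U X);
  lUU' : forall X : bterm, can S (lU1 (id1 X)) (mk_id S (U X)) (psfU' U X)
}.

Variable LU : lift_unit.

Definition marked_unit : psfun bterm marked :=
  @PsFun bterm marked (fun X => U X)
    (fun X Y f => existT _ (psf1 U f) (lU1 LU f))
    (fun X Y f g α => exist _ (psf2 U α) (lU2 LU α))
    (fun X Y Z f g => exist _ (psfC U f g) (lUC LU f g))
    (fun X Y Z f g => exist _ (psfC' U f g) (lUC' LU f g))
    (fun X => exist _ (psfU U X) (lUU LU X))
    (fun X => exist _ (psfU' U X) (lUU' LU X)).

Local Notation u := (@psf1 _ _ U tt tt tt).
Local Notation mu := (@lU1 LU tt tt tt).

Record lift_lunit (l : lunit_type T U) := LiftLunit {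
  ll1 : forall A : K, mk S (l1 l A);
  ll2 : forall (A B : K) (f : hom A B) (c : mk S f),
    can S (mk_comp (ll1 B) (lT1 LT mu c)) (mk_comp c (ll1 A)) (pn2 l f);
  ll2' : forall (A B : K) (f : hom A B) (c : mk S f),
    can S (mk_comp c (ll1 A)) (mk_comp (ll1 B) (lT1 LT mu c)) (pn2' l f)
}.

Record lift_runit (r : runit_type T U) := LiftRunit {
  lr1 : forall A : K, mk S (r1 r A);
  lr2 : forall (A B : K) (f : hom A B) (c : mk S f),
    can S (mk_comp (lr1 B) (lT1 LT c mu)) (mk_comp c (lr1 A)) (pn2 r f);
  lr2' : forall (A B : K) (f : hom A B) (c : mk S f),
    can S (mk_comp c (lr1 A)) (mk_comp (lr1 B) (lT1 LT c mu)) (pn2' r f)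
}.

Definition marked_lunit (l : lunit_type T U) (Ll : lift_lunit l) :
    lunit_type marked_tensor marked_unit :=
  @PsNat marked marked (ten marked_tensor (unit_at marked_unit marked) (psf_id marked))
    (psf_id marked)
    (fun X => existT _ (l1 l X) (ll1 Ll X))
    (fun X Y f => exist _ (pn2 l (projT1 f)) (ll2 Ll (projT2 f)))
    (fun X Y f => exist _ (pn2' l (projT1 f)) (ll2' Ll (projT2 f))).

Definition marked_runit (r : runit_type T U) (Lr : lift_runit r) :
    runit_type marked_tensor marked_unit :=
  @PsNat marked marked (ten marked_tensor (psf_id marked) (unit_at marked_unit marked))
    (psf_id marked)
    (fun X => existT _ (r1 r X) (lr1 Lr X))
    (fun X Y f => exist _ (pn2 r (projT1 f)) (lr2 Lr (projT2 f)))
    (fun X Y f => exist _ (pn2' r (projT1 f)) (lr2' Lr (projT2 f))).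

Variables (l : lunit_type T U) (Ll : lift_lunit l) (r : runit_type T U) (Lr : lift_runit r).
Local Notation Ml := (marked_lunit Ll).
Local Notation Mr := (marked_runit Lr).
Local Notation I := (marked_unit tt).

Definition munit_can (μ : munit_type a l r) : Prop := forall A B : K,
  can S (mk_comp (lT1 LT (mk_id S A) (ll1 Ll B)) (la1 La A (U tt) B))
        (lT1 LT (lr1 Lr A) (mk_id S B)) (mcell μ A B).
Definition lunitor_can (λ : lunitor_type a l) : Prop := forall A B : K,
  can S (mk_comp (ll1 Ll (tob T A B)) (la1 La (U tt) A B))
        (lT1 LT (ll1 Ll A) (mk_id S B)) (lcell λ A B).
Definition runitor_can (ρ : runitor_type a r) : Prop := forall A B : K,
  can S (mk_comp (lT1 LT (mk_id S A) (lr1 Lr B)) (la1 La A B (U tt)))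
        (lr1 Lr (tob T A B)) (rcell ρ A B).

Definition mk_lunit_at (B : bicat) (F : psfun B K) : mk_pn (lunit_at F l) :=
  fun X => ll1 Ll (F X).
Definition mk_runit_at (B : bicat) (F : psfun B K) : mk_pn (runit_at F r) :=
  fun X => lr1 Lr (F X).

Lemma mcell_can (μ : munit_type a l r) :
  (forall X : B2 K, can S
    (mk_pn_comp (mk_ten_pn (mk_pn_id p21) (mk_lunit_at p22))
      (mk_assoc_at La p21 (unit_at U (B2 K)) p22) X)
    (mk_ten_pn (mk_runit_at p21) (mk_pn_id p22) X) (μ X)) -> munit_can μ.
Proof. move=> H A B; exact (H (A, B)). Qed.

Lemma lcell_can (λ : lunitor_type a l) :
  (forall X : B2 K, can S
    (mk_pn_comp (mk_lunit_at (ten T p21 p22))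
      (mk_assoc_at La (unit_at U (B2 K)) p21 p22) X)
    (mk_ten_pn (mk_lunit_at p21) (mk_pn_id p22) X) (λ X)) -> lunitor_can λ.
Proof. move=> H A B; exact (H (A, B)). Qed.

Lemma rcell_can (ρ : runitor_type a r) :
  (forall X : B2 K, can S
    (mk_pn_comp (mk_ten_pn (mk_pn_id p21) (mk_runit_at p22))
      (mk_assoc_at La p21 p22 (unit_at U (B2 K))) X)
    (mk_runit_at (ten T p21 p22) X) (ρ X)) -> runitor_can ρ.
Proof. move=> H A B; exact (H (A, B)). Qed.

Definition marked_munit (μ : munit_type a l r) (cμ : munit_can μ) : munit_type Ma Ml Mr.
Proof.
refine (@marked_imod _ _ _ _ _ _ _) => X.
  exact: (exist _ _ (cμ X.1 X.2)).
exact: (exist _ _ (can_inv (md_inv μ (X.1, X.2)) (cμ X.1 X.2))).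
Defined.

Definition marked_lunitor (λ : lunitor_type a l) (cλ : lunitor_can λ) : lunitor_type Ma Ml.
Proof.
refine (@marked_imod _ _ _ _ _ _ _) => X.
  exact: (exist _ _ (cλ X.1 X.2)).
exact: (exist _ _ (can_inv (md_inv λ (X.1, X.2)) (cλ X.1 X.2))).
Defined.

Definition marked_runitor (ρ : runitor_type a r) (cρ : runitor_can ρ) : runitor_type Ma Mr.
Proof.
refine (@marked_imod _ _ _ _ _ _ _) => X.
  exact: (exist _ _ (cρ X.1 X.2)).
exact: (exist _ _ (can_inv (md_inv ρ (X.1, X.2)) (cρ X.1 X.2))).
Defined.

Variables (π : pentagonator_type a) (cπ : pentagonator_can (pent π)).
Variables (μ : munit_type a l r) (cμ : munit_can μ).

Lemma left_unit_axiom_thin (λ : lunitor_type a l) (cλ : lunitor_can λ) :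
  left_unit_axiom π μ λ.
Proof.
have H : left_unit_axiom (marked_pentagonator cπ) (marked_munit cμ) (marked_lunitor cλ).
  by move=> *; apply: marked_thin.
move=> A B C.
exact (f_equal (@proj1_sig _ _) (H A B C)).
Qed.

Lemma right_unit_axiom_thin (ρ : runitor_type a r) (cρ : runitor_can ρ) :
  right_unit_axiom π μ ρ.
Proof.
have H : right_unit_axiom (marked_pentagonator cπ) (marked_munit cμ) (marked_runitor cρ).
  by move=> *; apply: marked_thin.
move=> A B C.
exact (f_equal (@proj1_sig _ _) (H A B C)).
Qed.

End Units.

Section Braid13.
Variables (b : braid_type T) (Lb : lift_braid b).
Local Notation Mb := (marked_braid Lb).

Definition hexagonator_can (R : hexagonator_cell b a) : Prop :=
  forall A B C : K,
  can S (mk_comp (mk_comp (la1 La B C A) (lb1 Lb A (tob T B C))) (la1 La A B C))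
        (mk_comp (mk_comp (lT1 LT (mk_id S B) (lb1 Lb A C)) (la1 La B A C))
          (lT1 LT (lb1 Lb A B) (mk_id S C))) (R A B C).
Definition hexagonator_can' (R : hexagonator_cell' b a) : Prop :=
  forall A B C : K,
  can S (mk_comp (mk_comp (lT1 LT (mk_id S B) (lb1 Lb A C)) (la1 La B A C))
          (lT1 LT (lb1 Lb A B) (mk_id S C)))
        (mk_comp (mk_comp (la1 La B C A) (lb1 Lb A (tob T B C))) (la1 La A B C)) (R A B C).

Lemma hexa_can' (R : hexagonator_type a b) :
  hexagonator_can (hexa R) -> hexagonator_can' (hexa' R).
Proof. move=> cR A B C; exact: (can_inv (md_inv R (A, B, C)) (cR A B C)). Qed.

Lemma hexa_can (R : hexagonator_type a b) :
  (forall X : B3 K, can S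
    (mk_pn_comp (mk_pn_comp (mk_assoc_at La p32 p33 p31)
        (mk_braid_at Lb p31 (ten T p32 p33)))
      (mk_assoc_at La p31 p32 p33) X)
    (mk_pn_comp (mk_pn_comp (mk_ten_pn (mk_pn_id p32) (mk_braid_at Lb p31 p33))
        (mk_assoc_at La p32 p31 p33))
      (mk_ten_pn (mk_braid_at Lb p31 p32) (mk_pn_id p33)) X) (R X)) ->
  hexagonator_can (hexa R).
Proof. move=> H A B C; exact (H (A, B, C)). Qed.

Definition marked_hexagonator (R : hexagonator_type a b) (cR : hexagonator_can (hexa R)) :
  hexagonator_type Ma Mb.
Proof.
refine (@marked_imod _ _ _ _ _ _ _) => X.
  exact: (exist _ _ (cR X.1.1 X.1.2 X.2)).
exact: (exist _ _ (hexa_can' cR X.1.1 X.1.2 X.2)).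
Defined.

(** Phrased for bare families of cells, since the pentagonator [pent_rev] of the reversed structure
    is given only as a family of pasted mates; one lemma thus serves the axiom and its mirror
    image. *)
Lemma braid_axiom_13_thin (π : pentagonator_cell a) (π' : pentagonator_cell' a)
    (R' : hexagonator_cell' b a) :
  pentagonator_can π -> pentagonator_can' π' -> hexagonator_can' R' ->
  braid_axiom_13 π π' R'.
Proof.
move=> cπ cπ' cR'.
pose mπ : pentagonator_cell Ma := fun A B C D => exist _ (π A B C D) (cπ A B C D).
pose mπ' : pentagonator_cell' Ma := fun A B C D => exist _ (π' A B C D) (cπ' A B C D).
pose mR' : hexagonator_cell' Mb Ma := fun A B C => exist _ (R' A B C) (cR' A B C).
have H : braid_axiom_13 mπ mπ' mR' by move=> *; apply: marked_thin.
move=> A B C D.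
exact (f_equal (@proj1_sig _ _) (H A B C D)).
Qed.

End Braid13.

Section AdjEquivCan.
Variables (av : assocv_type T) (Lav : lift_assocv av) (e : adjequiv a av).
Local Notation Mav := (marked_assocv Lav).

Record adjequiv_can : Prop := AdjequivCan {
  eta_can : forall A B C : K,
    can S (mk_id S _) (mk_comp (lav1 Lav A B C) (la1 La A B C)) (eta e A B C);
  eps_can : forall A B C : K,
    can S (mk_comp (la1 La A B C) (lav1 Lav A B C)) (mk_id S _) (eps e A B C)
}.

Variable ce : adjequiv_can.

Definition marked_adjequiv : adjequiv Ma Mav.
Proof.
unshelve refine (@AdjEquiv _ _ _ _ Ma Mav (marked_psnat _) (marked_psnat _) _ _ _ _).
- refine (@marked_imod _ _ _ _ _ _ _) => X.
    exact: (exist _ _ (eta_can ce X.1.1 X.1.2 X.2)).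
  exact: (exist _ _ (can_inv (md_inv (ae_unit e) (X.1.1, X.1.2, X.2)) (eta_can ce _ _ _))).
- refine (@marked_imod _ _ _ _ _ _ _) => X.
    exact: (exist _ _ (eps_can ce X.1.1 X.1.2 X.2)).
  exact: (exist _ _ (can_inv (md_inv (ae_counit e) (X.1.1, X.1.2, X.2)) (eps_can ce _ _ _))).
- by move=> X; apply: marked_thin.
- by move=> X; apply: marked_thin.
Defined.

End AdjEquivCan.

End Assoc.
End MarkedTensor.

(** * The reversed tensor product, and the axioms for braidings and syllepses *)

Section Reverse.
Variables (T : psfun (bprod K K) K) (LT : lift_tensor T).

(** As [trev T] is a composite pseudofunctor, its constraint cells contain an image under [T] of
    identity cells of the projections; the factors built from [lT2] and [can_id] account for it. *)
Definition lift_trev : lift_tensor (trev T).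
Proof.
refine (@LiftTensor (trev T) (fun A A' C C' f g c d => lT1 LT d c) _ _ _ _ _).
- move=> A A' C C' f f' g g' c c' d d' α β cα cβ; exact: (lT2 LT cβ cα).
- move=> *; exact: (can_vcomp (lT2 LT (can_id _) (can_id _)) (lTC LT _ _ _ _)).
- move=> *; exact: (can_vcomp (lTC' LT _ _ _ _) (lT2 LT (can_id _) (can_id _))).
- move=> *; exact: (can_vcomp (lT2 LT (can_id _) (can_id _)) (lTU LT _ _)).
- move=> *; exact: (can_vcomp (lTU' LT _ _) (lT2 LT (can_id _) (can_id _))).
Defined.

Definition lift_assoc_rev (av : assocv_type T) (Lav : lift_assocv LT av) :
  lift_assoc lift_trev (assoc_rev av).
Proof.
refine (@LiftAssoc _ lift_trev (assoc_rev av) (fun A B C => lav1 Lav C B A) _ _) => *.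
  exact: (lav2 Lav).
exact: (lav2' Lav).
Defined.

Definition lift_braid_rev (b : braid_type T) (Lb : lift_braid LT b) :
  lift_braid lift_trev (braid_rev b).
Proof.
refine (@LiftBraid _ lift_trev (braid_rev b) (fun A B => lb1 Lb B A) _ _) => *.
  exact: (lb2 Lb).
exact: (lb2' Lb).
Defined.

Variables (a : assoc_type T) (La : lift_assoc LT a).
Variables (av : assocv_type T) (Lav : lift_assocv LT av) (e : adjequiv a av).
Variable ce : adjequiv_can La Lav e.
Local Notation Ma := (marked_assoc La).
Local Notation Mav := (marked_assocv Lav).
Variables (b : braid_type T) (Lb : lift_braid LT b).
Local Notation Mb := (marked_braid Lb).
Variables (π : pentagonator_type a) (cπ : pentagonator_can La (pent π)).

(** The same mate pasted in [marked] carries its canonicity as second projection. *)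
Lemma pent_rev_can : pentagonator_can (lift_assoc_rev Lav) (pent_rev e π).
Proof.
move=> A B C D.
exact: (proj2_sig (pentv (marked_adjequiv ce) (marked_pentagonator cπ) D C B A)).
Qed.

Lemma pent_rev_can' : pentagonator_can' (lift_assoc_rev Lav) (pent_rev' e π).
Proof.
move=> A B C D.
exact: (proj2_sig (pentv' (marked_adjequiv ce) (marked_pentagonator cπ) D C B A)).
Qed.

Definition hexagonatorv_can (R : hexagonatorv_type b av) : Prop :=
  hexagonator_can (lift_assoc_rev Lav) (lift_braid_rev Lb) (hexa R).

(** Reversing and marking commute up to conversion: on 1-cells, [marked_tensor] of [lift_trev] and
    [trev] of the marked tensor give the same underlying 1-cells with the same marks. *)
Definition marked_hexagonatorv (R : hexagonatorv_type b av) (cR : hexagonatorv_can R) :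
  hexagonatorv_type Mb Mav.
Proof.
refine (@marked_imod _ _ _ _ _ _ _) => X.
  exact: (exist _ _ (cR X.1.1 X.1.2 X.2)).
exact: (exist _ _ (hexa_can' cR X.1.1 X.1.2 X.2)).
Defined.

Variables (R : hexagonator_type a b) (cR : hexagonator_can La Lb (hexa R)).
Variables (R' : hexagonatorv_type b av) (cR' : hexagonatorv_can R').

Lemma braid_axiom_31_thin : braid_axiom_13 (pent_rev e π) (pent_rev' e π) (hexa' R').
Proof.
exact: (braid_axiom_13_thin pent_rev_can pent_rev_can' (hexa_can' cR')).
Qed.

Lemma braid_axiom_YB_thin : braid_axiom_YB e R R'.
Proof.
have H : braid_axiom_YB (marked_adjequiv ce) (marked_hexagonator cR) (marked_hexagonatorv cR').
  by move=> *; apply: marked_thin.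
move=> A B C.
exact (f_equal (@proj1_sig _ _) (H A B C)).
Qed.

Lemma braid_axiom_22_thin : braid_axiom_22 e π R R'.
Proof.
have H : braid_axiom_22 (marked_adjequiv ce) (marked_pentagonator cπ)
    (marked_hexagonator cR) (marked_hexagonatorv cR').
  by move=> *; apply: marked_thin.
move=> A B C D.
exact (f_equal (@proj1_sig _ _) (H A B C D)).
Qed.

Definition syllepsis_can (ν : syllepsis_type b) : Prop :=
  forall A B : K, can S (mk_id S _) (mk_comp (lb1 Lb B A) (lb1 Lb A B)) (sycell ν A B).

Lemma sycell_can (ν : syllepsis_type b) :
  (forall X : B2 K, can S (mk_pn_id (ten T p21 p22) X)
    (mk_pn_comp (mk_braid_at Lb p22 p21) (mk_braid_at Lb p21 p22) X) (ν X)) ->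
  syllepsis_can ν.
Proof. move=> H A B; exact (H (A, B)). Qed.

Variables (ν : syllepsis_type b) (cν : syllepsis_can ν).

Definition marked_syllepsis : syllepsis_type Mb.
Proof.
refine (@marked_imod _ _ _ _ _ _ _) => X.
  exact: (exist _ _ (cν X.1 X.2)).
exact: (exist _ _ (can_inv (md_inv ν (X.1, X.2)) (cν X.1 X.2))).
Defined.

Lemma syllepsis_axiom_12_thin : syllepsis_axiom_12 e R R' ν.
Proof.
have H : syllepsis_axiom_12 (marked_adjequiv ce) (marked_hexagonator cR)
    (marked_hexagonatorv cR') marked_syllepsis by move=> *; apply: marked_thin.
move=> A B C.
exact (f_equal (@proj1_sig _ _) (H A B C)).
Qed.

Lemma syllepsis_axiom_21_thin : syllepsis_axiom_21 e R R' ν.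
Proof.
have H : syllepsis_axiom_21 (marked_adjequiv ce) (marked_hexagonator cR)
    (marked_hexagonatorv cR') marked_syllepsis by move=> *; apply: marked_thin.
move=> A B C.
exact (f_equal (@proj1_sig _ _) (H A B C)).
Qed.

Lemma symmetry_axiom_thin : symmetry_axiom ν.
Proof.
have H : symmetry_axiom marked_syllepsis by move=> *; apply: marked_thin.
move=> A B.
exact (f_equal (@proj1_sig _ _) (H A B)).
Qed.

End Reverse.
End Marked.

Local Close Scope bicat_scope.

(** * Companions *)

Section BicatCoherence.
Local Open Scope bicat_scope.
Variables (K : bicat) (HK : is_bicat K).

Lemma vcomp_injr (X Y : K) (f g h : hom X Y) (α : f ⇒ g) (α' : g ⇒ f) (β γ : g ⇒ h) :
  inverse2 α α' -> β • α = γ • α -> β = γ.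
Proof.
move=> [_ e] E; rewrite -(vcomp1r HK β) -(vcomp1r HK γ) -e.
by rewrite !(vcompA HK) E.
Qed.

Lemma vcomp_injl (X Y : K) (f g h : hom X Y) (α : g ⇒ h) (α' : h ⇒ g) (β γ : f ⇒ g) :
  inverse2 α α' -> α • β = α • γ -> β = γ.
Proof.
move=> [e _] E; rewrite -(vcomp1l HK β) -(vcomp1l HK γ) -e.
by rewrite -!(vcompA HK) E.
Qed.

Lemma hcomp_vcompl (X Y Z : K) (f : hom X Y) (g g' g'' : hom Y Z)
    (α : g ⇒ g') (β : g' ⇒ g'') :
  (β • α) ∗ id2 f = (β ∗ id2 f) • (α ∗ id2 f).
Proof. by rewrite -(interchange HK) (vcomp1l HK). Qed.

Lemma hcomp_vcompr (X Y Z : K) (f f' f'' : hom X Y) (g : hom Y Z)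
    (α : f ⇒ f') (β : f' ⇒ f'') :
  id2 g ∗ (β • α) = (id2 g ∗ β) • (id2 g ∗ α).
Proof. by rewrite -(interchange HK) (vcomp1l HK). Qed.

Lemma inverse2_hcomp (X Y Z : K) (f f' : hom X Y) (g g' : hom Y Z)
    (α : f ⇒ f') (α' : f' ⇒ f) (β : g ⇒ g') (β' : g' ⇒ g) :
  inverse2 α α' -> inverse2 β β' -> inverse2 (β ∗ α) (β' ∗ α').
Proof.
by move=> [a1 a2] [b1 b2]; split;
  rewrite -(interchange HK) ?a1 ?a2 ?b1 ?b2 (hcomp_id HK).
Qed.

Lemma inverse2_id (X Y : K) (f : hom X Y) : inverse2 (id2 f) (id2 f).
Proof. by split; apply: (vcomp1l HK). Qed.

Lemma hcomp_id1_injr (X Y : K) (f g : hom X Y) (α β : f ⇒ g) :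
  α ∗ id2 (id1 X) = β ∗ id2 (id1 X) -> α = β.
Proof.
move=> E; apply: (vcomp_injr (runit_inv HK f)).
by rewrite -!(runit_nat HK) E.
Qed.

Lemma hcomp_id1_injl (X Y : K) (f g : hom X Y) (α β : f ⇒ g) :
  id2 (id1 Y) ∗ α = id2 (id1 Y) ∗ β -> α = β.
Proof.
move=> E; apply: (vcomp_injr (lunit_inv HK f)).
by rewrite -!(lunit_nat HK) E.
Qed.

(** Whiskering with an identity 1-cell is faithful and associators are invertible; after whiskering
    and composing with an associator, the equation follows from pentagon, triangle and
    naturality. *)
Lemma runit_comp (X Y Z : K) (f : hom X Y) (g : hom Y Z) :
  runit (g ∘ f) = (id2 g ∗ runit f) • assoc (id1 X) f g.
Proof.
apply: hcomp_id1_injr; apply: (vcomp_injl (assoc_inv HK (id1 X) f g)).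
rewrite -(triangle HK) (vcompA HK) -(hcomp_id HK) (assoc_nat HK) -(vcompA HK).
rewrite (pentagon HK) !(vcompA HK) -hcomp_vcompr (triangle HK) -(assoc_nat HK).
by rewrite -(vcompA HK) -hcomp_vcompl.
Qed.

Lemma lunit_comp (X Y Z : K) (f : hom X Y) (g : hom Y Z) :
  lunit (g ∘ f) • assoc f g (id1 Z) = lunit g ∗ id2 f.
Proof.
apply: hcomp_id1_injl.
apply: (vcomp_injr (assoc_inv HK f (id1 Z ∘ g) (id1 Z))).
apply: (vcomp_injr (inverse2_hcomp (inverse2_id f) (assoc_inv HK g (id1 Z) (id1 Z)))).
rewrite hcomp_vcompr -(assoc_nat HK) -!(vcompA HK) -hcomp_vcompl (triangle HK).
rewrite (assoc_nat HK) (hcomp_id HK) -(triangle HK) -!(vcompA HK) (pentagon HK).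
by rewrite !(vcompA HK).
Qed.

(** After whiskering, [lunit_comp] and the triangle reduce the claim to [lunit (id1 X ∘ id1 X) = id2
    (id1 X) ∗ lunit (id1 X)], which is naturality of [lunit] at the invertible cell
    [lunit (id1 X)]. *)
Lemma lunit_runit_id1 (X : K) : lunit (id1 X) = runit (id1 X).
Proof.
apply: hcomp_id1_injr; rewrite -lunit_comp -(triangle HK); congr (_ • _).
by apply: (vcomp_injl (lunit_inv HK (id1 X))); rewrite (lunit_nat HK).
Qed.

End BicatCoherence.

Local Open Scope dbl_scope.

(** * 2-cells, companions and squares in a double category *)

Section Cells.
Variable D : dblcat.

Lemma glob_eq (A B : D) (M N : loose A B) (α β : glob M N) :
  gcell α = gcell β -> α = β.
Proof.
case: α β => [α p] [β q] /= E; subst β.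
by rewrite (proof_irrelevance _ p q).
Qed.

Lemma godotE (A B C : D) (M M' : loose A B) (N N' : loose B C)
    (β : glob N N') (α : glob M M') : godot β α = ocell (godot_eq β α) :> cell _ _.
Proof. by []. Qed.

Section Odot.
Variables (A B C A' B' C' : D).
Variables (M : loose A B) (N : loose B C) (M' : loose A' B') (N' : loose B' C').

(** Since [ocell] takes the proof that the boundaries match as its explicit argument, its factors
    are changed through this congruence instead of by rewriting in place. *)
Lemma ocell_eq (α α' : cell M M') (β β' : cell N N')
    (e : tgt α = src β) (e' : tgt α' = src β') :
  α = α' -> β = β' -> ocell e = ocell e'.
Proof. by move=> Eα Eβ; subst; rewrite (proof_irrelevance _ e e'). Qed.

Variables (A'' B'' C'' : D) (M'' : loose A'' B'') (N'' : loose B'' C'').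
Variables (α : cell M M') (β : cell N N') (α' : cell M' M'') (β' : cell N' N'').
Variables (e : tgt α = src β) (e' : tgt α' = src β').

Lemma ocomp_eq : tgt (α' • α) = src (β' • β).
Proof. by rewrite tgt_cmp src_cmp e e'. Qed.

Lemma ocellM : ocell e' • ocell e = ocell ocomp_eq.
Proof. by rewrite -(ocell_cmp e e' ocomp_eq). Qed.
End Odot.

Lemma ocell_cid (A B C : D) (M : loose A B) (N : loose B C) (α : cell M M)
    (β : cell N N) (e : tgt α = src β) :
  α = cid M -> β = cid N -> ocell e = cid (N ⊙ M).
Proof. by move=> Eα Eβ; subst; apply: ocell_id. Qed.

Lemma Lb_bicat : is_bicat (Lb D).
Proof.
split=> *; try split; apply: glob_eq => /=.
- exact: ccmpA.
- exact: ccmp1l.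
- exact: ccmp1r.
- exact: ocell_id.
- exact: ocell_cmp.
- exact: (dassoc_inv _ _ _).1.
- exact: (dassoc_inv _ _ _).2.
- exact: (dlunit_inv _).1.
- exact: (dlunit_inv _).2.
- exact: (drunit_inv _).1.
- exact: (drunit_inv _).2.
- exact: dassoc_nat.
(* The double-categorical naturality involves the identity square on the tight target, which is an
   identity cell when the 2-cell is globular. *)
- rewrite -dlunit_nat; last by rewrite Ucell_src.
  by move=> e; congr (_ • _); apply: ocell_eq; rewrite ?gtgt ?Ucell_id.
- rewrite -drunit_nat; last by rewrite Ucell_tgt.
  by move=> e; congr (_ • _); apply: ocell_eq; rewrite ?gsrc ?Ucell_id.
- exact: dpentagon.
- exact: dtriangle.
Qed.

Lemma drunit_odot (A B C : D) (M : loose A B) (N : loose B C)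
    (e : tgt (drunit M) = src (cid N)) :
  drunit (N ⊙ M) = ocell e • dassoc (U A) M N :> cell _ _.
Proof.
rewrite -[LHS]/(gcell (@runit (Lb D) A C (N ⊙ M))).
rewrite (@runit_comp (Lb D) Lb_bicat A B C M N) /=.
by congr (_ • _); apply: ocell_eq.
Qed.

Lemma dlunit_odot (A B C : D) (M : loose A B) (N : loose B C)
    (e : tgt (cid M) = src (dlunit N)) :
  dlunit (N ⊙ M) • dassoc M N (U C) = ocell e :> cell _ _.
Proof.
have := f_equal (@gcell _ _ _ _ _) (@lunit_comp (Lb D) Lb_bicat A B C M N).
by move=> /= ->; apply: ocell_eq.
Qed.

Lemma dlunit_drunit_U (A : D) : dlunit (U A) = drunit (U A).
Proof. exact: (@lunit_runit_id1 (Lb D) Lb_bicat A). Qed.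

(* A companion structure on [M].  Its tight 1-cell is [src ce] and not a parameter, so
   that equalities of tight 1-cells never require transport. *)
Record mark (A B : D) (M : loose A B) := Mark {
  ce : cell M (U B);
  ce_tgt : tgt ce = tid B;
  ch : cell (U A) M;
  ch_src : src ch = tid A;
  ch_tgt : tgt ch = src ce;
  ce_ch : ce • ch = Ucell (src ce);
  ce_odot_ch : dlunit M • ocell ch_tgt = drunit M
}.

Definition mark_companion (A B : D) (f : tight A B) (c : companion f) : mark (chat c) :=
  Mark (ceps_tgt c) (ceta_src c)
    (etrans (ceps_eta c) (f_equal (@Ucell _ _ _) (esym (ceps_src c))))
    (ceps_odot_eta (etrans (ceta_tgt c) (esym (ceps_src c)))).

Definition canonical (A B : D) (M N : loose A B) (c : mark M) (d : mark N)
    (α : cell M N) : Prop := ce d • α = ce c.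

(** [drunit_nat] with the left-out factor [Ucell (src α)] known only up to an equation; this spares
    rewriting under the dependent argument of [ocell]. *)
Lemma drunit_ocell (A B A' B' : D) (M : loose A B) (N : loose A' B') (α : cell M N)
    (u : cell (U A) (U A')) (e : tgt u = src α) :
  u = Ucell (src α) -> drunit N • ocell e = α • drunit M.
Proof. by move=> Eu; subst u; apply: drunit_nat. Qed.

Lemma dlunit_ocell (A B A' B' : D) (M : loose A B) (N : loose A' B') (α : cell M N)
    (u : cell (U B) (U B')) (e : tgt α = src u) :
  u = Ucell (tgt α) -> dlunit N • ocell e = α • dlunit M.
Proof. by move=> Eu; subst u; apply: dlunit_nat. Qed.

Lemma drunitK (A B A' B' : D) (M : loose A B) (N : loose A' B') (α β : cell M N) :
  α • drunit M = β • drunit M -> α = β.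
Proof.
move=> E; rewrite -(ccmp1r α) -(ccmp1r β) -(drunit_inv M).2.
by rewrite !ccmpA E.
Qed.

Section Counit.
Variables (A B : D) (M : loose A B) (c : mark M).

Lemma counit_eq (C : D) (Q : loose B C) : tgt (ce c) = src (cid Q).
Proof. by rewrite ce_tgt src_id. Qed.

(* The 2-cell [ε ⊙ Q] modulo the unit isomorphism. *)
Definition counit (C : D) (Q : loose B C) : cell (Q ⊙ M) Q :=
  locked (drunit Q • ocell (counit_eq Q)).

Lemma counitE (C : D) (Q : loose B C) : counit Q = drunit Q • ocell (counit_eq Q).
Proof. by rewrite /counit -lock. Qed.

Lemma counit_src (C : D) (Q : loose B C) : src (counit Q) = src (ce c).
Proof. by rewrite counitE src_cmp ocell_src gsrc tcmp1l. Qed.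

Lemma counit_tgt (C : D) (Q : loose B C) : tgt (counit Q) = tid C.
Proof. by rewrite counitE tgt_cmp ocell_tgt tgt_id gtgt tcmp1l. Qed.

Lemma counit_ocell (C A' B' C' : D) (Q : loose B C) (N : loose A' B')
    (Q' : loose B' C') (α : cell N M) (β : cell Q' Q) (e : tgt α = src β)
    (e' : tgt (ce c • α) = src β) :
  counit Q • ocell e = drunit Q • ocell e'.
Proof.
by rewrite counitE -ccmpA ocellM; congr (_ • _); apply: ocell_eq; rewrite ?ccmp1l.
Qed.

(** The hypothesis [e] forces the tight source of [β] to be an identity, so that [β] slides past ε
    by interchange and past the right unitor by naturality. *)
Lemma counit_nat (C C' : D) (Q : loose B C) (Q' : loose B C') (β : cell Q' Q)
    (e : tgt (cid M) = src β) :
  counit Q • ocell e = β • counit Q'.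
Proof.
have s : src β = tid B by rewrite -e tgt_id.
have e1 : tgt (ce c • cid M) = src β by rewrite tgt_cmp tgt_id tcmp1r ce_tgt.
have e2 : tgt (cid (U B)) = src β by rewrite tgt_id s.
rewrite (counit_ocell e e1) counitE ccmpA -(drunit_ocell e2); first by rewrite s Ucell_id.
by rewrite -ccmpA ocellM; congr (_ • _); apply: ocell_eq; rewrite ?ccmp1l ?ccmp1r.
Qed.

Lemma counit_odot (C E : D) (P : loose B C) (Q : loose C E)
    (e : tgt (counit P) = src (cid Q)) :
  counit (Q ⊙ P) = ocell e • dassoc M P Q.
Proof.
have e1 : tgt (drunit P) = src (cid Q) by rewrite gtgt src_id.
have e2 : tgt (ocell (counit_eq P)) = src (cid Q) by rewrite ocell_tgt tgt_id src_id.
have e3 : tgt (cid P) = src (cid Q) by rewrite tgt_id src_id.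
have e4 : tgt (ce c) = src (ocell e3) by rewrite ocell_src src_id ce_tgt.
transitivity (ocell e1 • (ocell e2 • dassoc M P Q)); last first.
  by rewrite ccmpA ocellM; congr (_ • _); apply: ocell_eq; rewrite ?ccmp1l ?counitE.
rewrite counitE.
rewrite -(dassoc_nat e4) ccmpA -drunit_odot; congr (_ • _); apply: ocell_eq => //.
by rewrite ocell_id.
Qed.

Lemma odot_eq_ch (C : D) (Q : loose B C) : tgt (ch c) = src (counit Q).
Proof. by rewrite counit_src ch_tgt. Qed.

(** The companion equation [ce_odot_ch] whiskered with [Q]. Naturality of the associator brings ε
    next to [Q], and the triangle exchanges the left unitor of [M] for the right unitor of [Q]. *)
Lemma counit_ch (C : D) (Q : loose B C) (e : tgt (ch c) = src (counit Q)) :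
  ocell e = drunit (Q ⊙ M).
Proof.
have e1 : tgt (drunit M) = src (cid Q) by rewrite gtgt src_id.
have e2 : tgt (dlunit M) = src (cid Q) by rewrite gtgt src_id.
have e3 : tgt (ocell (ch_tgt c)) = src (cid Q) by rewrite ocell_tgt ce_tgt src_id.
have e4 : tgt (cid M) = src (drunit Q) by rewrite gsrc tgt_id.
have e5 : tgt (ch c) = src (ocell (counit_eq Q)) by rewrite ocell_src ch_tgt.
rewrite (drunit_odot e1).
have -> : ocell e1 = ocell e2 • ocell e3.
  by rewrite ocellM; apply: ocell_eq; rewrite ?ccmp1l ?ce_odot_ch.
rewrite -ccmpA -(dassoc_nat e5) ccmpA.
have e6 : tgt (cid M) = src (drunit Q) by rewrite tgt_id gsrc.
rewrite (dtriangle e2 e6) ocellM; apply: ocell_eq; first by rewrite ccmp1l.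
by rewrite counitE.
Qed.

(** Uniqueness half of the universal property of a companion: [γ] is recovered from [src γ] and
    [counit Q • γ] by pasting η along the tight source. This is the claim [K], and it follows from
    [counit_ch]. *)
Lemma counit_inj (C A' C' : D) (Q : loose B C) (N : loose A' C')
    (α β : cell N (Q ⊙ M)) :
  src α = src β -> counit Q • α = counit Q • β -> α = β.
Proof.
suff K (γ : cell N (Q ⊙ M)) (e : tgt (ch c • Ucell (src γ)) = src (counit Q • γ)) :
    ocell e = γ • drunit N.
  move=> s E; apply: drunitK.
  have H (γ : cell N (Q ⊙ M)) : tgt (ch c • Ucell (src γ)) = src (counit Q • γ).
    by rewrite tgt_cmp src_cmp Ucell_tgt counit_src ch_tgt.
  by rewrite -(K _ (H α)) -(K _ (H β)); apply: ocell_eq; rewrite ?s.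
have e1 : tgt (Ucell (src γ)) = src γ by rewrite Ucell_tgt.
transitivity (ocell (odot_eq_ch Q) • ocell e1); first by rewrite ocellM; apply: ocell_eq.
by rewrite counit_ch; apply: drunit_nat.
Qed.

(** The argument of [counit_inj] with the companion equation itself in place of [counit_ch]. *)
Lemma ce_inj (A' B' : D) (N : loose A' B') (α β : cell N M) :
  src α = src β -> ce c • α = ce c • β -> α = β.
Proof.
suff K (γ : cell N M) (e : tgt (ch c • Ucell (src γ)) = src (ce c • γ)) :
    dlunit M • ocell e = γ • drunit N.
  move=> s E; apply: drunitK.
  have H (γ : cell N M) : tgt (ch c • Ucell (src γ)) = src (ce c • γ).
    by rewrite tgt_cmp src_cmp Ucell_tgt ch_tgt.
  by rewrite -(K _ (H α)) -(K _ (H β)); congr (_ • _); apply: ocell_eq; rewrite ?s.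
have e1 : tgt (Ucell (src γ)) = src γ by rewrite Ucell_tgt.
have -> : ocell e = ocell (ch_tgt c) • ocell e1 by rewrite ocellM; apply: ocell_eq.
by rewrite ccmpA ce_odot_ch; apply: drunit_nat.
Qed.

End Counit.

Lemma canonical_uniq (A B : D) (M N : loose A B) (c : mark M) (d : mark N)
    (α β : glob M N) :
  canonical c d α -> canonical c d β -> α = β.
Proof.
move=> cα cβ; apply: glob_eq; apply: (ce_inj (c := d)).
  by rewrite !gsrc.
by rewrite [LHS]cα [RHS]cβ.
Qed.

Section MarkComp.
Variables (A B C : D) (M : loose A B) (N : loose B C) (d : mark N) (c : mark M).

Lemma mark_comp_eq : tgt (ch c) = src (ch d • Ucell (src (ce c))).
Proof. by rewrite src_cmp Ucell_src ch_src tcmp1l ch_tgt. Qed.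

Lemma mark_comp_ce_ch :
  (ce d • counit c N) • (ocell mark_comp_eq • drunit' (U A))
  = Ucell (src (ce d • counit c N)).
Proof.
have e : tgt (ce c • ch c) = src (ch d • Ucell (src (ce c))).
  by rewrite tgt_cmp ce_tgt tcmp1l mark_comp_eq.
rewrite -ccmpA (ccmpA (drunit' _)) (counit_ocell mark_comp_eq e).
rewrite (drunit_ocell e); first by rewrite ce_ch src_cmp Ucell_src ch_src tcmp1l.
rewrite -(ccmpA (drunit' _)) (drunit_inv _).2 ccmp1r ccmpA ce_ch.
by rewrite src_cmp counit_src Ucell_cmp.
Qed.

Lemma mark_comp_ce_tgt : tgt (ce d • counit c N) = tid C.
Proof. by rewrite tgt_cmp counit_tgt ce_tgt tcmp1l. Qed.

Lemma mark_comp_ch_src : src (ocell mark_comp_eq • drunit' (U A)) = tid A.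
Proof. by rewrite src_cmp ocell_src ch_src gsrc tcmp1l. Qed.

Lemma mark_comp_ch_tgt :
  tgt (ocell mark_comp_eq • drunit' (U A)) = src (ce d • counit c N).
Proof.
by rewrite tgt_cmp ocell_tgt gtgt tcmp1r tgt_cmp Ucell_tgt ch_tgt src_cmp counit_src.
Qed.

(* A cell with the boundary of [ε] is a companion counit as soon as it is
   injective on cells and has a section [η]. *)
Lemma mark_comp_odot :
  dlunit (N ⊙ M) • ocell mark_comp_ch_tgt = drunit (N ⊙ M).
Proof.
set ε := ce d • counit c N.
have s : src (dlunit (N ⊙ M) • ocell mark_comp_ch_tgt) = src (drunit (N ⊙ M)).
  by rewrite src_cmp ocell_src mark_comp_ch_src !gsrc tcmp1l.
apply: (counit_inj (c := c)) => //.
apply: (ce_inj (c := d)); first by rewrite !(src_cmp _ (counit c N)) s.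
rewrite [LHS]ccmpA [RHS]ccmpA [LHS]ccmpA -/ε.
have e1 : tgt ε = src (Ucell (tgt ε)) by rewrite Ucell_src.
have e2 : tgt (Ucell (src ε)) = src ε by rewrite Ucell_tgt.
(* Naturality of the unitors at ε replaces them by the two unitors of [U C], which coincide; what
   remains is an equation of horizontal composites, settled by ε • η. *)
rewrite -(drunit_nat e2) -(dlunit_nat e1) dlunit_drunit_U -ccmpA ocellM.
congr (_ • _); apply: ocell_eq; first by rewrite mark_comp_ce_ch.
by rewrite mark_comp_ce_tgt Ucell_id ccmp1l.
Qed.

(** The counit is ε of [N] after the whiskering of ε of [M] with [N]. The unit places η of [M]
    beside η of [N] precomposed with the identity square on the tight 1-cell of [M]. *)
Definition mark_comp : mark (N ⊙ M) :=
  Mark mark_comp_ce_tgt mark_comp_ch_src mark_comp_ce_ch mark_comp_odot.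

End MarkComp.

Section MarkId.
Variable A : D.

Lemma mark_id_eq : tgt (cid (U A)) = src (cid (U A)).
Proof. by rewrite tgt_id src_id. Qed.

Lemma mark_id_ce_ch : cid (U A) • cid (U A) = Ucell (src (cid (U A))).
Proof. by rewrite ccmp1l src_id Ucell_id. Qed.

Lemma mark_id_odot : dlunit (U A) • ocell mark_id_eq = drunit (U A).
Proof. by rewrite ocell_id ccmp1r dlunit_drunit_U. Qed.

Definition mark_id : mark (U A) :=
  Mark (tgt_id (U A)) (src_id (U A)) mark_id_ce_ch mark_id_odot.
End MarkId.

Lemma canonical_inv (A B : D) (M N : loose A B) (c : mark M) (d : mark N)
    (α : glob M N) (β : glob N M) :
  ginverse α β -> canonical c d α -> canonical d c β.
Proof. by move=> [_ e] cα; rewrite /canonical -cα -ccmpA e ccmp1r. Qed.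

Lemma canonical_vcomp (A B : D) (M N P : loose A B) (c : mark M) (d : mark N)
    (f : mark P) (β : cell N P) (α : cell M N) :
  canonical d f β -> canonical c d α -> canonical c f (β • α).
Proof. by move=> cβ cα; rewrite /canonical ccmpA cβ. Qed.

Lemma canonical_hcomp (A B C : D) (M M' : loose A B) (N N' : loose B C)
    (c : mark M) (c' : mark M') (d : mark N) (d' : mark N')
    (β : glob N N') (α : glob M M') :
  canonical d d' β -> canonical c c' α ->
  canonical (mark_comp d c) (mark_comp d' c') (godot β α).
Proof.
move=> cβ cα; rewrite /canonical godotE /= -cβ -[LHS]ccmpA -[RHS]ccmpA; congr (_ • _).
have e : tgt (ce c' • α) = src β by rewrite cα ce_tgt gsrc.
have e1 : tgt (cid M) = src β by rewrite tgt_id gsrc.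
rewrite (counit_ocell _ e) -(counit_nat c e1).
rewrite counitE -ccmpA ocellM; congr (_ • _).
by apply: ocell_eq; rewrite ?ccmp1l ?ccmp1r.
Qed.

Lemma canonical_assoc (A B C E : D) (M : loose A B) (N : loose B C) (P : loose C E)
    (c : mark M) (d : mark N) (f : mark P) :
  canonical (mark_comp (mark_comp f d) c) (mark_comp f (mark_comp d c)) (dassoc M N P).
Proof.
rewrite /canonical /= -[LHS]ccmpA -[RHS]ccmpA; congr (_ • _).
have e : tgt (counit c N) = src (cid P) by rewrite counit_tgt src_id.
rewrite (counit_odot e) [RHS]ccmpA; congr (_ • _).
rewrite counitE (counitE d P) -[RHS]ccmpA ocellM; congr (_ • _).
by apply: ocell_eq; rewrite ?ccmp1l.
Qed.

Lemma canonical_lunit (A B : D) (M : loose A B) (c : mark M) :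
  canonical (mark_comp (mark_id B) c) c (dlunit M).
Proof.
have e : tgt (ce c) = src (cid (U B)) by rewrite ce_tgt src_id.
rewrite /canonical /= ccmp1l -(dlunit_ocell e); first by rewrite ce_tgt Ucell_id.
by rewrite counitE dlunit_drunit_U; congr (_ • _); apply: ocell_eq.
Qed.

Lemma canonical_runit (A B : D) (M : loose A B) (c : mark M) :
  canonical (mark_comp c (mark_id A)) c (drunit M).
Proof.
rewrite /canonical /= counitE; congr (_ • _).
by rewrite -[LHS]ccmp1r; congr (_ • _); rewrite ocell_id.
Qed.

Section Theta.
Variables (A B : D) (M N : loose A B) (c : mark M) (d : mark N).
Hypothesis E : src (ce c) = src (ce d).

Lemma theta_eq : tgt (ch d) = src (ce c).
Proof. by rewrite ch_tgt E. Qed.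

(** The usual comparison of two companions: η of the target pasted to ε of the source. Both lie over
    the same tight 1-cell only by the propositional equality [E], which is consumed here as a
    boundary condition. *)
Definition theta_cell : cell M N := dlunit N • ocell theta_eq • drunit' M.

Lemma theta_src : src theta_cell = tid A.
Proof. by rewrite !src_cmp ocell_src ch_src !gsrc !tcmp1l. Qed.

Lemma theta_tgt : tgt theta_cell = tid B.
Proof. by rewrite !tgt_cmp ocell_tgt ce_tgt !gtgt !tcmp1l. Qed.

Definition theta : glob M N := mkglob theta_src theta_tgt.

Lemma theta_canonical : canonical c d theta.
Proof.
rewrite /canonical /= /theta_cell !ccmpA.
have e1 : tgt (ce d) = src (Ucell (tgt (ce d))) by rewrite Ucell_src.
have e2 : tgt (Ucell (src (ce c))) = src (ce c) by rewrite Ucell_tgt.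
rewrite -(dlunit_nat e1) -[_ • _ • ocell theta_eq]ccmpA ocellM.
rewrite -[RHS]ccmp1r -(drunit_inv M).2 ccmpA -(drunit_nat e2) dlunit_drunit_U.
congr (_ • _ • _); apply: ocell_eq; first by rewrite ce_ch E.
by rewrite ce_tgt Ucell_id ccmp1l.
Qed.
End Theta.

Lemma theta_inv (A B : D) (M N : loose A B) (c : mark M) (d : mark N)
    (E : src (ce c) = src (ce d)) (E' : src (ce d) = src (ce c)) :
  ginverse (theta E) (theta E').
Proof.
have id (P : loose A B) (f : mark P) : canonical f f (gid P) by apply: ccmp1r.
have cE := theta_canonical E; have cE' := theta_canonical E'.
by split; [have := canonical_uniq (α := gcmp (theta E') (theta E)) (canonical_vcomp cE' cE) (id _ c)
 |have := canonical_uniq (α := gcmp (theta E) (theta E')) (canonical_vcomp cE cE') (id _ d)];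
  move/(f_equal (@gcell _ _ _ _ _)).
Qed.

(* [σ] is the loose cell [ε_d ⊙ φ] transported along the universal property of [ε_c]. *)
Definition square (A B A' B' : D) (M : loose A A') (M' : loose B B')
    (P : loose A B) (Q : loose A' B') (c : mark M) (d : mark M')
    (φ : cell P Q) (σ : cell (M' ⊙ P) (Q ⊙ M)) : Prop :=
  src φ = src (ce c) /\
  exists e : tgt φ = src (ce d), counit c Q • σ = dlunit Q • ocell e.

(** The main device for equations between naturality cells: both sides are shown to lie over the
    same tight 2-cell [φ], using the closure properties that follow, and [counit_inj] identifies
    them. *)
Lemma square_uniq (A B A' B' : D) (M : loose A A') (M' : loose B B')
    (P : loose A B) (Q : loose A' B') (c : mark M) (d : mark M')
    (φ : cell P Q) (σ τ : glob (M' ⊙ P) (Q ⊙ M)) :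
  square c d φ σ -> square c d φ τ -> σ = τ.
Proof.
move=> [_ [e Eσ]] [_ [e' Eτ]]; apply: glob_eq; apply: (counit_inj (c := c)).
  by rewrite !gsrc.
by rewrite Eσ Eτ; congr (_ • _); apply: ocell_eq.
Qed.

Lemma square_canonicall (A B A' B' : D) (M N : loose A A') (M' : loose B B')
    (P : loose A B) (Q : loose A' B') (c : mark M) (c' : mark N) (d : mark M')
    (φ : cell P Q) (σ : cell (M' ⊙ P) (Q ⊙ M)) (μ : glob M N) :
  canonical c c' μ -> square c d φ σ ->
  square c' d φ (godot (gid Q) μ • σ).
Proof.
move=> cμ [s [e E]]; split; first by rewrite s -cμ src_cmp gsrc tcmp1r.
exists e; rewrite -E ccmpA godotE; congr (_ • _).
have e1 : tgt (ce c' • μ) = src (gid Q) by rewrite cμ ce_tgt gsrc.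
by rewrite (counit_ocell _ e1) counitE; congr (_ • _); apply: ocell_eq.
Qed.

Lemma square_canonicalr (A B A' B' : D) (M : loose A A') (M' N' : loose B B')
    (P : loose A B) (Q : loose A' B') (c : mark M) (d : mark M') (d' : mark N')
    (φ : cell P Q) (σ : cell (N' ⊙ P) (Q ⊙ M)) (μ : glob M' N') :
  canonical d d' μ -> square c d' φ σ ->
  square c d φ (σ • godot μ (gid P)).
Proof.
move=> cμ [s [e E]]; split=> //.
have e1 : tgt φ = src (ce d) by rewrite e -cμ src_cmp gsrc tcmp1r.
exists e1; rewrite ccmpA E godotE -ccmpA ocellM; congr (_ • _).
by apply: ocell_eq; rewrite ?ccmp1r.
Qed.

Lemma square_pre (A B A' B' : D) (M : loose A A') (M' : loose B B')
    (P P' : loose A B) (Q : loose A' B') (c : mark M) (d : mark M')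
    (φ : cell P Q) (σ : cell (M' ⊙ P) (Q ⊙ M)) (α : glob P' P) :
  square c d φ σ -> square c d (φ • α) (σ • godot (gid M') α).
Proof.
move=> [s [e E]]; split; first by rewrite src_cmp s gsrc tcmp1r.
have e1 : tgt (φ • α) = src (ce d) by rewrite tgt_cmp e gtgt tcmp1r.
exists e1; rewrite ccmpA E godotE -ccmpA ocellM; congr (_ • _).
by apply: ocell_eq; rewrite ?ccmp1r.
Qed.

Lemma square_post (A B A' B' : D) (M : loose A A') (M' : loose B B')
    (P : loose A B) (Q Q' : loose A' B') (c : mark M) (d : mark M')
    (φ : cell P Q) (σ : cell (M' ⊙ P) (Q ⊙ M)) (β : glob Q Q') :
  square c d φ σ -> square c d (β • φ) (godot β (gid M) • σ).
Proof.
move=> [s [e E]]; split; first by rewrite src_cmp s gsrc tcmp1l.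
have e1 : tgt (β • φ) = src (ce d) by rewrite tgt_cmp e gtgt tcmp1l.
have e2 : tgt (cid M) = src β by rewrite tgt_id gsrc.
have e3 : tgt (gcell β) = src (cid (U B')) by rewrite gtgt src_id.
exists e1; rewrite ccmpA godotE (counit_nat c (godot_eq β (gid M))) -[LHS]ccmpA E.
rewrite [LHS]ccmpA -(dlunit_ocell e3); first by rewrite gtgt Ucell_id.
by rewrite -ccmpA ocellM; congr (_ • _); apply: ocell_eq; rewrite ?ccmp1l.
Qed.

Lemma square_id (A B : D) (P : loose A B) :
  square (mark_id A) (mark_id B) (cid P) (drunit' P • dlunit P).
Proof.
split; first by rewrite !src_id.
have e : tgt (cid P) = src (cid (U B)) by rewrite tgt_id src_id.
exists e; rewrite ocell_id ccmp1r counitE.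
rewrite [ocell _]ocell_id ccmp1r ccmpA (drunit_inv P).2.
by rewrite ccmp1l.
Qed.

(** The loose cell is the one that occurs, before [psfU], on the right of [pn2_unit]; [square_id]
    treats in the same way the cell of [pn_id]. *)
Lemma square_Ucell (A A' : D) (M : loose A A') (c : mark M) :
  square c c (Ucell (src (ce c))) (dlunit' M • drunit M).
Proof.
split; first by rewrite Ucell_src.
have e : tgt (Ucell (src (ce c))) = src (ce c) by rewrite Ucell_tgt.
exists e; rewrite ccmpA dlunit_drunit_U (drunit_nat e); congr (_ • _).
have e1 : tgt (ce c) = src (cid (U A')) by rewrite ce_tgt src_id.
have -> : counit c (U A') = ce c • dlunit M.
  rewrite -(dlunit_ocell e1); first by rewrite ce_tgt Ucell_id.
  by rewrite counitE dlunit_drunit_U; congr (_ • _); apply: ocell_eq.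
by rewrite -ccmpA (dlunit_inv M).2 ccmp1r.
Qed.

(** The pasted loose cell is exactly the 2-cell of [pn_comp], so composing companion transformations
    corresponds to composing tight 2-cells. *)
Lemma square_vcomp (A B A' B' A'' B'' : D)
    (M : loose A A') (M' : loose B B') (N : loose A' A'') (N' : loose B' B'')
    (P : loose A B) (Q : loose A' B') (R : loose A'' B'')
    (c : mark M) (d : mark M') (c' : mark N) (d' : mark N')
    (φ : cell P Q) (ψ : cell Q R)
    (σ : glob (M' ⊙ P) (Q ⊙ M)) (τ : glob (N' ⊙ Q) (R ⊙ N)) :
  square c d φ σ -> square c' d' ψ τ ->
  square (mark_comp c' c) (mark_comp d' d) (ψ • φ)
    (dassoc M N R • godot τ (gid M) • dassoc' M Q N' • godot (gid N') σ
     • dassoc P M' N').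
Proof.
move=> [s [e E]] [s' [e' E']]; split.
  by rewrite /= src_cmp s s' [RHS]src_cmp counit_src.
have e0 : tgt (ψ • φ) = src (ce (mark_comp d' d)).
  by rewrite /= tgt_cmp e e' [RHS]src_cmp counit_src.
exists e0; rewrite !godotE.
have -> : counit (mark_comp c' c) R • (dassoc M N R • ocell (godot_eq τ (gid M))
    • dassoc' M Q N' • ocell (godot_eq (gid N') σ) • dassoc P M' N')
  = counit c' R • counit c (R ⊙ N) • ocell (godot_eq τ (gid M))
    • dassoc' M Q N' • ocell (godot_eq (gid N') σ) • dassoc P M' N'.
  rewrite !ccmpA; congr (_ • _ • _ • _ • _).
  have ea : tgt (counit c N) = src (cid R) by rewrite counit_tgt src_id.
  rewrite (counit_odot ea) ccmpA; congr (_ • _).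
  rewrite counitE (counitE c' R) -[RHS]ccmpA ocellM; congr (_ • _).
  by apply: ocell_eq; rewrite ?ccmp1l.
rewrite -(ccmpA (ocell _) (counit c (R ⊙ N))) (counit_nat c (godot_eq τ (gid M))).
rewrite ccmpA E'.
have ea : tgt (counit c Q) = src (cid N') by rewrite counit_tgt src_id.
rewrite (counit_odot ea).
rewrite (ccmpA (dassoc M Q N')) -(ccmpA (dassoc' M Q N')) (dassoc_inv M Q N').2 ccmp1r.
rewrite -(ccmpA (ocell (godot_eq (gid N') σ))) ocellM.
have e1 : tgt (dlunit Q) = src (cid N') by rewrite gtgt src_id.
have e2 : tgt (ocell e) = src (cid N') by rewrite ocell_tgt ce_tgt src_id.
have -> : ocell (ocomp_eq (godot_eq (gid N') σ) ea) = ocell e1 • ocell e2.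
  by rewrite ocellM; apply: ocell_eq; rewrite ?ccmp1l.
have e3 : tgt φ = src (ocell (counit_eq d N')) by rewrite ocell_src e.
have e4 : tgt (cid Q) = src (drunit N') by rewrite tgt_id gsrc.
have -> : ocell e0 = ocell e' • ocell e4 • ocell e3.
  rewrite -ccmpA !ocellM; apply: ocell_eq; first by rewrite ccmp1l.
  by rewrite /= counitE.
(* The triangle trades the right unitor of [N'] for the left unitor of [Q], the one that the square
   of [σ] produced on the other side. *)
rewrite -(dtriangle e1 e4) !ccmpA -(ccmpA (ocell e3)) (dassoc_nat (e1 := counit_eq d N') (e3 := e) e3 e2).
by rewrite !ccmpA.
Qed.

(** The pasted loose cell is the right-hand side of [pn2_comp] without its constraint cell
    [psfC]. *)
Lemma square_hcomp (A B C A' B' C' : D)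
    (M : loose A A') (M' : loose B B') (M'' : loose C C')
    (P : loose A B) (Q : loose A' B') (P' : loose B C) (Q' : loose B' C')
    (c : mark M) (d : mark M') (f : mark M'')
    (φ : cell P Q) (ψ : cell P' Q') (h : tgt φ = src ψ)
    (σ : glob (M' ⊙ P) (Q ⊙ M)) (τ : glob (M'' ⊙ P') (Q' ⊙ M')) :
  square c d φ σ -> square d f ψ τ ->
  square c f (ocell h)
    (dassoc' M Q Q' • godot (gid Q') σ • dassoc P M' Q' • godot τ (gid P)
     • dassoc' P P' M'').
Proof.
move=> [s [e E]] [s' [e' E']]; split; first by rewrite ocell_src s.
have e0 : tgt (ocell h) = src (ce f) by rewrite ocell_tgt e'.
exists e0; rewrite !godotE.
have ea : tgt (counit c Q) = src (cid Q') by rewrite counit_tgt src_id.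
rewrite !ccmpA (counit_odot ea) -(ccmpA (dassoc' M Q Q')) (dassoc_inv M Q Q').2 ccmp1r.
rewrite ocellM.
have e1 : tgt (dlunit Q) = src (cid Q') by rewrite gtgt src_id.
have e2 : tgt (ocell e) = src (cid Q') by rewrite ocell_tgt ce_tgt src_id.
have -> : ocell (ocomp_eq (godot_eq (gid Q') σ) ea) = ocell e1 • ocell e2.
  by rewrite ocellM; apply: ocell_eq; rewrite ?ccmp1l.
have e3 : tgt φ = src (ocell (counit_eq d Q')) by rewrite ocell_src e.
have e4 : tgt (cid Q) = src (drunit Q') by rewrite tgt_id gsrc.
rewrite -(ccmpA (dassoc P M' Q')) -(dassoc_nat (e1 := counit_eq d Q') (e3 := e) e3 e2).
(* The triangle turns the left unitor of [Q] into the right unitor of [Q']; this completes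
   [counit d Q'], to which the square of [τ] applies. *)
rewrite (ccmpA (ocell e3)) (dtriangle e1 e4) !ocellM.
have e5 : tgt φ = src (ocell e') by rewrite ocell_src h.
have e6 : tgt (cid Q) = src (dlunit Q') by rewrite tgt_id gsrc.
have -> : ocell (ocomp_eq (godot_eq τ (gid P)) (ocomp_eq e3 e4)) = ocell e6 • ocell e5.
  rewrite ocellM; apply: ocell_eq; first by rewrite ccmp1r.
  by rewrite -counitE E'.
rewrite -(dlunit_odot e6) -!ccmpA; congr (_ • _).
rewrite (ccmpA (dassoc' _ _ _)) (dassoc_nat (e1 := e') (e3 := h) e5 e0).
by rewrite -ccmpA (dassoc_inv _ _ _).2 ccmp1r.
Qed.

(** When [P] and [Q] are companions as well and [φ] intertwines their counits, the square equation
    becomes compatibility with the composite counits. This is how naturality cells at marked 1-cells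
    are found to be canonical. *)
Lemma square_mark (A B A' B' : D) (M : loose A A') (M' : loose B B')
    (P : loose A B) (Q : loose A' B') (c : mark M) (d : mark M') (p : mark P) (q : mark Q)
    (φ : cell P Q) (σ : cell (M' ⊙ P) (Q ⊙ M)) :
  ce q • φ = Ucell (src (ce d)) • ce p -> square c d φ σ ->
  canonical (mark_comp d p) (mark_comp q c) σ.
Proof.
move=> H [s [e E]]; rewrite /canonical /= -[LHS]ccmpA E ccmpA.
have e1 : tgt (ce q) = src (cid (U B')) by rewrite ce_tgt src_id.
have e2 : tgt (Ucell (src (ce d))) = src (ce d) by rewrite Ucell_tgt.
rewrite -(dlunit_ocell e1); first by rewrite ce_tgt Ucell_id.
rewrite counitE ccmpA -(drunit_ocell e2) // dlunit_drunit_U -!ccmpA !ocellM.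
by congr (_ • _); apply: ocell_eq; rewrite ?ccmp1l ?ccmp1r.
Qed.

Section HatSquare.
Variables (E : dblcat) (F G : dfun E D) (α : dtrans F G).
Variable c : forall A : E, companion (α A).
Variables (A B : E) (M : loose A B).

(** Composing with ε at [A] meets the η inside [hat] and collapses by [ceps_eta], leaving ε at [B]
    beside [dtc α M]. *)
Lemma hat_square :
  square (mark_companion (c A)) (mark_companion (c B)) (dtc α M) (hat c M).
Proof.
set m := mark_companion (c A).
split; first by rewrite dtc_src /= ceps_src.
have e : tgt (dtc α M) = src (ce (mark_companion (c B))) by rewrite dtc_tgt /= ceps_src.
exists e.
rewrite [gcell (hat _ _)]/gcell /= /hat_cell godotE.
have e1 : tgt (counit m (dfl G M)) = src (cid (U (G B))) by rewrite counit_tgt src_id.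
rewrite !ccmpA -(dlunit_ocell e1); first by rewrite counit_tgt Ucell_id.
rewrite -!ccmpA; congr (_ • _); rewrite !ocellM.
apply: ocell_eq; last by rewrite ccmp1l ccmp1r.
have e2 : tgt (ce m • ceta (c A)) = src (dtc α M).
  by rewrite /= ceps_eta Ucell_tgt dtc_src.
rewrite ccmpA (counit_ocell _ e2) (drunit_ocell e2); first by rewrite /= ceps_eta dtc_src.
by rewrite -ccmpA (drunit_inv _).2 ccmp1r.
Qed.
End HatSquare.

End Cells.

Lemma inverse2_ginverse (D : dblcat) (A B : D) (M N : loose A B)
    (α : glob M N) (β : glob N M) :
  ginverse α β -> @inverse2 (Lb D) A B M N α β.
Proof. by move=> [h1 h2]; split; apply: glob_eq. Qed.

Lemma ginverse_inverse2 (D : dblcat) (A B : D) (M N : loose A B)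
    (α : glob M N) (β : glob N M) :
  @inverse2 (Lb D) A B M N α β -> ginverse α β.
Proof. by move=> [/(f_equal (@gcell _ _ _ _ _)) h1 /(f_equal (@gcell _ _ _ _ _)) h2]. Qed.

(** * Companions under double functors, in products and in the terminal double category *)

Section MarkFunctor.
Variables (D E : dblcat) (F : dfun D E) (HF : is_dfun F).

Section MarkFun.
Variables (A B : D) (M : loose A B) (c : mark M).

Lemma mark_fun_ce_tgt : tgt (dfU' F B • dfc F (ce c)) = tid (F B).
Proof. by rewrite tgt_cmp gtgt dfc_tgt ce_tgt df1_id tcmp1l. Qed.

Lemma mark_fun_ce_src : src (dfU' F B • dfc F (ce c)) = df1 F (src (ce c)).
Proof. by rewrite src_cmp gsrc dfc_src tcmp1l. Qed.

Lemma mark_fun_ch_src : src (dfc F (ch c) • dfU F A) = tid (F A).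
Proof. by rewrite src_cmp gsrc dfc_src ch_src df1_id tcmp1l. Qed.

Lemma mark_fun_ch_tgt :
  tgt (dfc F (ch c) • dfU F A) = src (dfU' F B • dfc F (ce c)).
Proof. by rewrite mark_fun_ce_src tgt_cmp gtgt dfc_tgt ch_tgt tcmp1r. Qed.

Lemma mark_fun_ce_ch :
  (dfU' F B • dfc F (ce c)) • (dfc F (ch c) • dfU F A)
  = Ucell (src (dfU' F B • dfc F (ce c))).
Proof.
rewrite mark_fun_ce_src ccmpA -(ccmpA (dfc F (ch c))) -dfc_cmp ce_ch.
by rewrite -ccmpA -(dfU_nat HF) ccmpA (dfU_inv HF _).1 ccmp1l.
Qed.

(** The two unit axioms of [F] express the unitors of [dfl F M] through [dfO]; naturality of [dfO]
    then reduces the equation to the image of [ce_odot_ch]. *)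
Lemma mark_fun_odot : dlunit (dfl F M) • ocell mark_fun_ch_tgt = drunit (dfl F M).
Proof.
have e1 : tgt (cid (dfl F M)) = src (dfU' F B) by rewrite gsrc tgt_id.
have e2 : tgt (dfc F (ch c)) = src (dfc F (ce c)) by rewrite dfc_src dfc_tgt ch_tgt.
have e3 : tgt (dfU F A) = src (cid (dfl F M)) by rewrite gtgt src_id.
have -> : ocell mark_fun_ch_tgt = ocell e1 • ocell e2 • ocell e3.
  by rewrite -ccmpA !ocellM; apply: ocell_eq; rewrite ?ccmp1l ?ccmp1r.
have e4 : tgt (cid (dfl F M)) = src (dfU F B) by rewrite gsrc tgt_id.
have H : dlunit (dfl F M) • ocell e1 = dfc F (dlunit M) • dfO F M (U B).
  rewrite -(dfO_lunit HF e4) -!ccmpA ocellM ocell_cid ?ccmp1l ?ccmp1r //.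
  exact: (dfU_inv HF _).2.
rewrite !ccmpA H -(dfO_runit HF e3) -(ccmpA (ocell e2)); congr (_ • _).
rewrite (dfO_nat HF (ch_tgt c)) ccmpA -dfc_cmp.
by rewrite ce_odot_ch.
Qed.

Definition mark_fun : mark (dfl F M) :=
  Mark mark_fun_ce_tgt mark_fun_ch_src mark_fun_ce_ch mark_fun_odot.
End MarkFun.

(** Compatibility of whiskered counits with [F]; both canonicity of [dfO] and preservation of
    squares come down to it. *)
Lemma counit_fun (A B C : D) (M : loose A B) (c : mark M) (Q : loose B C) :
  counit (mark_fun c) (dfl F Q) = dfc F (counit c Q) • dfO F M Q.
Proof.
have e : tgt (dfU' F B) = src (cid (dfl F Q)) by rewrite gtgt src_id.
have e' : tgt (dfc F (ce c)) = src (cid (dfl F Q)).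
  by rewrite dfc_tgt ce_tgt df1_id src_id.
have e1 : tgt (dfU F B) = src (cid (dfl F Q)) by rewrite gtgt src_id.
have e2 : tgt (dfc F (ce c)) = src (dfc F (cid Q)).
  by rewrite dfc_tgt dfc_src ce_tgt src_id.
have -> : counit (mark_fun c) (dfl F Q) = drunit (dfl F Q) • (ocell e • ocell e').
  by rewrite counitE ocellM; congr (_ • _); apply: ocell_eq; rewrite ?ccmp1l.
rewrite counitE dfc_cmp -[RHS]ccmpA -(dfO_nat HF (counit_eq c Q) e2) !ccmpA.
have -> : ocell e2 = ocell e' by apply: ocell_eq; rewrite ?dfc_id.
congr (_ • _).
rewrite -(dfO_runit HF e1) -[LHS]ccmpA ocellM ocell_cid ?ccmp1l ?ccmp1r //.
exact: (dfU_inv HF _).2.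
Qed.

Lemma canonical_fun (A B : D) (M N : loose A B) (c : mark M) (d : mark N)
    (α : cell M N) :
  canonical c d α -> canonical (mark_fun c) (mark_fun d) (dfc F α).
Proof. by move=> cα; rewrite /canonical /= -ccmpA -dfc_cmp cα. Qed.

Lemma canonical_dfO (A B C : D) (M : loose A B) (N : loose B C) (c : mark M) (d : mark N) :
  canonical (mark_comp (mark_fun d) (mark_fun c)) (mark_fun (mark_comp d c)) (dfO F M N).
Proof. by rewrite /canonical /= counit_fun dfc_cmp !ccmpA. Qed.

Lemma canonical_dfU (A : D) : canonical (mark_id (F A)) (mark_fun (mark_id A)) (dfU F A).
Proof. by rewrite /canonical /= dfc_id ccmp1r (dfU_inv HF _).1. Qed.

Lemma square_fun (A B A' B' : D) (M : loose A A') (M' : loose B B')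
    (P : loose A B) (Q : loose A' B') (c : mark M) (d : mark M')
    (φ : cell P Q) (σ : cell (M' ⊙ P) (Q ⊙ M)) :
  square c d φ σ ->
  square (mark_fun c) (mark_fun d) (dfc F φ) (dfO' F M Q • dfc F σ • dfO F P M').
Proof.
move=> [s [e H]]; split; first by rewrite mark_fun_ce_src dfc_src s.
have e0 : tgt (dfc F φ) = src (ce (mark_fun d)) by rewrite mark_fun_ce_src dfc_tgt e.
exists e0; rewrite counit_fun !ccmpA -(ccmpA (dfO' F M Q)) (dfO_inv HF _ _).2 ccmp1r.
rewrite -dfc_cmp H dfc_cmp.
have e1 : tgt (dfc F φ) = src (dfc F (ce d)) by rewrite dfc_src dfc_tgt e.
have e2 : tgt (cid (dfl F Q)) = src (dfU' F B') by rewrite gsrc tgt_id.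
have e3 : tgt (cid (dfl F Q)) = src (dfU F B') by rewrite gsrc tgt_id.
rewrite -ccmpA -(dfO_nat HF e e1) ccmpA.
have -> : ocell e0 = ocell e2 • ocell e1.
  by rewrite ocellM; apply: ocell_eq; rewrite ?ccmp1l.
rewrite [RHS]ccmpA; congr (_ • _).
rewrite -(dfO_lunit HF e3) -[RHS]ccmpA ocellM ocell_cid ?ccmp1l ?ccmp1r //.
exact: (dfU_inv HF _).2.
Qed.

End MarkFunctor.

(** Naturality of [α] at ε moves the question to the loose unit of [B], where [dtc_U] answers it.
    This supplies the intertwining hypothesis of [square_mark]. *)
Lemma dtc_counit (D E : dblcat) (F G : dfun D E) (α : dtrans F G) (A B : D)
    (M : loose A B) (ε : cell M (U B)) :
  (forall A, ginverse (dfU F A) (dfU' F A)) ->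
  (forall A, ginverse (dfU G A) (dfU' G A)) ->
  (dfU' G B • dfc G ε) • dtc α M = Ucell (α B) • (dfU' F B • dfc F ε).
Proof.
move=> HF HG; rewrite -ccmpA dtc_nat !ccmpA; congr (_ • _).
rewrite -[LHS]ccmp1r -(HF B).2 ccmpA -(ccmpA (dfU F B)) -dtc_U ccmpA (HG B).1.
by rewrite ccmp1l.
Qed.

Section MarkPair.
Variables (D E : dblcat).

Section Pair.
Variables (A B : dprod D E) (M : loose A B) (c : mark M.1) (d : mark M.2).

Lemma mark_pair_ch_tgt :
  @tgt (dprod D E) _ _ _ _ (U A) M (ch c, ch d)
  = @src (dprod D E) _ _ _ _ M (U B) (ce c, ce d).
Proof. exact: (f_equal2 pair (ch_tgt c) (ch_tgt d)). Qed.

Lemma mark_pair_odot : dlunit M • ocell mark_pair_ch_tgt = drunit M.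
Proof.
rewrite /= -[RHS]/(gcell (drunit M.1), gcell (drunit M.2)).
by rewrite -(ce_odot_ch c) -(ce_odot_ch d); congr pair; congr (_ • _); apply: ocell_eq.
Qed.

Definition mark_pair : mark M :=
  @Mark (dprod D E) A B M (ce c, ce d) (f_equal2 pair (ce_tgt c) (ce_tgt d))
    (ch c, ch d) (f_equal2 pair (ch_src c) (ch_src d)) _
    (f_equal2 pair (ce_ch c) (ce_ch d)) mark_pair_odot.
End Pair.

Lemma counit_pair (A B C : dprod D E) (M : loose A B) (Q : loose B C)
    (c : mark M.1) (d : mark M.2) :
  counit (mark_pair c d) Q = (counit c Q.1, counit d Q.2).
Proof.
by rewrite !counitE; congr pair; congr (_ • _); apply: ocell_eq.
Qed.

(** Only the counits are compared, and that suffices: [canonical] depends on a mark through its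
    counit alone. *)
Lemma ce_pair_comp (A B C : dprod D E) (M : loose A B) (N : loose B C)
    (c : mark M.1) (c' : mark M.2) (d : mark N.1) (d' : mark N.2) :
  ce (mark_comp (mark_pair d d') (mark_pair c c'))
  = ce (mark_pair (M := N ⊙ M) (mark_comp d c) (mark_comp d' c')).
Proof. by rewrite /= counit_pair. Qed.

Lemma square_pair (A B A' B' : dprod D E) (M : loose A A') (M' : loose B B')
    (P : loose A B) (Q : loose A' B') (c : mark M.1) (c' : mark M.2)
    (d : mark M'.1) (d' : mark M'.2) (φ : cell P Q) (σ : cell (M' ⊙ P) (Q ⊙ M)) :
  square c d φ.1 σ.1 -> square c' d' φ.2 σ.2 ->
  square (mark_pair c c') (mark_pair d d') φ σ.
Proof.
move=> [s [e H]] [s' [e' H']]; split; first exact: (f_equal2 pair s s').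
exists (f_equal2 pair e e'); rewrite counit_pair.
rewrite /= -[LHS]/(counit c Q.1 • σ.1, counit c' Q.2 • σ.2) H H'.
by congr pair; congr (_ • _); apply: ocell_eq.
Qed.

End MarkPair.

Definition mark_term (A B : dterm) (M : loose A B) : mark M :=
  @Mark dterm A B M tt erefl tt erefl erefl erefl erefl.

(** * Pseudonatural transformations consisting of companions *)

Section Over.
Variables (B : bicat) (D : dblcat).

(* A pseudonatural transformation whose 1-cells are companions and whose 2-cells
   come from the 2-cells [oc] of a tight transformation. *)
Record over (F G : psfun B (Lb D)) (θ : psnat F G) := Over {
  om : forall X : B, @mark D (F X) (G X) (θ X);
  oc : forall (X Y : B) (f : hom X Y),
    @cell D (F X) (F Y) (G X) (G Y) (psf1 F f) (psf1 G f);
  oc_square : forall (X Y : B) (f : hom X Y),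
    @square D (F X) (F Y) (G X) (G Y) (θ X) (θ Y) (psf1 F f) (psf1 G f)
      (om X) (om Y) (oc f) (gcell (pn2 θ f))
}.

Section OverLemmas.
Variables (F G : psfun B (Lb D)).

(** An axiom of the tight structure enters twice: on objects, [E] provides the comparison [theta] of
    companions; on loose 1-cells, [E'] puts the two sides of naturality over the same 2-cell. *)
Definition imod_over (θ θ' : psnat F G) (P : over θ) (Q : over θ')
    (E : forall X, src (ce (om P X)) = src (ce (om Q X)))
    (E' : forall X Y (f : hom X Y), oc P f = oc Q f) : imod θ θ'.
Proof.
refine (@IMod _ _ _ _ θ θ' (fun X => theta (E X)) (fun X => theta (esym (E X)))
  (fun X => inverse2_ginverse (theta_inv _ _)) _).
move=> X Y f; apply: (square_uniq (c := om Q X) (d := om P Y) (φ := oc P f)).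
  exact: square_canonicall (theta_canonical _) (oc_square P f).
rewrite E'; exact: square_canonicalr (theta_canonical _) (oc_square Q f).
Defined.

Lemma imod_over_canonical (θ θ' : psnat F G) (P : over θ) (Q : over θ')
    (E : forall X, src (ce (om P X)) = src (ce (om Q X)))
    (E' : forall X Y (f : hom X Y), oc P f = oc Q f) (X : B) :
  canonical (om P X) (om Q X) (gcell (imod_over E E' X)).
Proof. exact: theta_canonical. Qed.

(** Apart from invertibility, which loose strength provides, pseudonaturality is reduced to the
    axioms of a tight transformation. *)
Lemma psnat_over (θ : psnat F G) (P : over θ) :
  (forall X Y (f : hom X Y), inverse2 (pn2 θ f) (pn2' θ f)) ->
  (forall X Y (f g : hom X Y) (α : two f g),
     gcell (psf2 G α) • oc P f = oc P g • gcell (psf2 F α)) ->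
  (forall X Y Z (f : hom X Y) (g : hom Y Z) (e : tgt (oc P f) = src (oc P g)),
     gcell (psfC G f g) • ocell e = oc P (comp1 g f) • gcell (psfC F f g)) ->
  (forall X, gcell (psfU G X) • Ucell (src (ce (om P X)))
     = oc P (id1 X) • gcell (psfU F X)) ->
  is_psnat θ.
Proof.
move=> Hinv Hnat Hcomp Hunit; split=> //.
- move=> X Y f f' α; apply: (square_uniq (c := om P X) (d := om P Y)).
    exact: square_post (oc_square P f).
  by rewrite Hnat; exact: square_pre (oc_square P f').
- move=> X Y Z f g; apply: (square_uniq (c := om P X) (d := om P Z)).
    exact: square_pre (oc_square P _).
  (* Both boundaries equal the tight 1-cell underlying the mark [om P Y]. *)
  have e : tgt (oc P f) = src (oc P g).
    by rewrite (oc_square P g).1; case: (oc_square P f) => _ [].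
  rewrite -(Hcomp _ _ _ _ _ e).
  have := square_post (psfC G f g) (square_hcomp e (oc_square P f) (oc_square P g)).
  by rewrite !ccmpA.
- move=> X; apply: (square_uniq (c := om P X) (d := om P X)).
    exact: square_pre (oc_square P _).
  rewrite -Hunit.
  have := square_post (psfU G X) (square_Ucell (om P X)).
  by rewrite !ccmpA.
Qed.

End OverLemmas.

Definition over_id (F : psfun B (Lb D)) : over (pn_id F).
Proof.
refine (@Over F F (pn_id F) (fun X => mark_id _) (fun X Y f => cid _) _) => X Y f.
exact: square_id.
Defined.

Definition over_comp (F G H : psfun B (Lb D)) (θ' : psnat G H) (θ : psnat F G)
    (P' : over θ') (P : over θ) : over (pn_comp θ' θ).
Proof.
refine (@Over F H (pn_comp θ' θ) (fun X => mark_comp (om P' X) (om P X))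
  (fun X Y f => oc P' f • oc P f) _) => X Y f.
exact: square_vcomp (oc_square P f) (oc_square P' f).
Defined.

End Over.

Section PsfunEq.
Variables (B C : bicat) (F : psfun B C).
Variable c : forall (X Y Z : B) (f : hom X Y) (g : hom Y Z),
  (psf1 F g ∘ psf1 F f ⇒ psf1 F (g ∘ f))%bicat.
Variable c' : forall (X Y Z : B) (f : hom X Y) (g : hom Y Z),
  (psf1 F (g ∘ f) ⇒ psf1 F g ∘ psf1 F f)%bicat.
Variable u : forall X : B, (id1 (F X) ⇒ psf1 F (id1 X))%bicat.
Variable u' : forall X : B, (psf1 F (id1 X) ⇒ id1 (F X))%bicat.

(** The constraint cells of a composite such as [psf_comp (Lf T) (Lprod D D)] carry the image of an
    identity cell. This lemma replaces them by the constraint cells of the double functor before the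
    axioms are verified. *)
Lemma psfun_eq :
  (forall X Y Z (f : hom X Y) (g : hom Y Z), psfC F f g = c f g) ->
  (forall X Y Z (f : hom X Y) (g : hom Y Z), psfC' F f g = c' f g) ->
  (forall X, psfU F X = u X) -> (forall X, psfU' F X = u' X) ->
  is_psfun (PsFun (@psf2 _ _ F) c c' u u') -> is_psfun F.
Proof.
move=> Ec Ec' Eu Eu' H; split.
- exact: (psf2_id H).
- exact: (psf2_comp H).
- by move=> X Y Z f g; rewrite Ec Ec'; apply: (psfC_inv H).
- by move=> X; rewrite Eu Eu'; apply: (psfU_inv H).
- by move=> X Y Z f f' g g' α β; rewrite !Ec; apply: (psfC_nat H).
- by move=> X Y Z W f g h; rewrite !Ec; apply: (psfC_assoc H).
- by move=> X Y f; rewrite Ec Eu; apply: (psfC_lunit H).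
- by move=> X Y f; rewrite Ec Eu; apply: (psfC_runit H).
Qed.
End PsfunEq.

(** * The tensor product of loose 1-cells *)

Section LooseTensor.
Variables (D : dblcat) (T : dfun (dprod D D) D) (HT : is_dfun T).
Let L := psf_comp (Lf T) (Lprod D D).

Lemma Ltensor_C (A B C : dprod D D) (M : loose A B) (N : loose B C) :
  psfC L M N = dfO T M N.
Proof. by apply: glob_eq => /=; rewrite -[RHS]ccmp1l -(dfc_id T). Qed.

Lemma Ltensor_C' (A B C : dprod D D) (M : loose A B) (N : loose B C) :
  psfC' L M N = dfO' T M N.
Proof. by apply: glob_eq => /=; rewrite -[RHS]ccmp1r -(dfc_id T). Qed.

Lemma Ltensor_U (A : dprod D D) : psfU L A = dfU T A.
Proof. by apply: glob_eq => /=; rewrite -[RHS]ccmp1l -(dfc_id T). Qed.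

Lemma Ltensor_U' (A : dprod D D) : psfU' L A = dfU' T A.
Proof. by apply: glob_eq => /=; rewrite -[RHS]ccmp1r -(dfc_id T). Qed.

Lemma Ltensor_psfun : is_psfun L.
Proof.
refine (@psfun_eq _ _ L _ _ _ _ Ltensor_C Ltensor_C' Ltensor_U Ltensor_U' _); split.
- by move=> X Y f; apply: glob_eq; apply: (dfc_id T).
- by move=> X Y f g h α β; apply: glob_eq;
  exact (@dfc_cmp (dprod D D) D T X Y X Y X Y f g h (gcell α.1, gcell α.2) (gcell β.1, gcell β.2)).
- by move=> X Y Z f g; apply: inverse2_ginverse; apply: (dfO_inv HT).
- by move=> X; apply: inverse2_ginverse; apply: (dfU_inv HT).
- move=> X Y Z f f' g g' α β; apply: glob_eq.
  have e1 : @tgt (dprod D D) X Y X Y f f' (gcell α.1, gcell α.2)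
      = @src (dprod D D) Y Z Y Z g g' (gcell β.1, gcell β.2).
    by congr pair; rewrite gtgt gsrc.
  have e2 : tgt (dfc T (gpair α.1 α.2)) = src (dfc T (gpair β.1 β.2)).
    by rewrite dfc_tgt dfc_src [tgt _]e1.
  have H := @dfO_nat (dprod D D) D T HT X Y Z X Y Z f g f' g'
    (gcell β.1, gcell β.2) (gcell α.1, gcell α.2) e1 e2.
  transitivity (dfO T f' g' • ocell e2).
    by rewrite /gcell /=; congr (_ • _); apply: ocell_eq.
  rewrite H /=; congr (_ • _); congr (dfc T _); congr pair; apply: ocell_eq => //.
- by move=> X Y Z W f g h; apply: glob_eq; apply: (dfO_assoc HT).
- by move=> X Y f; apply: glob_eq; apply: (dfO_lunit HT).
- by move=> X Y f; apply: glob_eq; apply: (dfO_runit HT).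
Qed.

End LooseTensor.

Section LooseUnit.
Variables (D : dblcat) (I : dfun dterm D) (HI : is_dfun I).
Let L := psf_comp (Lf I) Lone.

Lemma Lunit_C (X Y Z : bterm) (f : hom X Y) (g : hom Y Z) :
  psfC L f g = @dfO dterm D I tt tt tt tt tt.
Proof. by apply: glob_eq => /=; rewrite -[RHS]ccmp1l -(dfc_id I). Qed.

Lemma Lunit_C' (X Y Z : bterm) (f : hom X Y) (g : hom Y Z) :
  psfC' L f g = @dfO' dterm D I tt tt tt tt tt.
Proof. by apply: glob_eq => /=; rewrite -[RHS]ccmp1r -(dfc_id I). Qed.

Lemma Lunit_U (X : bterm) : psfU L X = @dfU dterm D I tt.
Proof. by apply: glob_eq => /=; rewrite -[RHS]ccmp1l -(dfc_id I). Qed.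

Lemma Lunit_U' (X : bterm) : psfU' L X = @dfU' dterm D I tt.
Proof. by apply: glob_eq => /=; rewrite -[RHS]ccmp1r -(dfc_id I). Qed.

Lemma Lunit_psfun : is_psfun L.
Proof.
refine (@psfun_eq _ _ L _ _ _ _ Lunit_C Lunit_C' Lunit_U Lunit_U' _); split.
- by move=> X Y f; apply: glob_eq; exact (@dfc_id dterm D I tt tt tt).
- move=> X Y f g h α β; apply: glob_eq.
  exact (@dfc_cmp dterm D I tt tt tt tt tt tt tt tt tt tt tt).
- by move=> X Y Z f g; apply: inverse2_ginverse; apply: (dfO_inv HI).
- by move=> X; apply: inverse2_ginverse; apply: (dfU_inv HI).
- move=> X Y Z f f' g g' α β; apply: glob_eq.
  exact (@dfO_nat dterm D I HI tt tt tt tt tt tt tt tt tt tt tt tt erefl _).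
- by move=> X Y Z W f g h; apply: glob_eq; apply: (dfO_assoc HI).
- by move=> X Y f; apply: glob_eq; apply: (@dfO_lunit dterm D I HI tt tt tt).
- by move=> X Y f; apply: glob_eq; apply: (@dfO_runit dterm D I HI tt tt tt).
Qed.

End LooseUnit.

Definition companion_thin (D : dblcat) : thin_sub (Lb D).
Proof.
refine (@ThinSub (Lb D) (fun A B M => @mark D A B M)
  (fun A B M N c d α => @canonical D A B M N c d (gcell α)) _ _
  (fun A => @mark_id D A) (fun A B C N M d c => mark_comp d c) _ _ _ _ _ _).
- by move=> A B M N c d α β; apply: canonical_uniq.
- by move=> A B M N c d α β /ginverse_inverse2; apply: canonical_inv.
- by move=> A B M c; apply: ccmp1r.
- by move=> A B M N P c d f β α; apply: canonical_vcomp.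
- by move=> A B C M M' N N' c c' d d' β α; apply: canonical_hcomp.
- by move=> A B C E M N P c d f; apply: canonical_assoc.
- by move=> A B M c; apply: canonical_lunit.
- by move=> A B M c; apply: canonical_runit.
Defined.

(** * Tensor products of companions, canonical cells and squares *)

Section LiftTensor.
Variables (D : dblcat) (T : dfun (dprod D D) D) (HT : is_dfun T).
Local Notation L := (psf_comp (Lf T) (Lprod D D)).
Local Notation S := (companion_thin D).

Definition mark_tensor (A A' C C' : D) (M : loose A A') (N : loose C C')
    (c : mark M) (d : mark N) : mark (dtenl T M N) :=
  mark_fun HT (@mark_pair D D (A, C) (A', C') (M, N) c d).

Lemma canonical_tensor (A A' C C' : D) (M M' : loose A A') (N N' : loose C C')
    (c : mark M) (c' : mark M') (d : mark N) (d' : mark N')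
    (α : cell M M') (β : cell N N') :
  canonical c c' α -> canonical d d' β ->
  canonical (mark_tensor c d) (mark_tensor c' d') (dtenc T α β).
Proof.
move=> cα cβ; apply: (@canonical_fun (dprod D D) D T HT (A, C) (A', C') (M, N) (M', N')).
exact: (f_equal2 pair cα cβ).
Qed.

Lemma canonical_tensor_comp (A A' A'' C C' C'' : D) (M : loose A A') (M' : loose A' A'')
    (N : loose C C') (N' : loose C' C'')
    (c : mark M) (c' : mark M') (d : mark N) (d' : mark N') :
  canonical (mark_comp (mark_tensor c' d') (mark_tensor c d))
    (mark_tensor (mark_comp c' c) (mark_comp d' d))
    (@dfO (dprod D D) D T (A, C) (A', C') (A'', C'') (M, N) (M', N')).
Proof.
have H := @canonical_dfO (dprod D D) D T HT (A, C) (A', C') (A'', C'') (M, N) (M', N')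
  (@mark_pair D D (A, C) (A', C') (M, N) c d)
  (@mark_pair D D (A', C') (A'', C'') (M', N') c' d').
(* [H] speaks of the composite of paired marks, the goal of the pair of composite marks; their
   counits agree. *)
refine (etrans _ H); rewrite /=; congr (_ • dfc T _ • _).
by symmetry; apply: (@ce_pair_comp D D (A, C) (A', C') (A'', C'') (M, N) (M', N')).
Qed.

Lemma canonical_tensor_id (A C : D) :
  canonical (mark_id (T (A, C))) (mark_tensor (mark_id A) (mark_id C))
    (@dfU (dprod D D) D T (A, C)).
Proof. exact: (@canonical_dfU (dprod D D) D T HT (A, C)). Qed.

Definition companion_tensor : lift_tensor S L.
Proof.
refine (@LiftTensor (Lb D) S L (fun A A' C C' M N c d => mark_tensor c d) _ _ _ _ _).
- by move=> A A' C C' M M' N N' c c' d d' α β; apply: canonical_tensor.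
- move=> A A' A'' C C' C'' M M' N N' c c' d d'.
  rewrite /tcomp Ltensor_C; exact: canonical_tensor_comp.
- move=> A A' A'' C C' C'' M M' N N' c c' d d'.
  rewrite /tcomp' Ltensor_C'; apply: canonical_inv (canonical_tensor_comp _ _ _ _).
  exact: (dfO_inv HT).
- move=> A C; rewrite /tunit Ltensor_U; exact: canonical_tensor_id.
- move=> A C; rewrite /tunit' Ltensor_U'; apply: canonical_inv (canonical_tensor_id _ _).
  exact: (dfU_inv HT).
Defined.

Lemma square_tensor (A B A' B' C E C' E' : D) (M : loose A A') (M' : loose B B')
    (P : loose A B) (Q : loose A' B') (N : loose C C') (N' : loose E E')
    (R : loose C E) (S' : loose C' E') (c : mark M) (d : mark M') (c' : mark N) (d' : mark N')
    (φ : cell P Q) (ψ : cell R S') (σ : cell (M' ⊙ P) (Q ⊙ M)) (τ : cell (N' ⊙ R) (S' ⊙ N)) :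
  square c d φ σ -> square c' d' ψ τ ->
  square (mark_tensor c c') (mark_tensor d d') (dtenc T φ ψ)
    (@dfO' (dprod D D) D T (A, C) (A', C') (B', E') (M, N) (Q, S') • dtenc T σ τ
     • @dfO (dprod D D) D T (A, C) (B, E) (B', E') (P, R) (M', N')).
Proof.
move=> H H'.
exact (@square_fun (dprod D D) D T HT (A, C) (B, E) (A', C') (B', E')
  (M, N) (M', N') (P, R) (Q, S') _ _ _ (σ, τ)
  (@square_pair D D (A, C) (B, E) (A', C') (B', E') (M, N) (M', N') (P, R) (Q, S')
    c c' d d' (φ, ψ) (σ, τ) H H')).
Qed.

Section OverTensor.
Variables (B : bicat) (F F' G G' : psfun B (Lb D)) (θ : psnat F F') (κ : psnat G G').
Variables (P : over θ) (Q : over κ).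

Lemma ten_pnE (X Y : B) (f : hom X Y) :
  gcell (pn2 (ten_pn L θ κ) f)
  = @dfO' (dprod D D) D T (F X, G X) (F' X, G' X) (F' Y, G' Y)
      (θ X, κ X) (psf1 F' f, psf1 G' f)
    • dtenc T (gcell (pn2 θ f)) (gcell (pn2 κ f))
    • @dfO (dprod D D) D T (F X, G X) (F Y, G Y) (F' Y, G' Y)
      (psf1 F f, psf1 G f) (θ Y, κ Y).
Proof.
have E' := @Ltensor_C' D T (F X, G X) (F' X, G' X) (F' Y, G' Y)
  (θ X, κ X) (psf1 F' f, psf1 G' f).
have E := @Ltensor_C D T (F X, G X) (F Y, G Y) (F' Y, G' Y)
  (psf1 F f, psf1 G f) (θ Y, κ Y).
exact (f_equal2 (fun x y : glob _ _ =>
  gcell x • dtenc T (gcell (pn2 θ f)) (gcell (pn2 κ f)) • gcell y) E' E).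
Qed.

Definition over_tensor : over (ten_pn L θ κ) :=
  @Over B D (ten L F G) (ten L F' G') (ten_pn L θ κ)
    (fun X => mark_tensor (om P X) (om Q X)) (fun X Y f => dtenc T (oc P f) (oc Q f))
    (fun X Y f => eq_ind_r (fun σ => square _ _ _ σ)
       (square_tensor (oc_square P f) (oc_square Q f)) (ten_pnE f)).

End OverTensor.
End LiftTensor.

Section TensorConstraints.
Variables (D : dblcat) (T : dfun (dprod D D) D) (B : bicat) (F G : psfun B (Lb D)).
Local Notation L := (psf_comp (Lf T) (Lprod D D)).

Lemma ten_C (X Y Z : B) (f : hom X Y) (g : hom Y Z) :
  gcell (psfC (ten L F G) f g)
  = dtenc T (gcell (psfC F f g)) (gcell (psfC G f g))
    • @dfO (dprod D D) D T (F X, G X) (F Y, G Y) (F Z, G Z)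
        (psf1 F f, psf1 G f) (psf1 F g, psf1 G g).
Proof.
have E := @Ltensor_C D T (F X, G X) (F Y, G Y) (F Z, G Z)
  (psf1 F f, psf1 G f) (psf1 F g, psf1 G g).
exact (f_equal (fun x : glob _ _ =>
  dtenc T (gcell (psfC F f g)) (gcell (psfC G f g)) • gcell x) E).
Qed.

Lemma ten_U (X : B) :
  gcell (psfU (ten L F G) X)
  = dtenc T (gcell (psfU F X)) (gcell (psfU G X)) • @dfU (dprod D D) D T (F X, G X).
Proof.
have E := @Ltensor_U D T (F X, G X).
exact (f_equal (fun x : glob _ _ =>
  dtenc T (gcell (psfU F X)) (gcell (psfU G X)) • gcell x) E).
Qed.

End TensorConstraints.

Section OverTensorRev.
Variables (D : dblcat) (T : dfun (dprod D D) D) (HT : is_dfun T).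
Local Notation L := (psf_comp (Lf T) (Lprod D D)).

Variables (B : bicat) (F F' G G' : psfun B (Lb D)) (θ : psnat F F') (κ : psnat G G').
Variables (P : over θ) (Q : over κ).

Lemma ten_pn_trevE (X Y : B) (f : hom X Y) :
  gcell (pn2 (ten_pn (trev L) θ κ) f)
  = @dfO' (dprod D D) D T (G X, F X) (G' X, F' X) (G' Y, F' Y)
      (κ X, θ X) (psf1 G' f, psf1 F' f)
    • dtenc T (gcell (pn2 κ f)) (gcell (pn2 θ f))
    • @dfO (dprod D D) D T (G X, F X) (G Y, F Y) (G' Y, F' Y)
      (psf1 G f, psf1 F f) (κ Y, θ Y).
Proof.
cbn.
(* Both [trev] and [Lprod] insert images under [T] of identities, located at these two
   composites. *)
have I := @dfc_id (dprod D D) D T (G X, F X) (G' Y, F' Y)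
  (psf1 G' f ⊙ κ X, psf1 F' f ⊙ θ X).
have J := @dfc_id (dprod D D) D T (G X, F X) (G' Y, F' Y)
  (κ Y ⊙ psf1 G f, θ Y ⊙ psf1 F f).
cbn in I, J.
rewrite !I !J !ccmp1r !ccmp1l.
reflexivity.
Qed.

Definition over_tensor_rev : over (ten_pn (trev L) θ κ) :=
  @Over B D (ten (trev L) F G) (ten (trev L) F' G') (ten_pn (trev L) θ κ)
    (fun X => mark_tensor HT (om Q X) (om P X)) (fun X Y f => dtenc T (oc Q f) (oc P f))
    (fun X Y f => eq_ind_r (fun σ => square _ _ _ σ)
       (square_tensor HT (oc_square Q f) (oc_square P f)) (ten_pn_trevE f)).

End OverTensorRev.

(** * Unit constraints of composite functors, and canonicity of naturality cells *)

Section UnitInverses.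
(** [dtc_counit] asks this of the source and the target of a constraint. Both are built from
    projections, identity, unit and tensor, under which the property is closed. *)
Definition unit_inv (D E : dblcat) (F : dfun D E) : Prop :=
  forall A, ginverse (dfU F A) (dfU' F A).

Lemma unit_inv_comp (D E H : dblcat) (G : dfun E H) (F : dfun D E) :
  unit_inv G -> unit_inv F -> unit_inv (df_comp G F).
Proof.
move=> HG HF A; split; rewrite /= /gcell /= -/gcell.
  rewrite -ccmpA (ccmpA (dfU G (F A))) -dfc_cmp (HF A).1 dfc_id ccmp1l.
  exact: (HG _).1.
rewrite -ccmpA (ccmpA (dfc G (dfU' F A))) (HG _).2 ccmp1l -dfc_cmp (HF A).2.
exact: dfc_id.
Qed.

Lemma unit_inv_pair (D E H : dblcat) (F : dfun D E) (G : dfun D H) :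
  unit_inv F -> unit_inv G -> unit_inv (df_pair F G).
Proof.
move=> HF HG A; split.
  exact: (f_equal2 pair (HF A).1 (HG A).1).
exact: (f_equal2 pair (HF A).2 (HG A).2).
Qed.

Lemma unit_inv_fst (D E : dblcat) : unit_inv (df_fst D E).
Proof. by move=> A; split; apply: ccmp1l. Qed.
Lemma unit_inv_snd (D E : dblcat) : unit_inv (df_snd D E).
Proof. by move=> A; split; apply: ccmp1l. Qed.
Lemma unit_inv_id (D : dblcat) : unit_inv (df_id D).
Proof. by move=> A; split; apply: ccmp1l. Qed.
Lemma unit_inv_bang (D : dblcat) : unit_inv (df_bang D).
Proof. by []. Qed.
End UnitInverses.

(** [square_mark] applied to [hat_square], with [dtc_counit] as intertwining condition. The marks
    [p] and [q] are constrained only through their counits: in the applications they are iterated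
    [mark_tensor]s, not [mark_fun] of the composite functor. *)
Lemma canonical_hat (E D : dblcat) (F G : dfun E D) (α : dtrans F G)
    (c : forall A, companion (α A)) (A B : E) (M : loose A B)
    (p : mark (dfl F M)) (q : mark (dfl G M)) (ε : cell M (U B)) :
  unit_inv F -> unit_inv G ->
  ce p = dfU' F B • dfc F ε -> ce q = dfU' G B • dfc G ε ->
  canonical (mark_comp (mark_companion (c B)) p) (mark_comp q (mark_companion (c A)))
    (hat c M).
Proof.
move=> HF HG Ep Eq; apply: square_mark (hat_square c M).
by rewrite /= ceps_src Ep Eq; apply: dtc_counit.
Qed.

Lemma unit_inv_dten (X D : dblcat) (T : dfun (dprod D D) D) (F G : dfun X D) :
  is_dfun T -> unit_inv F -> unit_inv G -> unit_inv (dten T F G).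
Proof. by move=> HT HF HG; apply: unit_inv_comp (dfU_inv HT) (unit_inv_pair HF HG). Qed.

Lemma dten_O (X D : dblcat) (T : dfun (dprod D D) D) (F G : dfun X D) (A B C : X)
    (M : loose A B) (N : loose B C) :
  gcell (dfO (dten T F G) M N)
  = dtenc T (gcell (dfO F M N)) (gcell (dfO G M N))
    • @dfO (dprod D D) D T (F A, G A) (F B, G B) (F C, G C)
        (dfl F M, dfl G M) (dfl F N, dfl G N).
Proof.
unfold dten, df_comp, gcmp, gcell, mkglob; cbn [dfO proj1_sig].
reflexivity.
Qed.

Lemma dten_U (X D : dblcat) (T : dfun (dprod D D) D) (F G : dfun X D) (A : X) :
  gcell (dfU (dten T F G) A)
  = dtenc T (gcell (dfU F A)) (gcell (dfU G A)) • @dfU (dprod D D) D T (F A, G A).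
Proof.
unfold dten, df_comp, gcmp, gcell, mkglob; cbn [dfU proj1_sig].
reflexivity.
Qed.

(** * Pseudonaturality of the companion constraints *)

Section Constraints.
Variable D : monoidal_dbl.
Local Notation T := (mdT D).
Local Notation K := (Lb D).
Local Notation L := (LT D).
Local Notation I := (LU D).

(** The pseudofunctors built from [LT] and the loose parts of the double functors built from [T]
    have the same 1-cells by conversion, but their constraint cells differ by images of identities
    from [Lprod]. Identifying them here and in the following lemmas makes [dtc_odot] and [dtc_U]
    applicable. *)
Lemma ten_p3_C (X Y Z : B3 K) (f : hom X Y) (g : hom Y Z) :
  gcell (psfC (ten L p31 p32) f g)
  = gcell (@dfO (D3 D) D (dten T (d31 D) (d32 D)) X Y Z f g).
Proof.
by rewrite (@ten_C D T (B3 K) p31 p32) (@dten_O (D3 D) D T (d31 D) (d32 D)).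
Qed.

Lemma ten_p3_U (X : B3 K) :
  gcell (psfU (ten L p31 p32) X)
  = gcell (@dfU (D3 D) D (dten T (d31 D) (d32 D)) X).
Proof.
by rewrite (@ten_U D T (B3 K) p31 p32) (@dten_U (D3 D) D T (d31 D) (d32 D)).
Qed.

Lemma ten_p3_C2 (X Y Z : B3 K) (f : hom X Y) (g : hom Y Z) :
  gcell (psfC (ten L p32 p33) f g)
  = gcell (@dfO (D3 D) D (dten T (d32 D) (d33 D)) X Y Z f g).
Proof.
by rewrite (@ten_C D T (B3 K) p32 p33) (@dten_O (D3 D) D T (d32 D) (d33 D)).
Qed.

Lemma ten_p3_U2 (X : B3 K) :
  gcell (psfU (ten L p32 p33) X)
  = gcell (@dfU (D3 D) D (dten T (d32 D) (d33 D)) X).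
Proof.
by rewrite (@ten_U D T (B3 K) p32 p33) (@dten_U (D3 D) D T (d32 D) (d33 D)).
Qed.

Lemma assoc_src_C (X Y Z : B3 K) (f : hom X Y) (g : hom Y Z) :
  gcell (psfC (ten L (ten L p31 p32) p33) f g)
  = gcell (@dfO (D3 D) D (dten T (dten T (d31 D) (d32 D)) (d33 D)) X Y Z f g).
Proof.
rewrite (@ten_C D T (B3 K) (ten L p31 p32) p33) ten_p3_C.
by rewrite (@dten_O (D3 D) D T (dten T (d31 D) (d32 D)) (d33 D)).
Qed.

Lemma assoc_src_U (X : B3 K) :
  gcell (psfU (ten L (ten L p31 p32) p33) X)
  = gcell (@dfU (D3 D) D (dten T (dten T (d31 D) (d32 D)) (d33 D)) X).
Proof.
rewrite (@ten_U D T (B3 K) (ten L p31 p32) p33) ten_p3_U.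
by rewrite (@dten_U (D3 D) D T (dten T (d31 D) (d32 D)) (d33 D)).
Qed.

Lemma assoc_tgt_C (X Y Z : B3 K) (f : hom X Y) (g : hom Y Z) :
  gcell (psfC (ten L p31 (ten L p32 p33)) f g)
  = gcell (@dfO (D3 D) D (dten T (d31 D) (dten T (d32 D) (d33 D))) X Y Z f g).
Proof.
rewrite (@ten_C D T (B3 K) p31 (ten L p32 p33)) ten_p3_C2.
by rewrite (@dten_O (D3 D) D T (d31 D) (dten T (d32 D) (d33 D))).
Qed.

Lemma assoc_tgt_U (X : B3 K) :
  gcell (psfU (ten L p31 (ten L p32 p33)) X)
  = gcell (@dfU (D3 D) D (dten T (d31 D) (dten T (d32 D) (d33 D))) X).
Proof.
rewrite (@ten_U D T (B3 K) p31 (ten L p32 p33)) ten_p3_U2.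
by rewrite (@dten_U (D3 D) D T (d31 D) (dten T (d32 D) (d33 D))).
Qed.

Lemma braid_src_C (X Y Z : B2 K) (f : hom X Y) (g : hom Y Z) :
  gcell (psfC (ten L p21 p22) f g)
  = gcell (@dfO (D2 D) D (dten T (d21 D) (d22 D)) X Y Z f g).
Proof. by rewrite (@ten_C D T (B2 K) p21 p22) (@dten_O (D2 D) D T (d21 D) (d22 D)). Qed.

Lemma braid_src_U (X : B2 K) :
  gcell (psfU (ten L p21 p22) X)
  = gcell (@dfU (D2 D) D (dten T (d21 D) (d22 D)) X).
Proof. by rewrite (@ten_U D T (B2 K) p21 p22) (@dten_U (D2 D) D T (d21 D) (d22 D)). Qed.

Lemma braid_tgt_C (X Y Z : B2 K) (f : hom X Y) (g : hom Y Z) :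
  gcell (psfC (ten L p22 p21) f g)
  = gcell (@dfO (D2 D) D (dten T (d22 D) (d21 D)) X Y Z f g).
Proof. by rewrite (@ten_C D T (B2 K) p22 p21) (@dten_O (D2 D) D T (d22 D) (d21 D)). Qed.

Lemma braid_tgt_U (X : B2 K) :
  gcell (psfU (ten L p22 p21) X)
  = gcell (@dfU (D2 D) D (dten T (d22 D) (d21 D)) X).
Proof. by rewrite (@ten_U D T (B2 K) p22 p21) (@dten_U (D2 D) D T (d22 D) (d21 D)). Qed.

Lemma unit_at_C (X Y Z : K) (f : hom X Y) (g : hom Y Z) :
  gcell (psfC (unit_at I K) f g) = gcell (@dfO D D (dunit_at (mdI D) D) X Y Z f g).
Proof.
have E := @Lunit_C D (mdI D) tt tt tt tt tt.
exact (f_equal (fun x : glob _ _ => dfc (mdI D) (gcell (@gtt tt tt tt tt)) • gcell x) E).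
Qed.

Lemma unit_at_U (X : K) :
  gcell (psfU (unit_at I K) X) = gcell (@dfU D D (dunit_at (mdI D) D) X).
Proof.
have E := @Lunit_U D (mdI D) tt.
exact (f_equal (fun x : glob _ _ => dfc (mdI D) (gcell (@gtt tt tt tt tt)) • gcell x) E).
Qed.

Lemma lunit_src_C (X Y Z : K) (f : hom X Y) (g : hom Y Z) :
  gcell (psfC (ten L (unit_at I K) (psf_id K)) f g)
  = gcell (@dfO D D (dten T (dunit_at (mdI D) D) (df_id D)) X Y Z f g).
Proof.
rewrite (@ten_C D T K (unit_at I K) (psf_id K)) unit_at_C.
by rewrite (@dten_O D D T (dunit_at (mdI D) D) (df_id D)).
Qed.

Lemma lunit_src_U (X : K) :
  gcell (psfU (ten L (unit_at I K) (psf_id K)) X)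
  = gcell (@dfU D D (dten T (dunit_at (mdI D) D) (df_id D)) X).
Proof.
rewrite (@ten_U D T K (unit_at I K) (psf_id K)) unit_at_U.
by rewrite (@dten_U D D T (dunit_at (mdI D) D) (df_id D)).
Qed.

Lemma runit_src_C (X Y Z : K) (f : hom X Y) (g : hom Y Z) :
  gcell (psfC (ten L (psf_id K) (unit_at I K)) f g)
  = gcell (@dfO D D (dten T (df_id D) (dunit_at (mdI D) D)) X Y Z f g).
Proof.
rewrite (@ten_C D T K (psf_id K) (unit_at I K)) unit_at_C.
by rewrite (@dten_O D D T (df_id D) (dunit_at (mdI D) D)).
Qed.

Lemma runit_src_U (X : K) :
  gcell (psfU (ten L (psf_id K) (unit_at I K)) X)
  = gcell (@dfU D D (dten T (df_id D) (dunit_at (mdI D) D)) X).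
Proof.
rewrite (@ten_U D T K (psf_id K) (unit_at I K)) unit_at_U.
by rewrite (@dten_U D D T (df_id D) (dunit_at (mdI D) D)).
Qed.

Section Structure.
Variable c : constraint_companions D.

Definition over_α : over (Lα c) :=
  @Over (B3 K) D _ _ (Lα c) (fun X => mark_companion (ccα c X))
    (fun X Y f => @dtc (D3 D) D _ _ (mdα D) X Y f)
    (fun X Y f => @hat_square D (D3 D) _ _ (mdα D) (ccα c) X Y f).

(** Invertibility is loose strength ([sc_invP]); the other three conditions are [dtc_nat],
    [dtc_odot] and [dtc_U] for the tight associator. The remaining constraints follow the same
    scheme. *)
Lemma psnat_α : is_psnat (Lα c).
Proof.
apply: (@psnat_over (B3 K) D _ _ (Lα c) over_α).
- by move=> X Y f; exact (inverse2_ginverse (@sc_invP (D3 D) D _ _ (mdα D) (ccα c) X Y f)).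
- by move=> X Y f g α;
  exact (@dtc_nat (D3 D) D _ _ (mdα D) X Y X Y f g ((gcell α.1.1, gcell α.1.2), gcell α.2)).
- move=> X Y Z f g e; have H := @dtc_odot (D3 D) D _ _ (mdα D) X Y Z f g e.
  by rewrite assoc_src_C assoc_tgt_C; exact H.
- move=> X; have H := @dtc_U (D3 D) D _ _ (mdα D) X.
  have s : src (ce (om over_α X)) = mdα D X := ceps_src (ccα c X).
  by rewrite assoc_src_U assoc_tgt_U s; exact H.
Qed.

Definition over_αv : over (Lαv c) :=
  @Over (B3 K) D _ _ (Lαv c) (fun X => mark_companion (ccαv c X))
    (fun X Y f => @dtc (D3 D) D _ _ (mdαv D) X Y f)
    (fun X Y f => @hat_square D (D3 D) _ _ (mdαv D) (ccαv c) X Y f).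

Lemma psnat_αv : is_psnat (Lαv c).
Proof.
apply: (@psnat_over (B3 K) D _ _ (Lαv c) over_αv).
- by move=> X Y f; exact (inverse2_ginverse (@sc_invP (D3 D) D _ _ (mdαv D) (ccαv c) X Y f)).
- by move=> X Y f g α;
  exact (@dtc_nat (D3 D) D _ _ (mdαv D) X Y X Y f g ((gcell α.1.1, gcell α.1.2), gcell α.2)).
- move=> X Y Z f g e; have H := @dtc_odot (D3 D) D _ _ (mdαv D) X Y Z f g e.
  by rewrite assoc_tgt_C assoc_src_C; exact H.
- move=> X; have H := @dtc_U (D3 D) D _ _ (mdαv D) X.
  have s : src (ce (om over_αv X)) = mdαv D X := ceps_src (ccαv c X).
  by rewrite assoc_tgt_U assoc_src_U s; exact H.
Qed.

Definition over_λ : over (Lλ c) :=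
  @Over (K) D _ _ (Lλ c) (fun X => mark_companion (ccλ c X))
    (fun X Y f => @dtc (D) D _ _ (mdλ D) X Y f)
    (fun X Y f => @hat_square D (D) _ _ (mdλ D) (ccλ c) X Y f).

Lemma psnat_λ : is_psnat (Lλ c).
Proof.
apply: (@psnat_over (K) D _ _ (Lλ c) over_λ).
- by move=> X Y f; exact (inverse2_ginverse (@sc_invP (D) D _ _ (mdλ D) (ccλ c) X Y f)).
- by move=> X Y f g α; exact (@dtc_nat (D) D _ _ (mdλ D) X Y X Y f g (gcell α)).
- move=> X Y Z f g e; have H := @dtc_odot (D) D _ _ (mdλ D) X Y Z f g e.
  by rewrite lunit_src_C; exact H.
- move=> X; have H := @dtc_U (D) D _ _ (mdλ D) X.
  have s : src (ce (om over_λ X)) = mdλ D X := ceps_src (ccλ c X).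
  by rewrite lunit_src_U s; exact H.
Qed.

Definition over_λv : over (Lλv c) :=
  @Over (K) D _ _ (Lλv c) (fun X => mark_companion (ccλv c X))
    (fun X Y f => @dtc (D) D _ _ (mdλv D) X Y f)
    (fun X Y f => @hat_square D (D) _ _ (mdλv D) (ccλv c) X Y f).

Lemma psnat_λv : is_psnat (Lλv c).
Proof.
apply: (@psnat_over (K) D _ _ (Lλv c) over_λv).
- by move=> X Y f; exact (inverse2_ginverse (@sc_invP (D) D _ _ (mdλv D) (ccλv c) X Y f)).
- by move=> X Y f g α; exact (@dtc_nat (D) D _ _ (mdλv D) X Y X Y f g (gcell α)).
- move=> X Y Z f g e; have H := @dtc_odot (D) D _ _ (mdλv D) X Y Z f g e.
  by rewrite lunit_src_C; exact H.
- move=> X; have H := @dtc_U (D) D _ _ (mdλv D) X.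
  have s : src (ce (om over_λv X)) = mdλv D X := ceps_src (ccλv c X).
  by rewrite lunit_src_U s; exact H.
Qed.

Definition over_ρ : over (Lρ c) :=
  @Over (K) D _ _ (Lρ c) (fun X => mark_companion (ccρ c X))
    (fun X Y f => @dtc (D) D _ _ (mdρ D) X Y f)
    (fun X Y f => @hat_square D (D) _ _ (mdρ D) (ccρ c) X Y f).

Lemma psnat_ρ : is_psnat (Lρ c).
Proof.
apply: (@psnat_over (K) D _ _ (Lρ c) over_ρ).
- by move=> X Y f; exact (inverse2_ginverse (@sc_invP (D) D _ _ (mdρ D) (ccρ c) X Y f)).
- by move=> X Y f g α; exact (@dtc_nat (D) D _ _ (mdρ D) X Y X Y f g (gcell α)).
- move=> X Y Z f g e; have H := @dtc_odot (D) D _ _ (mdρ D) X Y Z f g e.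
  by rewrite runit_src_C; exact H.
- move=> X; have H := @dtc_U (D) D _ _ (mdρ D) X.
  have s : src (ce (om over_ρ X)) = mdρ D X := ceps_src (ccρ c X).
  by rewrite runit_src_U s; exact H.
Qed.

Definition over_ρv : over (Lρv c) :=
  @Over (K) D _ _ (Lρv c) (fun X => mark_companion (ccρv c X))
    (fun X Y f => @dtc (D) D _ _ (mdρv D) X Y f)
    (fun X Y f => @hat_square D (D) _ _ (mdρv D) (ccρv c) X Y f).

Lemma psnat_ρv : is_psnat (Lρv c).
Proof.
apply: (@psnat_over (K) D _ _ (Lρv c) over_ρv).
- by move=> X Y f; exact (inverse2_ginverse (@sc_invP (D) D _ _ (mdρv D) (ccρv c) X Y f)).
- by move=> X Y f g α; exact (@dtc_nat (D) D _ _ (mdρv D) X Y X Y f g (gcell α)).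
- move=> X Y Z f g e; have H := @dtc_odot (D) D _ _ (mdρv D) X Y Z f g e.
  by rewrite runit_src_C; exact H.
- move=> X; have H := @dtc_U (D) D _ _ (mdρv D) X.
  have s : src (ce (om over_ρv X)) = mdρv D X := ceps_src (ccρv c X).
  by rewrite runit_src_U s; exact H.
Qed.

End Structure.
End Constraints.

Section BraidConstraints.
Variables (D : braided_dbl) (c : braid_companions D).
Local Notation K := (Lb D).

Definition over_β : over (Lβ c) :=
  @Over (B2 K) D _ _ (Lβ c) (fun X => mark_companion (ccβ c X))
    (fun X Y f => @dtc (D2 D) D _ _ (bdβ D) X Y f)
    (fun X Y f => @hat_square D (D2 D) _ _ (bdβ D) (ccβ c) X Y f).

Lemma psnat_β : is_psnat (Lβ c).
Proof.
apply: (@psnat_over (B2 K) D _ _ (Lβ c) over_β).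
- by move=> X Y f; exact (inverse2_ginverse (@sc_invP (D2 D) D _ _ (bdβ D) (ccβ c) X Y f)).
- by move=> X Y f g α; exact (@dtc_nat (D2 D) D _ _ (bdβ D) X Y X Y f g (gcell α.1, gcell α.2)).
- move=> X Y Z f g e; have H := @dtc_odot (D2 D) D _ _ (bdβ D) X Y Z f g e.
  by rewrite braid_src_C braid_tgt_C; exact H.
- move=> X; have H := @dtc_U (D2 D) D _ _ (bdβ D) X.
  have s : src (ce (om over_β X)) = bdβ D X := ceps_src (ccβ c X).
  by rewrite braid_src_U braid_tgt_U s; exact H.
Qed.

Definition over_βv : over (Lβv c) :=
  @Over (B2 K) D _ _ (Lβv c) (fun X => mark_companion (ccβv c X))
    (fun X Y f => @dtc (D2 D) D _ _ (bdβv D) X Y f)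
    (fun X Y f => @hat_square D (D2 D) _ _ (bdβv D) (ccβv c) X Y f).

Lemma psnat_βv : is_psnat (Lβv c).
Proof.
apply: (@psnat_over (B2 K) D _ _ (Lβv c) over_βv).
- by move=> X Y f; exact (inverse2_ginverse (@sc_invP (D2 D) D _ _ (bdβv D) (ccβv c) X Y f)).
- by move=> X Y f g α; exact (@dtc_nat (D2 D) D _ _ (bdβv D) X Y X Y f g (gcell α.1, gcell α.2)).
- move=> X Y Z f g e; have H := @dtc_odot (D2 D) D _ _ (bdβv D) X Y Z f g e.
  by rewrite braid_tgt_C braid_src_C; exact H.
- move=> X; have H := @dtc_U (D2 D) D _ _ (bdβv D) X.
  have s : src (ce (om over_βv X)) = bdβv D X := ceps_src (ccβv c X).
  by rewrite braid_tgt_U braid_src_U s; exact H.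
Qed.

End BraidConstraints.

Section TensorCells.
Variables (D : dblcat) (T : dfun (dprod D D) D).

Lemma dtenc_cmp (A A' B B' C C' E E' G G' H H' : D) (M : loose A A') (N : loose B B')
    (P : loose C C') (M' : loose E E') (N' : loose G G') (P' : loose H H')
    (α : cell M N) (β : cell N P) (α' : cell M' N') (β' : cell N' P') :
  dtenc T (β • α) (β' • α') = dtenc T β β' • dtenc T α α'.
Proof.
exact (@dfc_cmp (dprod D D) D T (A, E) (A', E') (B, G) (B', G') (C, H) (C', H')
  (M, M') (N, N') (P, P') (α, α') (β, β')).
Qed.

Lemma dtenc_id (A A' B B' : D) (M : loose A A') (N : loose B B') :
  dtenc T (cid M) (cid N) = cid (dtenl T M N).
Proof. exact (@dfc_id (dprod D D) D T (A, B) (A', B') (M, N)). Qed.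

Lemma dtenc_src (A A' B B' C C' E E' : D) (M : loose A A') (N : loose B B')
    (P : loose C C') (Q : loose E E') (α : cell M N) (β : cell P Q) :
  src (dtenc T α β) = dten1 T (src α) (src β).
Proof.
exact (@dfc_src (dprod D D) D T (A, C) (A', C') (B, E) (B', E') (M, P) (N, Q) (α, β)).
Qed.
End TensorCells.

(** * Unit coherence *)

Section Kelly.
Variable D : monoidal_dbl.
Local Notation T := (mdT D).
Local Notation J := (@dfl dterm D (mdI D) tt tt tt).

(** These are the constraints of the monoidal category of loose 1-cells and 2-cells. Its unit object
    is [J], the loose 1-cell picked out by [mdI], which is isomorphic to the loose unit on
    [mdI D tt] but in general distinct from it. *)
Definition assoc1 (A A' B B' C C' : D) (M : loose A A') (N : loose B B') (P : loose C C') :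
    cell (dtenl T (dtenl T M N) P) (dtenl T M (dtenl T N P)) :=
  dtc (mdα D) ((M, N, P) : @loose (D3 D) (A, B, C) (A', B', C')).

Definition assocv1 (A A' B B' C C' : D) (M : loose A A') (N : loose B B') (P : loose C C') :
    cell (dtenl T M (dtenl T N P)) (dtenl T (dtenl T M N) P) :=
  dtc (mdαv D) ((M, N, P) : @loose (D3 D) (A, B, C) (A', B', C')).

Definition lunit1 (A A' : D) (M : loose A A') : cell (dtenl T J M) M := dtc (mdλ D) M.
Definition lunitv1 (A A' : D) (M : loose A A') : cell M (dtenl T J M) := dtc (mdλv D) M.
Definition runit1 (A A' : D) (M : loose A A') : cell (dtenl T M J) M := dtc (mdρ D) M.
Definition runitv1 (A A' : D) (M : loose A A') : cell M (dtenl T M J) := dtc (mdρv D) M.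

Lemma assoc1_src (A A' B B' C C' : D) (M : loose A A') (N : loose B B') (P : loose C C') :
  src (assoc1 M N P) = mdα D ((A, B, C) : D3 D).
Proof. exact (@dtc_src (D3 D) D _ _ (mdα D) (A, B, C) (A', B', C') (M, N, P)). Qed.

Lemma lunit1_src (A A' : D) (M : loose A A') : src (lunit1 M) = mdλ D A.
Proof. exact (@dtc_src D D _ _ (mdλ D) A A' M). Qed.

Lemma runit1_src (A A' : D) (M : loose A A') : src (runit1 M) = mdρ D A.
Proof. exact (@dtc_src D D _ _ (mdρ D) A A' M). Qed.

Lemma assoc1K (A A' B B' C C' : D) (M : loose A A') (N : loose B B') (P : loose C C') :
  assocv1 M N P • assoc1 M N P = cid _ /\ assoc1 M N P • assocv1 M N P = cid _.
Proof. exact ((mdα_inv D).2 (A, B, C) (A', B', C') (M, N, P)). Qed.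

Lemma lunit1K (A A' : D) (M : loose A A') : lunit1 M • lunitv1 M = cid M.
Proof. exact ((mdλ_inv D).2 A A' M).2. Qed.

Lemma runit1K (A A' : D) (M : loose A A') : runit1 M • runitv1 M = cid M.
Proof. exact ((mdρ_inv D).2 A A' M).2. Qed.

Lemma assoc1_nat (A A' B B' C C' E E' G G' H H' : D)
    (M : loose A A') (N : loose B B') (P : loose C C')
    (M' : loose E E') (N' : loose G G') (P' : loose H H')
    (α : cell M M') (β : cell N N') (γ : cell P P') :
  dtenc T α (dtenc T β γ) • assoc1 M N P = assoc1 M' N' P' • dtenc T (dtenc T α β) γ.
Proof.
exact (@dtc_nat (D3 D) D _ _ (mdα D) (A, B, C) (A', B', C') (E, G, H) (E', G', H')
  (M, N, P) (M', N', P') (α, β, γ)).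
Qed.

Lemma lunit1_nat (A A' B B' : D) (M : loose A A') (N : loose B B') (α : cell M N) :
  α • lunit1 M = lunit1 N • dtenc T (cid J) α.
Proof.
have H := @dtc_nat D D _ _ (mdλ D) A A' B B' M N α.
have I := @dfc_id dterm D (mdI D) tt tt tt.
by rewrite -[cid J]I; exact H.
Qed.

Lemma runit1_nat (A A' B B' : D) (M : loose A A') (N : loose B B') (α : cell M N) :
  α • runit1 M = runit1 N • dtenc T α (cid J).
Proof.
have H := @dtc_nat D D _ _ (mdρ D) A A' B B' M N α.
have I := @dfc_id dterm D (mdI D) tt tt tt.
by rewrite -[cid J]I; exact H.
Qed.

(** Tensoring with the unit object is faithful, being naturally isomorphic to the identity through
    [lunit1]. *)
Lemma dtenc_Jinjl (A A' B B' : D) (M : loose A A') (N : loose B B') (α β : cell M N) :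
  dtenc T (cid J) α = dtenc T (cid J) β -> α = β.
Proof.
move=> H; rewrite -(ccmp1r α) -(ccmp1r β) -lunit1K !ccmpA.
by rewrite !lunit1_nat H.
Qed.

Lemma dtenc_Jinjr (A A' B B' : D) (M : loose A A') (N : loose B B') (α β : cell M N) :
  dtenc T α (cid J) = dtenc T β (cid J) -> α = β.
Proof.
move=> H; rewrite -(ccmp1r α) -(ccmp1r β) -runit1K !ccmpA.
by rewrite !runit1_nat H.
Qed.

Lemma assoc1_injr (A A' B B' C C' E E' : D) (M : loose A A') (N : loose B B')
    (P : loose C C') (Q : loose E E') (α β : cell (dtenl T M (dtenl T N P)) Q) :
  α • assoc1 M N P = β • assoc1 M N P -> α = β.
Proof.
move=> H; rewrite -(ccmp1r α) -(ccmp1r β) -(assoc1K M N P).2 !ccmpA.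
rewrite H; reflexivity.
Qed.

Lemma assoc1_injl (A A' B B' C C' E E' : D) (M : loose A A') (N : loose B B')
    (P : loose C C') (Q : loose E E') (α β : cell Q (dtenl T (dtenl T M N) P)) :
  assoc1 M N P • α = assoc1 M N P • β -> α = β.
Proof.
move=> H; rewrite -(ccmp1l α) -(ccmp1l β) -(assoc1K M N P).1 -!ccmpA.
rewrite H; reflexivity.
Qed.

Lemma assoc1_tensor_injr (A A' B B' C C' E E' F F' : D) (M : loose A A') (N : loose B B')
    (P : loose C C') (R : loose F F') (Q : loose E E')
    (α β : cell (dtenl T (dtenl T M (dtenl T N P)) R) Q) :
  α • dtenc T (assoc1 M N P) (cid R) = β • dtenc T (assoc1 M N P) (cid R) -> α = β.
Proof.
move=> H; rewrite -(ccmp1r α) -(ccmp1r β) -dtenc_id -(assoc1K M N P).2.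
rewrite -(ccmp1l (cid R)) dtenc_cmp !ccmpA H; reflexivity.
Qed.

Lemma pentagon1 (A B C E A' B' C' E' : D)
    (M : loose A A') (N : loose B B') (P : loose C C') (Q : loose E E') :
  dtenc T (cid M) (assoc1 N P Q) • assoc1 M (dtenl T N P) Q • dtenc T (assoc1 M N P) (cid Q)
  = assoc1 M N (dtenl T P Q) • assoc1 (dtenl T M N) P Q.
Proof. exact: md_pentagon1. Qed.

Lemma triangle1 (A B A' B' : D) (M : loose A A') (N : loose B B') :
  dtenc T (cid M) (lunit1 N) • assoc1 M J N = dtenc T (runit1 M) (cid N).
Proof. exact: md_triangle1. Qed.

(** Kelly's argument: tensoring with [J] on the left is faithful and associators are invertible, so
    the equation may be compared along the pentagon at [J], [J], [M], [N], where the triangle and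
    naturality of the associator conclude. *)
Lemma lunit1_assoc1 (A B A' B' : D) (M : loose A A') (N : loose B B') :
  lunit1 (dtenl T M N) • assoc1 J M N = dtenc T (lunit1 M) (cid N).
Proof.
apply: dtenc_Jinjl; apply: (assoc1_injr (M := J) (N := dtenl T J M) (P := N)).
apply: (assoc1_tensor_injr (M := J) (N := J) (P := M) (R := N)).
rewrite -[X in dtenc T X _](ccmp1l (cid J)) dtenc_cmp -!ccmpA (ccmpA (dtenc T (assoc1 J J M) _)).
rewrite pentagon1 ccmpA triangle1 -dtenc_id assoc1_nat -triangle1.
by rewrite [RHS]ccmpA assoc1_nat -[RHS]ccmpA -dtenc_cmp ccmp1l.
Qed.

(** The mirror image, with [J] tensored on the right and the pentagon at [M], [N], [J], [J]. *)
Lemma runit1_assoc1 (A B A' B' : D) (M : loose A A') (N : loose B B') :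
  dtenc T (cid M) (runit1 N) • assoc1 M N J = runit1 (dtenl T M N).
Proof.
apply: dtenc_Jinjr; apply: (assoc1_injl (M := M) (N := N) (P := J)).
have E : dtenc T (dtenc T (cid M) (runit1 N) • assoc1 M N J) (cid J)
    = dtenc T (dtenc T (cid M) (runit1 N)) (cid J) • dtenc T (assoc1 M N J) (cid J).
  by rewrite -dtenc_cmp ccmp1l.
rewrite E ccmpA -assoc1_nat -triangle1.
have E' : dtenc T (cid M) (dtenc T (cid N) (lunit1 J) • assoc1 N J J)
    = dtenc T (cid M) (dtenc T (cid N) (lunit1 J)) • dtenc T (cid M) (assoc1 N J J).
  by rewrite -dtenc_cmp ccmp1l.
rewrite E' -[LHS]ccmpA -[LHS]ccmpA (ccmpA (dtenc T (assoc1 M N J) _)) pentagon1.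
rewrite ccmpA assoc1_nat dtenc_id -ccmpA triangle1; reflexivity.
Qed.

(** The source functor carries the equation between 2-cells to the one between tight 1-cells; every
    object is the source of its loose unit. *)
Lemma lunit0_assoc0 (A B : D) :
  mdλ D (T (A, B)) ∘ₜ mdα D ((mdI D tt, A, B) : D3 D) = dten1 T (mdλ D A) (tid B).
Proof.
have H := f_equal (fun x => src x) (lunit1_assoc1 (U A) (U B)).
by rewrite src_cmp dtenc_src src_id !lunit1_src assoc1_src in H.
Qed.

Lemma runit0_assoc0 (A B : D) :
  dten1 T (tid A) (mdρ D B) ∘ₜ mdα D ((A, B, mdI D tt) : D3 D) = mdρ D (T (A, B)).
Proof.
have H := f_equal (fun x => src x) (runit1_assoc1 (U A) (U B)).
by rewrite src_cmp dtenc_src src_id !runit1_src assoc1_src in H.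
Qed.

End Kelly.

(** * Adjoint equivalences from inverse tight transformations *)

Section AdjequivOver.
Variables (B : bicat) (D : dblcat) (F G : psfun B (Lb D)).
Variables (θ : psnat F G) (θv : psnat G F) (P : over θ) (Q : over θv).

Lemma src_mark_comp (A A' A'' : D) (M : loose A A') (N : loose A' A'')
    (d : mark N) (c : mark M) :
  src (ce (mark_comp d c)) = src (ce d) ∘ₜ src (ce c).
Proof. by rewrite /= src_cmp counit_src. Qed.

Hypothesis Hθ : is_psnat θ.
Hypothesis Hθv : is_psnat θv.
Hypothesis E : forall X, tid (F X) = src (ce (om Q X)) ∘ₜ src (ce (om P X)).
Hypothesis E' : forall X, src (ce (om P X)) ∘ₜ src (ce (om Q X)) = tid (G X).
Hypothesis H : forall X Y (f : hom X Y),
  cid (psf1 F f : @loose D (F X) (F Y)) = oc Q f • oc P f.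
Hypothesis H' : forall X Y (f : hom X Y),
  oc P f • oc Q f = cid (psf1 G f : @loose D (G X) (G Y)).

Lemma adjequiv_unit_src (X : B) :
  src (ce (om (over_id F) X)) = src (ce (om (over_comp Q P) X)).
Proof. by rewrite src_mark_comp -E src_id. Qed.

Lemma adjequiv_counit_src (X : B) :
  src (ce (om (over_comp P Q) X)) = src (ce (om (over_id G) X)).
Proof. by rewrite src_mark_comp E' src_id. Qed.

Definition adjequiv_unit : imod (pn_id F) (pn_comp θv θ) :=
  imod_over (P := over_id F) (Q := over_comp Q P) adjequiv_unit_src H.
Definition adjequiv_counit : imod (pn_comp θ θv) (pn_id G) :=
  imod_over (P := over_comp P Q) (Q := over_id G) adjequiv_counit_src H'.

(** Unit and counit are canonical cells, so the triangle identities hold by thinness and the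
    equivalence is adjoint as it stands. *)
Definition adjequiv_over : adjequiv θ θv :=
  @AdjEquiv _ _ _ _ θ θv Hθ Hθv adjequiv_unit adjequiv_counit
    (fun X => @triangle_thin (Lb D) (Lb_bicat D) (companion_thin D) (F X) (G X)
      (θ X) (θv X) (om P X) (om Q X) (adjequiv_unit X) (adjequiv_counit X)
      (theta_canonical (adjequiv_unit_src X)) (theta_canonical (adjequiv_counit_src X)))
    (fun X => @trianglev_thin (Lb D) (Lb_bicat D) (companion_thin D) (F X) (G X)
      (θ X) (θv X) (om P X) (om Q X) (adjequiv_unit X) (adjequiv_counit X)
      (theta_canonical (adjequiv_unit_src X)) (theta_canonical (adjequiv_counit_src X))).

End AdjequivOver.

(* [p] is the companion structure that [F] induces on [F M] from [ε]. *)
Definition image_counit (X D : dblcat) (F : dfun X D) (A B : X) (M : loose A B)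
    (ε : cell M (U B)) (p : mark (dfl F M)) : Prop :=
  ce p = dfU' F B • dfc F ε.

Lemma dten_U' (X D : dblcat) (T : dfun (dprod D D) D) (F G : dfun X D) (A : X) :
  gcell (dfU' (dten T F G) A)
  = @dfU' (dprod D D) D T (F A, G A) • dtenc T (gcell (dfU' F A)) (gcell (dfU' G A)).
Proof.
unfold dten, df_comp, gcmp, gcell, mkglob; cbn [dfU' proj1_sig].
reflexivity.
Qed.

Lemma ce_tensor (D : dblcat) (T : dfun (dprod D D) D) (HT : is_dfun T)
    (A A' C C' : D) (M : loose A A') (N : loose C C') (c : mark M) (d : mark N) :
  ce (mark_tensor HT c d) = @dfU' (dprod D D) D T (A', C') • dtenc T (ce c) (ce d).
Proof. by unfold mark_tensor, mark_fun, mark_pair; cbn [ce]. Qed.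

Lemma image_counit_dten (X D : dblcat) (T : dfun (dprod D D) D) (HT : is_dfun T)
    (F G : dfun X D) (A B : X) (M : loose A B) (ε : cell M (U B))
    (p : mark (dfl F M)) (q : mark (dfl G M)) :
  image_counit ε p -> image_counit ε q ->
  @image_counit X D (dten T F G) A B M ε (mark_tensor HT p q).
Proof.
move=> Hp Hq; rewrite /image_counit ce_tensor dten_U' -[RHS]ccmpA.
rewrite -[dfc (dten T F G) ε]/(dtenc T (dfc F ε) (dfc G ε)).
rewrite -dtenc_cmp -Hp -Hq.
reflexivity.
Qed.

(** * The companion constraints lifted to the thin structure *)

Section Lifts.
Variable D : monoidal_dbl.
Local Notation T := (mdT D).
Let HT := mdT_dfun D.
Let HI := mdI_dfun D.
Local Notation S := (companion_thin D).
Local Notation CT := (companion_tensor HT).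

Lemma unit_inv_d31 : unit_inv (d31 D).
Proof. exact: unit_inv_comp (@unit_inv_fst _ _) (@unit_inv_fst _ _). Qed.
Lemma unit_inv_d32 : unit_inv (d32 D).
Proof. exact: unit_inv_comp (@unit_inv_snd _ _) (@unit_inv_fst _ _). Qed.
Lemma unit_inv_d33 : unit_inv (d33 D).
Proof. exact: unit_inv_snd. Qed.
Lemma unit_inv_dunit (X : dblcat) : unit_inv (dunit_at (mdI D) X).
Proof. exact: unit_inv_comp (dfU_inv HI) (@unit_inv_bang _). Qed.

Lemma unit_inv_assoc_src : unit_inv (dten T (dten T (d31 D) (d32 D)) (d33 D)).
Proof.
exact: unit_inv_dten HT (unit_inv_dten HT unit_inv_d31 unit_inv_d32) unit_inv_d33.
Qed.

Lemma unit_inv_assoc_tgt : unit_inv (dten T (d31 D) (dten T (d32 D) (d33 D))).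
Proof.
exact: unit_inv_dten HT unit_inv_d31 (unit_inv_dten HT unit_inv_d32 unit_inv_d33).
Qed.

Lemma unit_inv_lunit_src : unit_inv (dten T (dunit_at (mdI D) D) (df_id D)).
Proof. exact: unit_inv_dten HT (@unit_inv_dunit _) (@unit_inv_id _). Qed.

Lemma unit_inv_runit_src : unit_inv (dten T (df_id D) (dunit_at (mdI D) D)).
Proof. exact: unit_inv_dten HT (@unit_inv_id _) (@unit_inv_dunit _). Qed.

Section AssocCounits.
Variables (A A' B B' C C' : D) (M : loose A A') (N : loose B B') (P : loose C C').
Variables (c : mark M) (d : mark N) (e : mark P).
Local Notation MNP := ((M, N, P) : @loose (D3 D) (A, B, C) (A', B', C')).
Let ε : cell MNP (U ((A', B', C') : D3 D)) := (ce c, ce d, ce e).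

Lemma image_counit_d31 : @image_counit (D3 D) D (d31 D) _ _ MNP ε c.
Proof. by symmetry; refine (etrans (f_equal (fun x => x • _) (ccmp1l _)) (ccmp1l _)). Qed.

Lemma image_counit_d32 : @image_counit (D3 D) D (d32 D) _ _ MNP ε d.
Proof. by symmetry; refine (etrans (f_equal (fun x => x • _) (ccmp1l _)) (ccmp1l _)). Qed.

Lemma image_counit_d33 : @image_counit (D3 D) D (d33 D) _ _ MNP ε e.
Proof. by symmetry; refine (ccmp1l _). Qed.

Lemma image_counit_assoc_src :
  @image_counit (D3 D) D (dten T (dten T (d31 D) (d32 D)) (d33 D)) _ _ MNP ε
    (mark_tensor HT (mark_tensor HT c d) e).
Proof.
exact (@image_counit_dten (D3 D) D T HT (dten T (d31 D) (d32 D)) (d33 D) _ _ MNP ε _ _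
  (@image_counit_dten (D3 D) D T HT (d31 D) (d32 D) _ _ MNP ε _ _
    image_counit_d31 image_counit_d32) image_counit_d33).
Qed.

Lemma image_counit_assoc_tgt :
  @image_counit (D3 D) D (dten T (d31 D) (dten T (d32 D) (d33 D))) _ _ MNP ε
    (mark_tensor HT c (mark_tensor HT d e)).
Proof.
exact (@image_counit_dten (D3 D) D T HT (d31 D) (dten T (d32 D) (d33 D)) _ _ MNP ε _ _
  image_counit_d31 (@image_counit_dten (D3 D) D T HT (d32 D) (d33 D) _ _ MNP ε _ _
    image_counit_d32 image_counit_d33)).
Qed.

End AssocCounits.

Definition mark_unit : mark (@dfl dterm D (mdI D) tt tt tt) :=
  mark_fun HI (@mark_term tt tt tt).

Lemma ce_mark_unit :
  ce mark_unit = @dfU' dterm D (mdI D) tt • @dfc dterm D (mdI D) tt tt tt tt tt tt tt.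
Proof. by unfold mark_unit, mark_fun; cbn [ce]. Qed.

Lemma dfc_unit :
  @dfc dterm D (mdI D) tt tt tt tt tt tt tt = cid (@dfl dterm D (mdI D) tt tt tt).
Proof. exact (@dfc_id dterm D (mdI D) tt tt tt). Qed.

Lemma canonical_unit_O :
  canonical (mark_comp mark_unit mark_unit) mark_unit (@dfO dterm D (mdI D) tt tt tt tt tt).
Proof.
have H := @canonical_dfO dterm D (mdI D) HI tt tt tt tt tt (@mark_term tt tt tt)
  (@mark_term tt tt tt).
exact H.
Qed.

Lemma canonical_unit_U :
  canonical (mark_id (mdI D tt)) mark_unit (@dfU dterm D (mdI D) tt).
Proof. exact (@canonical_dfU dterm D (mdI D) HI tt). Qed.

Definition companion_unit : lift_unit S (LU D).
Proof.
refine (@LiftUnit (Lb D) S (LU D) (fun X Y f => mark_unit) _ _ _ _ _).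
- move=> X Y f g α.
  exact (etrans (f_equal (fun x => ce mark_unit • x) dfc_unit) (ccmp1r (ce mark_unit))).
- by move=> X Y Z f g; rewrite Lunit_C; exact: canonical_unit_O.
- move=> X Y Z f g; rewrite Lunit_C'.
  exact: (canonical_inv (@dfO_inv dterm D (mdI D) HI tt tt tt tt tt) canonical_unit_O).
- by move=> X; rewrite Lunit_U; exact: canonical_unit_U.
- move=> X; rewrite Lunit_U'.
  exact: (canonical_inv (@dfU_inv dterm D (mdI D) HI tt) canonical_unit_U).
Defined.

Section UnitCounits.
Variables (A A' : D) (M : loose A A') (c : mark M).

Lemma image_counit_dunit :
  @image_counit D D (dunit_at (mdI D) D) A A' M (ce c) mark_unit.
Proof.
rewrite /image_counit ce_mark_unit; congr (_ • _).
refine (etrans _ (esym (f_equal (fun x => gcell (dfU' (mdI D) tt) • x) dfc_unit))).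
by rewrite ccmp1r.
Qed.

Lemma image_counit_id : @image_counit D D (df_id D) A A' M (ce c) c.
Proof. by rewrite /image_counit /= ccmp1l. Qed.

Lemma image_counit_lunit_src :
  @image_counit D D (dten T (dunit_at (mdI D) D) (df_id D)) A A' M (ce c)
    (mark_tensor HT mark_unit c).
Proof.
exact (@image_counit_dten D D T HT (dunit_at (mdI D) D) (df_id D) A A' M (ce c) _ _
  image_counit_dunit image_counit_id).
Qed.

Lemma image_counit_runit_src :
  @image_counit D D (dten T (df_id D) (dunit_at (mdI D) D)) A A' M (ce c)
    (mark_tensor HT c mark_unit).
Proof.
exact (@image_counit_dten D D T HT (df_id D) (dunit_at (mdI D) D) A A' M (ce c) _ _
  image_counit_id image_counit_dunit).
Qed.

End UnitCounits.

Section ConstraintLifts.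
Variable c : constraint_companions D.

Lemma canonical_α (A A' B B' C C' : D) (f : loose A A') (g : loose B B')
    (h : loose C C') (m : mark f) (n : mark g) (p : mark h) :
  canonical (mark_comp (mark_companion (ccα c ((A', B', C') : D3 D)))
      (mark_tensor HT (mark_tensor HT m n) p))
    (mark_comp (mark_tensor HT m (mark_tensor HT n p)) (mark_companion (ccα c ((A, B, C) : D3 D))))
    (@hat (D3 D) D _ _ (mdα D) (ccα c) (A, B, C) (A', B', C') (f, g, h)).
Proof.
exact (@canonical_hat (D3 D) D _ _ (mdα D) (ccα c) (A, B, C) (A', B', C') (f, g, h) _ _ _
  unit_inv_assoc_src unit_inv_assoc_tgt
  (image_counit_assoc_src m n p) (image_counit_assoc_tgt m n p)).
Qed.

Definition lift_α : lift_assoc CT (Lα c) :=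
  @LiftAssoc (Lb D) S (LT D) CT (Lα c)
    (fun A B C => mark_companion (ccα c ((A, B, C) : D3 D)))
    (fun A A' B B' C C' f g h m n p => canonical_α m n p)
    (fun A A' B B' C C' f g h m n p => canonical_inv
      (@sc_invP (D3 D) D _ _ (mdα D) (ccα c) (A, B, C) (A', B', C') (f, g, h))
      (canonical_α m n p)).

Lemma canonical_αv (A A' B B' C C' : D) (f : loose A A') (g : loose B B')
    (h : loose C C') (m : mark f) (n : mark g) (p : mark h) :
  canonical (mark_comp (mark_companion (ccαv c ((A', B', C') : D3 D)))
      (mark_tensor HT m (mark_tensor HT n p)))
    (mark_comp (mark_tensor HT (mark_tensor HT m n) p) (mark_companion (ccαv c ((A, B, C) : D3 D))))
    (@hat (D3 D) D _ _ (mdαv D) (ccαv c) (A, B, C) (A', B', C') (f, g, h)).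
Proof.
exact (@canonical_hat (D3 D) D _ _ (mdαv D) (ccαv c) (A, B, C) (A', B', C') (f, g, h) _ _ _
  unit_inv_assoc_tgt unit_inv_assoc_src
  (image_counit_assoc_tgt m n p) (image_counit_assoc_src m n p)).
Qed.

Definition lift_αv : lift_assocv CT (Lαv c) :=
  @LiftAssocv (Lb D) S (LT D) CT (Lαv c)
    (fun A B C => mark_companion (ccαv c ((A, B, C) : D3 D)))
    (fun A A' B B' C C' f g h m n p => canonical_αv m n p)
    (fun A A' B B' C C' f g h m n p => canonical_inv
      (@sc_invP (D3 D) D _ _ (mdαv D) (ccαv c) (A, B, C) (A', B', C') (f, g, h))
      (canonical_αv m n p)).

Lemma canonical_λ (A B : D) (f : loose A B) (m : mark f) :
  canonical (mark_comp (mark_companion (ccλ c B)) (mark_tensor HT mark_unit m))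
    (mark_comp m (mark_companion (ccλ c A))) (@hat D D _ _ (mdλ D) (ccλ c) A B f).
Proof.
exact (@canonical_hat D D _ _ (mdλ D) (ccλ c) A B f _ _ _
  unit_inv_lunit_src (@unit_inv_id D) (image_counit_lunit_src m) (image_counit_id m)).
Qed.

Definition lift_λ : lift_lunit CT companion_unit (Lλ c) :=
  @LiftLunit (Lb D) S (LT D) CT (LU D) companion_unit (Lλ c)
    (fun A => mark_companion (ccλ c A))
    (fun A B f m => canonical_λ m)
    (fun A B f m => canonical_inv (@sc_invP D D _ _ (mdλ D) (ccλ c) A B f) (canonical_λ m)).

Lemma canonical_ρ (A B : D) (f : loose A B) (m : mark f) :
  canonical (mark_comp (mark_companion (ccρ c B)) (mark_tensor HT m mark_unit))
    (mark_comp m (mark_companion (ccρ c A))) (@hat D D _ _ (mdρ D) (ccρ c) A B f).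
Proof.
exact (@canonical_hat D D _ _ (mdρ D) (ccρ c) A B f _ _ _
  unit_inv_runit_src (@unit_inv_id D) (image_counit_runit_src m) (image_counit_id m)).
Qed.

Definition lift_ρ : lift_runit CT companion_unit (Lρ c) :=
  @LiftRunit (Lb D) S (LT D) CT (LU D) companion_unit (Lρ c)
    (fun A => mark_companion (ccρ c A))
    (fun A B f m => canonical_ρ m)
    (fun A B f m => canonical_inv (@sc_invP D D _ _ (mdρ D) (ccρ c) A B f) (canonical_ρ m)).

End ConstraintLifts.
End Lifts.

Section BraidLift.
Variables (D : braided_dbl) (c : braid_companions D).
Let HT := mdT_dfun D.
Local Notation S := (companion_thin D).
Local Notation CT := (companion_tensor HT).

Lemma canonical_β (A A' B B' : D) (f : loose A A') (g : loose B B')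
    (m : mark f) (n : mark g) :
  canonical (mark_comp (mark_companion (ccβ c ((A', B') : D2 D))) (mark_tensor HT m n))
    (mark_comp (mark_tensor HT n m) (mark_companion (ccβ c ((A, B) : D2 D))))
    (@hat (D2 D) D _ _ (bdβ D) (ccβ c) (A, B) (A', B') (f, g)).
Proof.
exact (@canonical_hat (D2 D) D _ _ (bdβ D) (ccβ c) (A, B) (A', B') (f, g) _ _ (ce m, ce n)
  (unit_inv_dten HT (@unit_inv_fst D D) (@unit_inv_snd D D))
  (unit_inv_dten HT (@unit_inv_snd D D) (@unit_inv_fst D D))
  (@image_counit_dten (D2 D) D (mdT D) HT (d21 D) (d22 D) (A, B) (A', B') (f, g)
    (ce m, ce n) m n (esym (ccmp1l (ce m))) (esym (ccmp1l (ce n))))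
  (@image_counit_dten (D2 D) D (mdT D) HT (d22 D) (d21 D) (A, B) (A', B') (f, g)
    (ce m, ce n) n m (esym (ccmp1l (ce n))) (esym (ccmp1l (ce m))))).
Qed.

Definition lift_β : lift_braid CT (Lβ c) :=
  @LiftBraid (Lb D) S (LT D) CT (Lβ c) (fun A B => mark_companion (ccβ c ((A, B) : D2 D)))
    (fun A A' B B' f g m n => canonical_β m n)
    (fun A A' B B' f g m n => canonical_inv
      (@sc_invP (D2 D) D _ _ (bdβ D) (ccβ c) (A, B) (A', B') (f, g)) (canonical_β m n)).

End BraidLift.

(* Two iterated companions must be compared head first: expanding them to their
   constituents is exponential in the nesting. *)
Strategy 1000 [mark_comp mark_tensor mark_companion mark_id theta].

(** * The monoidal structure *)

Section Final.
Variable D : monoidal_dbl.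
Local Notation T := (mdT D).
Local Notation K := (Lb D).
Let HT := mdT_dfun D.
Variable c : constraint_companions D.
Local Notation CT := (companion_tensor HT).

Lemma src_companion (E : dblcat) (A B : E) (f : tight A B) (k : companion f) :
  src (ce (mark_companion k)) = f.
Proof. exact: ceps_src. Qed.

Lemma src_tensor (A A' C C' : D) (M : loose A A') (N : loose C C') (m : mark M) (n : mark N) :
  src (ce (mark_tensor HT m n)) = dten1 T (src (ce m)) (src (ce n)).
Proof. by rewrite ce_tensor src_cmp gsrc tcmp1l dtenc_src. Qed.

(** With the sources of the parts as arguments, the tight 1-cell under a nested pasting is assembled
    as a term, without unfolding the iterated marks. *)
Lemma over_comp_src (B : bicat) (F G H : psfun B K) (θ' : psnat G H) (θ : psnat F G)
    (P' : over θ') (P : over θ) (X : B) (g : @tight D (G X) (H X)) (f : @tight D (F X) (G X)) :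
  src (ce (om P' X)) = g -> src (ce (om P X)) = f ->
  src (ce (om (over_comp P' P) X)) = g ∘ₜ f.
Proof. by move=> <- <-; exact: src_mark_comp. Qed.

Lemma over_id_src (B : bicat) (F : psfun B K) (X : B) :
  src (ce (om (over_id F) X)) = tid (F X).
Proof. exact: src_id. Qed.

Lemma over_tensor_src (B : bicat) (F F' G G' : psfun B K) (θ : psnat F F') (κ : psnat G G')
    (P : over θ) (Q : over κ) (X : B)
    (f : @tight D (F X) (F' X)) (g : @tight D (G X) (G' X)) :
  src (ce (om P X)) = f -> src (ce (om Q X)) = g ->
  src (ce (om (over_tensor HT P Q) X)) = dten1 T f g.
Proof. by move=> <- <-; exact: src_tensor. Qed.

Section At.
Variables (X : bicat) (F G H : psfun X K).

Definition over_assoc_at : over (assoc_at F G H (Lα c)) :=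
  @Over X D _ _ (assoc_at F G H (Lα c))
    (fun x => mark_companion (ccα c ((F x, G x, H x) : D3 D)))
    (fun x y f => @dtc (D3 D) D _ _ (mdα D) (F x, G x, H x) (F y, G y, H y)
      (psf1 F f, psf1 G f, psf1 H f))
    (fun x y f => @hat_square D (D3 D) _ _ (mdα D) (ccα c) (F x, G x, H x) (F y, G y, H y)
      (psf1 F f, psf1 G f, psf1 H f)).

Definition over_lunit_at : over (lunit_at F (Lλ c)) :=
  @Over X D _ _ (lunit_at F (Lλ c)) (fun x => mark_companion (ccλ c (F x)))
    (fun x y f => @dtc D D _ _ (mdλ D) (F x) (F y) (psf1 F f))
    (fun x y f => @hat_square D D _ _ (mdλ D) (ccλ c) (F x) (F y) (psf1 F f)).

Definition over_runit_at : over (runit_at F (Lρ c)) :=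
  @Over X D _ _ (runit_at F (Lρ c)) (fun x => mark_companion (ccρ c (F x)))
    (fun x y f => @dtc D D _ _ (mdρ D) (F x) (F y) (psf1 F f))
    (fun x y f => @hat_square D D _ _ (mdρ D) (ccρ c) (F x) (F y) (psf1 F f)).

Lemma over_assoc_at_src (x : X) :
  src (ce (om over_assoc_at x)) = mdα D ((F x, G x, H x) : D3 D).
Proof. exact: ceps_src. Qed.

Lemma over_lunit_at_src (x : X) : src (ce (om over_lunit_at x)) = mdλ D (F x).
Proof. exact: ceps_src. Qed.

Lemma over_runit_at_src (x : X) : src (ce (om over_runit_at x)) = mdρ D (F x).
Proof. exact: ceps_src. Qed.
End At.

Definition Ladj_α : adjequiv (Lα c) (Lαv c).
Proof.
refine (@adjequiv_over (B3 K) D _ _ (Lα c) (Lαv c) (over_α c) (over_αv c)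
  (psnat_α c) (psnat_αv c) _ _ _ _).
- by move=> X; rewrite !src_companion; symmetry; exact ((mdα_inv D).1 X).1.
- by move=> X; rewrite !src_companion; exact ((mdα_inv D).1 X).2.
- by move=> X Y f; symmetry; exact ((mdα_inv D).2 X Y f).1.
- by move=> X Y f; exact ((mdα_inv D).2 X Y f).2.
Defined.

Definition Ladj_λ : adjequiv (Lλ c) (Lλv c).
Proof.
refine (@adjequiv_over K D _ _ (Lλ c) (Lλv c) (over_λ c) (over_λv c)
  (psnat_λ c) (psnat_λv c) _ _ _ _).
- by move=> X; rewrite !src_companion; symmetry; exact ((mdλ_inv D).1 X).1.
- by move=> X; rewrite !src_companion; exact ((mdλ_inv D).1 X).2.
- by move=> X Y f; symmetry; exact ((mdλ_inv D).2 X Y f).1.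
- by move=> X Y f; exact ((mdλ_inv D).2 X Y f).2.
Defined.

Definition Ladj_ρ : adjequiv (Lρ c) (Lρv c).
Proof.
refine (@adjequiv_over K D _ _ (Lρ c) (Lρv c) (over_ρ c) (over_ρv c)
  (psnat_ρ c) (psnat_ρv c) _ _ _ _).
- by move=> X; rewrite !src_companion; symmetry; exact ((mdρ_inv D).1 X).1.
- by move=> X; rewrite !src_companion; exact ((mdρ_inv D).1 X).2.
- by move=> X Y f; symmetry; exact ((mdρ_inv D).2 X Y f).1.
- by move=> X Y f; exact ((mdρ_inv D).2 X Y f).2.
Defined.

(** The two sides of the pentagon as companion transformations. [Lpent0], the pentagon for tight
    1-cells, yields the components of the pentagonator, and [Lpent1], the pentagon for 2-cells, its
    naturality; the other modifications are built likewise. *)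
Definition Lpent_src := over_comp (over_comp
    (over_tensor HT (over_id p41) (over_assoc_at p42 p43 p44))
    (over_assoc_at p41 (ten (LT D) p42 p43) p44))
  (over_tensor HT (over_assoc_at p41 p42 p43) (over_id p44)).
Definition Lpent_tgt := over_comp (over_assoc_at p41 p42 (ten (LT D) p43 p44))
  (over_assoc_at (ten (LT D) p41 p42) p43 p44).

Lemma Lpent0 (X : B4 K) : src (ce (om Lpent_src X)) = src (ce (om Lpent_tgt X)).
Proof.
have H := md_pentagon0 (m := D) X.1.1.1 X.1.1.2 X.1.2 X.2.
refine (etrans (over_comp_src (over_comp_src (over_tensor_src (over_id_src p41 X)
  (over_assoc_at_src p42 p43 p44 X)) (over_assoc_at_src p41 (ten (LT D) p42 p43) p44 X))
  (over_tensor_src (over_assoc_at_src p41 p42 p43 X) (over_id_src p44 X))) _).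
refine (etrans _ (esym (over_comp_src (over_assoc_at_src p41 p42 (ten (LT D) p43 p44) X)
  (over_assoc_at_src (ten (LT D) p41 p42) p43 p44 X)))).
exact H.
Qed.

Lemma Lpent1 (X Y : B4 K) (f : hom X Y) : oc Lpent_src f = oc Lpent_tgt f.
Proof.
exact (md_pentagon1 (m := D) f.1.1.1 f.1.1.2 f.1.2 f.2).
Qed.

Definition Lpent : pentagonator_type (Lα c) := imod_over Lpent0 Lpent1.

Local Notation I := (LU D).

Definition Lmid_src := over_comp (over_tensor HT (over_id p21) (over_lunit_at p22))
  (over_assoc_at p21 (unit_at I (B2 K)) p22).
Definition Lmid_tgt := over_tensor HT (over_runit_at p21) (over_id p22).

Lemma Lmid0 (X : B2 K) : src (ce (om Lmid_src X)) = src (ce (om Lmid_tgt X)).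
Proof.
have H := md_triangle0 (m := D) X.1 X.2.
refine (etrans (over_comp_src (over_tensor_src (over_id_src p21 X) (over_lunit_at_src p22 X))
  (over_assoc_at_src p21 (unit_at I (B2 K)) p22 X)) _).
refine (etrans _ (esym (over_tensor_src (over_runit_at_src p21 X) (over_id_src p22 X)))).
exact H.
Qed.

Lemma Lmid1 (X Y : B2 K) (f : hom X Y) : oc Lmid_src f = oc Lmid_tgt f.
Proof. exact (md_triangle1 (m := D) f.1 f.2). Qed.

Definition Lmid : munit_type (Lα c) (Lλ c) (Lρ c) := imod_over Lmid0 Lmid1.

Definition Lleft_src := over_comp (over_lunit_at (ten (LT D) p21 p22))
  (over_assoc_at (unit_at I (B2 K)) p21 p22).
Definition Lleft_tgt := over_tensor HT (over_lunit_at p21) (over_id p22).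

Lemma Lleft0 (X : B2 K) : src (ce (om Lleft_src X)) = src (ce (om Lleft_tgt X)).
Proof.
have H := lunit0_assoc0 X.1 X.2.
refine (etrans (over_comp_src (over_lunit_at_src (ten (LT D) p21 p22) X)
  (over_assoc_at_src (unit_at I (B2 K)) p21 p22 X)) _).
refine (etrans _ (esym (over_tensor_src (over_lunit_at_src p21 X) (over_id_src p22 X)))).
exact H.
Qed.

Lemma Lleft1 (X Y : B2 K) (f : hom X Y) : oc Lleft_src f = oc Lleft_tgt f.
Proof. exact (lunit1_assoc1 f.1 f.2). Qed.

Definition Lleft : lunitor_type (Lα c) (Lλ c) := imod_over Lleft0 Lleft1.

Definition Lright_src := over_comp (over_tensor HT (over_id p21) (over_runit_at p22))
  (over_assoc_at p21 p22 (unit_at I (B2 K))).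
Definition Lright_tgt := over_runit_at (ten (LT D) p21 p22).

Lemma Lright0 (X : B2 K) : src (ce (om Lright_src X)) = src (ce (om Lright_tgt X)).
Proof.
have H := runit0_assoc0 X.1 X.2.
refine (etrans (over_comp_src (over_tensor_src (over_id_src p21 X) (over_runit_at_src p22 X))
  (over_assoc_at_src p21 p22 (unit_at I (B2 K)) X)) _).
refine (etrans _ (esym (over_runit_at_src (ten (LT D) p21 p22) X))).
exact H.
Qed.

Lemma Lright1 (X Y : B2 K) (f : hom X Y) : oc Lright_src f = oc Lright_tgt f.
Proof. exact (runit1_assoc1 f.1 f.2). Qed.

Definition Lright : runitor_type (Lα c) (Lρ c) := imod_over Lright0 Lright1.

Lemma Lmid_can : munit_can (lift_α c) (lift_λ c) (lift_ρ c) Lmid.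
Proof.
apply: mcell_can => X.
exact (imod_over_canonical Lmid0 Lmid1 X).
Qed.

Lemma Lleft_can : lunitor_can (lift_α c) (lift_λ c) Lleft.
Proof.
apply: lcell_can => X.
exact (imod_over_canonical Lleft0 Lleft1 X).
Qed.

Lemma Lright_can : runitor_can (lift_α c) (lift_ρ c) Lright.
Proof.
apply: rcell_can => X.
exact (imod_over_canonical Lright0 Lright1 X).
Qed.

Lemma Lpent_can : pentagonator_can (lift_α c) (pent Lpent).
Proof.
apply: pent_can => X.
exact (imod_over_canonical Lpent0 Lpent1 X).
Qed.

Lemma Ladj_α_can : adjequiv_can (lift_α c) (lift_αv c) Ladj_α.
Proof.
split=> A B C.
(* By computation the component of the unit is a [theta]; the inverse law left as a hole is read off
   from [Ladj_α] by unification. *)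
exact (@theta_canonical D _ _ _ _ _ _ (@adjequiv_unit_src (B3 K) D _ _ (Lα c) (Lαv c)
  (over_α c) (over_αv c) (fun X => _) (A, B, C))).
exact (@theta_canonical D _ _ _ _ _ _ (@adjequiv_counit_src (B3 K) D _ _ (Lα c) (Lαv c)
  (over_α c) (over_αv c) (fun X => _) (A, B, C))).
Qed.

Definition loose_monoidal : monoidal_bicat (Lmon c) :=
  @MonoidalBicat K (Lmon c) (Lb_bicat D) (Ltensor_psfun (mdT_dfun D)) (Lunit_psfun (mdI_dfun D))
    Ladj_α Ladj_λ Ladj_ρ Lpent Lmid Lleft Lright
    (assoc_axiom_thin (Lb_bicat D) Lpent_can) (left_unit_axiom_thin (Lb_bicat D) Lpent_can Lmid_can Lleft_can)
    (right_unit_axiom_thin (Lb_bicat D) Lpent_can Lmid_can Lright_can).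

End Final.

(** * Braiding and symmetry *)

Section Braided.
Variable D : braided_dbl.
Local Notation T := (mdT D).
Local Notation K := (Lb D).
Let HT := mdT_dfun D.
Variables (c : constraint_companions D) (cb : braid_companions D).

Section At.
Variables (X : bicat) (F G H : psfun X K).

Definition over_braid_at : over (braid_at F G (Lβ cb)) :=
  @Over X D _ _ (braid_at F G (Lβ cb))
    (fun x => mark_companion (ccβ cb ((F x, G x) : D2 D)))
    (fun x y f => @dtc (D2 D) D _ _ (bdβ D) (F x, G x) (F y, G y) (psf1 F f, psf1 G f))
    (fun x y f => @hat_square D (D2 D) _ _ (bdβ D) (ccβ cb) (F x, G x) (F y, G y)
      (psf1 F f, psf1 G f)).

Lemma over_braid_at_src (x : X) :
  src (ce (om over_braid_at x)) = bdβ D ((F x, G x) : D2 D).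
Proof. exact: ceps_src. Qed.

Definition over_assoc_rev_at : over (assoc_at F G H (assoc_rev (Lαv c))) :=
  @Over X D _ _ (assoc_at F G H (assoc_rev (Lαv c)))
    (fun x => mark_companion (ccαv c ((H x, G x, F x) : D3 D)))
    (fun x y f => @dtc (D3 D) D _ _ (mdαv D) (H x, G x, F x) (H y, G y, F y)
      (psf1 H f, psf1 G f, psf1 F f))
    (fun x y f => @hat_square D (D3 D) _ _ (mdαv D) (ccαv c) (H x, G x, F x) (H y, G y, F y)
      (psf1 H f, psf1 G f, psf1 F f)).

Lemma over_assoc_rev_at_src (x : X) :
  src (ce (om over_assoc_rev_at x)) = mdαv D ((H x, G x, F x) : D3 D).
Proof. exact: ceps_src. Qed.

Definition over_braid_rev_at : over (braid_at F G (braid_rev (Lβ cb))) :=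
  @Over X D _ _ (braid_at F G (braid_rev (Lβ cb)))
    (fun x => mark_companion (ccβ cb ((G x, F x) : D2 D)))
    (fun x y f => @dtc (D2 D) D _ _ (bdβ D) (G x, F x) (G y, F y) (psf1 G f, psf1 F f))
    (fun x y f => @hat_square D (D2 D) _ _ (bdβ D) (ccβ cb) (G x, F x) (G y, F y)
      (psf1 G f, psf1 F f)).

Lemma over_braid_rev_at_src (x : X) :
  src (ce (om over_braid_rev_at x)) = bdβ D ((G x, F x) : D2 D).
Proof. exact: ceps_src. Qed.
End At.

Lemma over_tensor_rev_src (B : bicat) (F F' G G' : psfun B K) (θ : psnat F F') (κ : psnat G G')
    (P : over θ) (Q : over κ) (X : B)
    (f : @tight D (F X) (F' X)) (g : @tight D (G X) (G' X)) :
  src (ce (om P X)) = f -> src (ce (om Q X)) = g ->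
  src (ce (om (over_tensor_rev HT P Q) X)) = dten1 T g f.
Proof. by move=> <- <-; exact: src_tensor. Qed.

Definition Ladj_β : adjequiv (Lβ cb) (Lβv cb).
Proof.
refine (@adjequiv_over (B2 K) D _ _ (Lβ cb) (Lβv cb) (over_β cb) (over_βv cb)
  (psnat_β cb) (psnat_βv cb) _ _ _ _).
- by move=> X; rewrite !src_companion; symmetry; exact ((bdβ_inv D).1 X).1.
- by move=> X; rewrite !src_companion; exact ((bdβ_inv D).1 X).2.
- by move=> X Y f; symmetry; exact ((bdβ_inv D).2 X Y f).1.
- by move=> X Y f; exact ((bdβ_inv D).2 X Y f).2.
Defined.

Definition Lhex_src := over_comp
  (over_comp (over_assoc_at c p32 p33 p31) (over_braid_at p31 (ten (LT D) p32 p33)))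
  (over_assoc_at c p31 p32 p33).
Definition Lhex_tgt := over_comp
  (over_comp (over_tensor HT (over_id p32) (over_braid_at p31 p33)) (over_assoc_at c p32 p31 p33))
  (over_tensor HT (over_braid_at p31 p32) (over_id p33)).

Lemma Lhex0 (X : B3 K) : src (ce (om Lhex_src X)) = src (ce (om Lhex_tgt X)).
Proof.
have H := bd_hexagon0 (b := D) X.1.1 X.1.2 X.2.
refine (etrans (over_comp_src (over_comp_src (over_assoc_at_src c p32 p33 p31 X)
  (over_braid_at_src p31 (ten (LT D) p32 p33) X)) (over_assoc_at_src c p31 p32 p33 X)) _).
refine (etrans _ (esym (over_comp_src (over_comp_src (over_tensor_src (over_id_src p32 X)
  (over_braid_at_src p31 p33 X)) (over_assoc_at_src c p32 p31 p33 X))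
  (over_tensor_src (over_braid_at_src p31 p32 X) (over_id_src p33 X))))).
exact H.
Qed.

Lemma Lhex1 (X Y : B3 K) (f : hom X Y) : oc Lhex_src f = oc Lhex_tgt f.
Proof. exact (bd_hexagon1 (b := D) f.1.1 f.1.2 f.2). Qed.

Definition Lhex : hexagonator_type (Lα c) (Lβ cb) := imod_over Lhex0 Lhex1.

Definition Lhexv_src := over_comp
  (over_comp (over_assoc_rev_at p32 p33 p31) (over_braid_rev_at p31 (ten (trev (LT D)) p32 p33)))
  (over_assoc_rev_at p31 p32 p33).
Definition Lhexv_tgt := over_comp
  (over_comp (over_tensor_rev HT (over_id p32) (over_braid_rev_at p31 p33))
    (over_assoc_rev_at p32 p31 p33))
  (over_tensor_rev HT (over_braid_rev_at p31 p32) (over_id p33)).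

Lemma Lhexv0 (X : B3 K) : src (ce (om Lhexv_src X)) = src (ce (om Lhexv_tgt X)).
Proof.
(* The second hexagonator belongs to the reversed structure, so the tight hexagon is taken at the
   reversed triple of objects. *)
have H := bd_hexagonv0 (b := D) X.2 X.1.2 X.1.1.
refine (etrans (over_comp_src (over_comp_src (over_assoc_rev_at_src p32 p33 p31 X)
  (over_braid_rev_at_src p31 (ten (trev (LT D)) p32 p33) X))
  (over_assoc_rev_at_src p31 p32 p33 X)) _).
refine (etrans _ (esym (over_comp_src (over_comp_src (over_tensor_rev_src (over_id_src p32 X)
  (over_braid_rev_at_src p31 p33 X)) (over_assoc_rev_at_src p32 p31 p33 X))
  (over_tensor_rev_src (over_braid_rev_at_src p31 p32 X) (over_id_src p33 X))))).
exact H.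
Qed.

Lemma Lhexv1 (X Y : B3 K) (f : hom X Y) : oc Lhexv_src f = oc Lhexv_tgt f.
Proof. exact (bd_hexagonv1 (b := D) f.2 f.1.2 f.1.1). Qed.

Definition Lhexv : hexagonatorv_type (Lβ cb) (Lαv c) := imod_over Lhexv0 Lhexv1.

Lemma Lhex_can : hexagonator_can (lift_α c) (lift_β cb) (hexa Lhex).
Proof.
apply: hexa_can => X.
exact (imod_over_canonical Lhex0 Lhex1 X).
Qed.

Lemma Lhexv_can : hexagonatorv_can (lift_αv c) (lift_β cb) Lhexv.
Proof.
apply: hexa_can => X.
exact (imod_over_canonical Lhexv0 Lhexv1 X).
Qed.

Definition loose_braided : braided_bicat (loose_monoidal c) (Lβ cb) (Lβv cb) :=
  @BraidedBicat K (Lmon c) (loose_monoidal c) (Lβ cb) (Lβv cb) Ladj_β Lhex Lhexv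
    (braid_axiom_13_thin (Lb_bicat D) (Lpent_can c) (pent_can' (Lpent_can c)) (hexa_can' Lhex_can))
    (braid_axiom_31_thin (Lb_bicat D) (Ladj_α_can c) (Lpent_can c) Lhexv_can)
    (braid_axiom_22_thin (Lb_bicat D) (Ladj_α_can c) (Lpent_can c) Lhex_can Lhexv_can)
    (braid_axiom_YB_thin (Lb_bicat D) (Ladj_α_can c) Lhex_can Lhexv_can).

Section Symmetric.
Hypothesis sym : is_symmetric_dbl D.

Definition Lsyl_tgt := over_comp (over_braid_at p22 p21) (over_braid_at p21 p22).

Lemma Lsyl0 (X : B2 K) :
  src (ce (om (over_id (ten (LT D) p21 p22)) X)) = src (ce (om Lsyl_tgt X)).
Proof.
refine (etrans (over_id_src (ten (LT D) p21 p22) X) (etrans (esym (sym.1 X.1 X.2)) _)).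
exact (esym (over_comp_src (over_braid_at_src p22 p21 X) (over_braid_at_src p21 p22 X))).
Qed.

Lemma Lsyl1 (X Y : B2 K) (f : hom X Y) :
  oc (over_id (ten (LT D) p21 p22)) f = oc Lsyl_tgt f.
Proof. exact (esym (sym.2 X.1 X.2 Y.1 Y.2 f.1 f.2)). Qed.

Definition Lsyl : syllepsis_type (Lβ cb) := imod_over Lsyl0 Lsyl1.

Lemma Lsyl_can : syllepsis_can (lift_β cb) Lsyl.
Proof.
apply: sycell_can => X.
exact (imod_over_canonical Lsyl0 Lsyl1 X).
Qed.

Definition loose_symmetric : symmetric_bicat loose_braided :=
  @SymmetricBicat K (Lmon c) (loose_monoidal c) (Lβ cb) (Lβv cb) loose_braided Lsyl
    (syllepsis_axiom_12_thin (Lb_bicat D) (Ladj_α_can c) Lhex_can Lhexv_can Lsyl_can)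
    (syllepsis_axiom_21_thin (Lb_bicat D) (Ladj_α_can c) Lhex_can Lhexv_can Lsyl_can)
    (symmetry_axiom_thin (Lb_bicat D) Lsyl_can).

End Symmetric.
End Braided.

Theorem theorem1p1 :
  (forall (D : monoidal_dbl) (c : constraint_companions D),
     inhabited (monoidal_bicat (Lmon c)))
  /\ (forall (D : braided_dbl) (c : constraint_companions D) (cb : braid_companions D),
        exists m : monoidal_bicat (Lmon c),
          inhabited (braided_bicat m (Lβ cb) (Lβv cb)))
  /\ (forall (D : braided_dbl) (sym : is_symmetric_dbl D)
        (c : constraint_companions D) (cb : braid_companions D),
        exists (m : monoidal_bicat (Lmon c))
               (br : braided_bicat m (Lβ cb) (Lβv cb)),
          inhabited (symmetric_bicat br)).
Proof.
split; first by move=> D c; exact: (inhabits (loose_monoidal c)).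
split.
- by move=> D c cb; exists (loose_monoidal c); exact: (inhabits (loose_braided c cb)).
- move=> D sym c cb; exists (loose_monoidal c), (loose_braided c cb).
  exact: (inhabits (loose_symmetric c cb sym)).
Qed.
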